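(* Let $\Bbbk$ be a field of characteristic zero, let $n,k\in\mathbb{N}$, and let $\lambda$ be a nonzero dominant integral weight of $\mathfrak{sl}_\infty$. Under the inclusion of algebras $H_n^\lambda\otimes H_k\hookrightarrow H_{n+k}^\lambda$ induced by the natural inclusion $H_n\otimes H_k\hookrightarrow H_{n+k}$, the centralizer of $H_n^\lambda$ in $H_{n+k}^\lambda$ is generated by $H_k$ and the center of $H_n^\lambda$.
   Context: $\mathbb{N}$ is the set of nonnegative integers and $I$ is the image of $\mathbb{Z}$ in $\Bbbk$; $\omega_i$ ($i\in I$) are the fundamental weights of $\mathfrak{sl}_\infty$, and $\lambda=\sum_{i\in I}\lambda_i\omega_i$ with $\lambda_i\in\mathbb{N}$, finitely many nonzero, $\lambda\ne0$. The degenerate affine Hecke algebra $H_n$ is the $\Bbbk$-algebra generated by $s_1,\dots,s_{n-1},x_1,\dots,x_n$ with relations $s_i^2=1$; $s_is_j=s_js_i$ for $|i-j|>1$; $s_is_{i+1}s_i=s_{i+1}s_is_{i+1}$; $s_jx_i=x_is_j$ for $i\ne j,j+1$; $s_ix_i=x_{i+1}s_i-1$; $x_ix_j=x_jx_i$; by convention $H_0=\Bbbk$ and $H_1=\Bbbk[x_1]$. The degenerate cyclotomic Hecke algebra is $H_n^\lambda=H_n/I_n^\lambda$, where $I_n^\lambda$ is the ideal of $H_n$ generated by $\prod_{i\in I}(x_1-i)^{\lambda_i}$ (with $I_0^\lambda=\{0\}$, so $H_0^\lambda=\Bbbk$). The inclusion $H_n\subseteq H_{n+1}$ induces an embedding $H_n^\lambda\hookrightarrow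 H_{n+1}^\lambda$, through which $H_n^\lambda$ is viewed as a subalgebra of $H_{n+1}^\lambda$, and hence of $H_{n+k}^\lambda$. The natural inclusion $H_n\otimes H_k\hookrightarrow H_{n+k}$ is the standard inclusion on $H_n$ and sends the generators $s_i,x_i$ of $H_k$ to $s_{n+i},x_{n+i}$. *)

(* Defs.v *)
From HB Require Import structures.
From mathcomp Require Import all_boot all_order all_algebra.
From mathcomp Require Import finmap.
From mathcomp Require Import boolp classical_sets.
From mathcomp.multinomials Require Import monalg.

Set Implicit Arguments.
Unset Strict Implicit.
Unset Printing Implicit Defensive.

Import GRing.Theory.

Local Open Scope classical_set_scope.
Local Open Scope ring_scope.

Section CentralizersAndSubalgebras.
Variables (K : fieldType) (A : algType K).
Implicit Types S B : set A.

Definition centralizer S : set A :=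
  [set z | forall y, S y -> GRing.comm z y].

Definition center : set A := centralizer setT.

Definition subalgebra B : Prop :=
  [/\ B 1, forall (c : K) x y, B x -> B y -> B (c *: x + y)
    & forall x y, B x -> B y -> B (x * y)].

Definition subalg_gen S : set A := smallest subalgebra S.

Definition two_sided_ideal B : Prop :=
  [/\ B 0, forall x y, B x -> B y -> B (x - y)
    & forall a b x, B x -> B (a * x * b)].

Definition ideal_gen S : set A := smallest two_sided_ideal S.

End CentralizersAndSubalgebras.

Arguments center {K} A.

Section Quotient.
Variables (K : fieldType) (A : algType K) (S : set A).

Lemma ideal_gen_ideal : two_sided_ideal (ideal_gen S).
Proof.
split.
- by move=> B [[B0 _ _] _].
- move=> x y Sx Sy B SB; have [[_ BB _] _] := SB.
  exact: BB (Sx _ SB) (Sy _ SB).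
- move=> a b x Sx B SB; have [[_ _ BM] _] := SB.
  exact: BM (Sx _ SB).
Qed.

Lemma sub_ideal_gen : S `<=` ideal_gen S.
Proof. by move=> x Sx B [_]; apply. Qed.

Definition ideal_pred : {pred A} := fun x => `[< ideal_gen S x >].

Lemma ideal_predP x : reflect (ideal_gen S x) (x \in ideal_pred).
Proof. exact: asboolP. Qed.

Lemma ideal_pred_zmod_closed : zmod_closed ideal_pred.
Proof.
have [I0 IB _] := ideal_gen_ideal.
split; first exact/ideal_predP.
by move=> x y /ideal_predP Ix /ideal_predP Iy; apply/ideal_predP; exact: IB.
Qed.

HB.instance Definition _ :=
  GRing.isZmodClosed.Build A ideal_pred ideal_pred_zmod_closed.

Definition ideal_zmod := GRing.ZmodClosed.clone A ideal_pred _.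

(* A / (S), for S generating a proper ideal: an [algType] is a nonzero ring. *)
Definition quotalg (_ : ~ ideal_gen S 1) : Type := Quotient.quot ideal_zmod.

Variable S_proper : ~ ideal_gen S 1.

Local Notation Q := (quotalg S_proper).

HB.instance Definition _ := GRing.Zmodule.on Q.

Definition qproj (x : A) : Q := (\pi_(Quotient.quot ideal_zmod) x)%qT.

Lemma qprojP (P : Q -> Prop) : (forall x, P (qproj x)) -> forall q, P q.
Proof.
by move=> Pproj q; rewrite -[q](@reprK _ (Quotient.quot ideal_zmod)).
Qed.

Lemma qproj_eq x y : qproj x = qproj y <-> ideal_gen S (x - y).
Proof.
split=> [/eqP|Ixy].
  by rewrite /qproj -Quotient.idealrBE => /ideal_predP.
by apply/eqP; rewrite /qproj -Quotient.idealrBE; apply/ideal_predP.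
Qed.

Lemma qproj_repr x : ideal_gen S (repr (qproj x) - x).
Proof. by apply/qproj_eq; rewrite /qproj reprK. Qed.

Lemma qproj_zmod_morphism : zmod_morphism qproj.
Proof. by move=> x y; rewrite /qproj raddfB. Qed.

HB.instance Definition _ :=
  GRing.isZmodMorphism.Build A Q qproj qproj_zmod_morphism.

Let qone : Q := qproj 1.
Let qmul (p q : Q) : Q := qproj (repr p * repr q).
Let qscale (c : K) (q : Q) : Q := qproj (c *: repr q).

Let qmulE x y : qmul (qproj x) (qproj y) = qproj (x * y).
Proof.
have [I0 IB IM] := ideal_gen_ideal.
apply/qproj_eq; set x' := repr _; set y' := repr _.
have -> : x' * y' - x * y = 1 * (x' - x) * y' - x * (y - y') * 1.
  by rewrite mul1r mulr1 mulrBl mulrBr opprB addrA subrK.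
apply: (IB); apply: IM; first exact: qproj_repr.
by rewrite -opprB -sub0r; apply: IB => //; apply: qproj_repr.
Qed.

Let qscaleE c x : qscale c (qproj x) = qproj (c *: x).
Proof.
have [_ _ IM] := ideal_gen_ideal.
apply/qproj_eq; rewrite -scalerBr -mulr_algl -[X in ideal_gen _ X]mulr1.
by apply: IM; apply: qproj_repr.
Qed.

Let qmulA : associative qmul.
Proof.
by elim/qprojP=> x; elim/qprojP=> y; elim/qprojP=> z; rewrite !qmulE mulrA.
Qed.

Let qmul1 : left_id qone qmul.
Proof. by elim/qprojP=> x; rewrite qmulE mul1r. Qed.

Let qmulr1 : right_id qone qmul.
Proof. by elim/qprojP=> x; rewrite qmulE mulr1. Qed.

Let qmulDl : left_distributive qmul +%R.
Proof.
elim/qprojP=> x; elim/qprojP=> y; elim/qprojP=> z.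
by rewrite -raddfD !qmulE mulrDl raddfD.
Qed.

Let qmulDr : right_distributive qmul +%R.
Proof.
elim/qprojP=> x; elim/qprojP=> y; elim/qprojP=> z.
by rewrite -raddfD !qmulE mulrDr raddfD.
Qed.

Let qone_neq0 : qone != 0.
Proof.
apply/eqP; rewrite -(raddf0 qproj) => /qproj_eq.
by rewrite subr0.
Qed.

HB.instance Definition _ := GRing.Zmodule_isNzRing.Build Q
  qmulA qmul1 qmulr1 qmulDl qmulDr qone_neq0.

Let qscaleA a b q : qscale a (qscale b q) = qscale (a * b) q.
Proof. by elim/qprojP: q => x; rewrite !qscaleE scalerA. Qed.

Let qscale1 : left_id 1 qscale.
Proof. by elim/qprojP=> x; rewrite qscaleE scale1r. Qed.

Let qscaleDr : right_distributive qscale +%R.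
Proof.
move=> c; elim/qprojP=> x; elim/qprojP=> y.
by rewrite -raddfD !qscaleE scalerDr raddfD.
Qed.

Let qscaleDl q : {morph qscale^~ q : a b / a + b}.
Proof. by elim/qprojP: q => x a b; rewrite !qscaleE scalerDl raddfD. Qed.

HB.instance Definition _ := GRing.Zmodule_isLmodule.Build K Q
  qscaleA qscale1 qscaleDr qscaleDl.

Let qscaleAl (c : K) (p q : Q) : c *: (p * q) = (c *: p) * q.
Proof.
elim/qprojP: p => x; elim/qprojP: q => y.
by rewrite [RHS](congr1 (qmul^~ _) (qscaleE c x)) [LHS](congr1 (qscale c) (qmulE x y))
  qscaleE [RHS]qmulE scalerAl.
Qed.

HB.instance Definition _ := GRing.Lmodule_isLalgebra.Build K Q qscaleAl.

Let qscaleAr (c : K) (p q : Q) : c *: (p * q) = p * (c *: q).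
Proof.
elim/qprojP: p => x; elim/qprojP: q => y.
by rewrite [RHS](congr1 (qmul _) (qscaleE c y)) [LHS](congr1 (qscale c) (qmulE x y))
  qscaleE [RHS]qmulE scalerAr.
Qed.

HB.instance Definition _ := GRing.Lalgebra_isAlgebra.Build K Q qscaleAr.

Lemma qproj_monoid_morphism : monoid_morphism qproj.
Proof. by split=> // x y; rewrite -qmulE. Qed.

HB.instance Definition _ :=
  GRing.isMonoidMorphism.Build A Q qproj qproj_monoid_morphism.

Lemma qproj_scalable : scalable qproj.
Proof. by move=> c x; rewrite -qscaleE. Qed.

HB.instance Definition _ :=
  GRing.isScalable.Build K A Q *:%R qproj qproj_scalable.

Lemma qproj0 x : S x -> qproj x = 0.
Proof.
move=> Sx; rewrite -(raddf0 qproj); apply/qproj_eq; rewrite subr0.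
exact: sub_ideal_gen.
Qed.

End Quotient.

Section QuotientLift.
Variables (K : fieldType) (A : algType K) (S : set A) (B : algType K).
Variable f : {lrmorphism A -> B}.

Lemma ideal_gen_ker : (forall x, S x -> f x = 0) ->
  forall x, ideal_gen S x -> f x = 0.
Proof.
move=> f0 x /(_ [set y | f y = 0]); apply; split=> //; split=> /=.
- exact: rmorph0.
- by move=> y z /= fy fz; rewrite rmorphB /= fy fz subrr.
- by move=> a b y /= fy; rewrite !rmorphM /= fy mulr0 mul0r.
Qed.

Lemma proper_of_lrmorphism : (forall x, S x -> f x = 0) -> ~ ideal_gen S 1.
Proof.
by move=> /ideal_gen_ker f0 /f0 /eqP; rewrite rmorph1 oner_eq0.
Qed.

Variable S_proper : ~ ideal_gen S 1.

(* The morphism A / (S) -> B induced by f. *)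
Definition quot_lift (_ : forall x, S x -> f x = 0) (q : quotalg S_proper) : B :=
  f (repr q).

Hypothesis f0 : forall x, S x -> f x = 0.

Lemma quot_liftE x : quot_lift f0 (qproj S_proper x) = f x.
Proof.
apply/eqP; rewrite -subr_eq0 -rmorphB; apply/eqP.
by apply: (ideal_gen_ker f0); apply: qproj_repr.
Qed.

Lemma quot_lift_linear : linear (quot_lift f0).
Proof.
move=> c; elim/qprojP=> x; elim/qprojP=> y.
by rewrite -linearP !quot_liftE linearP.
Qed.

Lemma quot_lift_monoid_morphism : monoid_morphism (quot_lift f0).
Proof.
split; first by rewrite -(rmorph1 (qproj S_proper)) quot_liftE rmorph1.
elim/qprojP=> x; elim/qprojP=> y.
by rewrite -rmorphM !quot_liftE rmorphM.
Qed.

HB.instance Definition _ := GRing.isLinear.Build K (quotalg S_proper) B *:%R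
  (quot_lift f0) quot_lift_linear.
HB.instance Definition _ := GRing.isMonoidMorphism.Build (quotalg S_proper) B
  (quot_lift f0) quot_lift_monoid_morphism.

End QuotientLift.

Lemma malg_scalerAr (M : monomType) (R : comNzRingType) (c : R)
    (p q : {malg R[M]}) :
  c *: (p * q) = p * (c *: q).
Proof.
apply/malgP => m; rewrite mcoeffZ mcoeffMl.
rewrite (mcoeffMlw m (fsubset_refl _) (msuppZ_le c q)) mulr_sumr.
apply: eq_bigr => i _; rewrite mulr_sumr; apply: eq_bigr => j _.
by rewrite mcoeffZ mulrnAr mulrCA.
Qed.

Section FreeAlgebra.
Variables (K : fieldType) (I : choiceType).

Definition freealg : Type := {malg K[{fmonom I}]}.

HB.instance Definition _ := GRing.Lalgebra.on freealg.
HB.instance Definition _ :=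
  GRing.Lalgebra_isAlgebra.Build K freealg (@malg_scalerAr _ _).

Definition freegen (i : I) : freealg := mkmalgU (fmu i) 1.

Variables (B : algType K) (g : I -> B).

Definition word_eval (m : {fmonom I}) : B := \prod_(i <- (m : seq I)) g i.

Lemma word_eval_mmorphism : mmorphism word_eval.
Proof.
split=> [m1 m2|]; first by rewrite /word_eval fmM big_cat.
by rewrite /word_eval fm1 big_nil.
Qed.

HB.instance Definition _ :=
  isMultiplicative.Build {fmonom I} B word_eval word_eval_mmorphism.

Definition free_eval (p : freealg) : B := mmap (in_alg B) word_eval p.

Lemma free_evalE i : free_eval (freegen i) = g i.
Proof.
by rewrite /free_eval mmapU /= scale1r mul1r /word_eval fmU big_seq1.
Qed.

Lemma free_eval_linear : linear free_eval.
Proof.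
have comm_in_alg (p : freealg) m m' : GRing.comm (in_alg B p@_m) (word_eval m').
  by rewrite /GRing.comm /= mulr_algr mulr_algl.
move=> c p q; rewrite /free_eval raddfD /=; congr (_ + _).
by rewrite mmapZ //= mulr_algl.
Qed.

Lemma free_eval_monoid_morphism : monoid_morphism free_eval.
Proof.
have comm_in_alg (p : freealg) m m' : GRing.comm (in_alg B p@_m) (word_eval m').
  by rewrite /GRing.comm /= mulr_algr mulr_algl.
have [fM f1] := @commr_mmap_is_multiplicative _ _ _ (in_alg B) word_eval comm_in_alg.
by split.
Qed.

HB.instance Definition _ :=
  GRing.isLinear.Build K freealg B *:%R free_eval free_eval_linear.
HB.instance Definition _ :=
  GRing.isMonoidMorphism.Build freealg B free_eval free_eval_monoid_morphism.

End FreeAlgebra.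

Lemma free_eval_id (K : fieldType) (I : choiceType) (p : freealg K I) :
  free_eval (freegen K (I := I)) p = p.
Proof.
have wordE (m : {fmonom I}) : word_eval (freegen K (I := I)) m = mkmalgU m 1.
  rewrite /word_eval; case: m => r; elim: r => [|i r IHr] /=.
    by rewrite big_nil; congr mkmalgU; apply: val_inj; rewrite /= fm1.
  rewrite big_cons IHr [LHS]fgmulUU mulr1; congr mkmalgU.
  by apply: val_inj; rewrite /= fmM fmU.
rewrite /free_eval mmapE [RHS]monalgE; apply: eq_bigr => m _.
rewrite mulr_algl wordE; apply/malgP => m'.
by rewrite mcoeffZ !mcoeffU mulrnAr mulr1.
Qed.

Section AffineHecke.
Variable K : fieldType.

(* Indices are shifted by one: [s i] and [x j] stand for s_(i+1) and x_(j+1).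
   A relation l = r is recorded as the element l - r. *)
Section Relations.
Variables (A : algType K) (n : nat) (s : 'I_n.-1 -> A) (x : 'I_n -> A).

Inductive affHecke_rel : A -> Prop :=
| affHecke_rel_sqr i :
    affHecke_rel (s i ^+ 2 - 1)
| affHecke_rel_comm (i j : 'I_n.-1) : (i.+1 < j)%N || (j.+1 < i)%N ->
    affHecke_rel (s i * s j - s j * s i)
| affHecke_rel_braid (i j : 'I_n.-1) : j = i.+1 :> nat ->
    affHecke_rel (s i * s j * s i - s j * s i * s j)
| affHecke_rel_sx (j : 'I_n.-1) (i : 'I_n) : i != j :> nat -> i != j.+1 :> nat ->
    affHecke_rel (s j * x i - x i * s j)
| affHecke_rel_cross (i : 'I_n.-1) (a b : 'I_n) :
    a = i :> nat -> b = i.+1 :> nat ->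
    affHecke_rel (s i * x a - (x b * s i - 1))
| affHecke_rel_xx (i j : 'I_n) :
    affHecke_rel (x i * x j - x j * x i).

End Relations.

Lemma affHecke_rel_morph (A B : algType K) (f : {lrmorphism A -> B}) n
    (s : 'I_n.-1 -> A) (x : 'I_n -> A) (s' : 'I_n.-1 -> B) (x' : 'I_n -> B) :
    (forall i, f (s i) = s' i) -> (forall i, f (x i) = x' i) ->
  forall r, affHecke_rel s x r -> affHecke_rel s' x' (f r).
Proof.
move=> fs fx r [i|i j ij|i j ij|j i ij ij'|i a b ai bi|i j].
- by rewrite rmorphB rmorphXn rmorph1 /= fs; constructor.
- by rewrite rmorphB !rmorphM /= !fs; constructor.
- by rewrite rmorphB !rmorphM /= !fs; constructor.
- by rewrite rmorphB !rmorphM /= !fs !fx; constructor.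
- by rewrite !rmorphB !rmorphM rmorph1 /= !fs !fx; constructor.
- by rewrite rmorphB !rmorphM /= !fx; constructor.
Qed.

Lemma affHecke_rel_lift (A B : algType K) (f : {lrmorphism A -> B}) n
    (s : 'I_n.-1 -> A) (x : 'I_n -> A) r :
    affHecke_rel (fun i => f (s i)) (fun i => f (x i)) r ->
  exists2 r', affHecke_rel s x r' & r = f r'.
Proof.
case=> [i|i j ij|i j ij|j i ij ij'|i a b ai bi|i j].
- by exists (s i ^+ 2 - 1); [constructor|rewrite rmorphB rmorphXn rmorph1].
- by exists (s i * s j - s j * s i); [constructor|rewrite rmorphB !rmorphM].
- exists (s i * s j * s i - s j * s i * s j); first by constructor.
  by rewrite rmorphB !rmorphM.
- by exists (s j * x i - x i * s j); [constructor|rewrite rmorphB !rmorphM].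
- exists (s i * x a - (x b * s i - 1)); first by constructor.
  by rewrite !rmorphB !rmorphM rmorph1.
- by exists (x i * x j - x j * x i); [constructor|rewrite rmorphB !rmorphM].
Qed.

Lemma affHecke_rel_reindex (A : algType K) n m d
    (s : 'I_m.-1 -> A) (x : 'I_m -> A) (f : 'I_n.-1 -> 'I_m.-1) (g : 'I_n -> 'I_m) :
    (forall i, f i = (d + i)%N :> nat) -> (forall i, g i = (d + i)%N :> nat) ->
  forall r, affHecke_rel (fun i => s (f i)) (fun i => x (g i)) r -> affHecke_rel s x r.
Proof.
move=> fE gE r [i|i j ij|i j ij|j i ij ij'|i a b ai bi|i j]; constructor.
- by rewrite !fE -!addnS !leq_add2l.
- by rewrite !fE ij addnS.
- by rewrite fE gE eqn_add2l.
- by rewrite fE gE -addnS eqn_add2l.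
- by rewrite fE gE ai.
- by rewrite fE gE bi addnS.
Qed.

Definition heckegen n : Type := ('I_n.-1 + 'I_n)%type.
HB.instance Definition _ n := Choice.on (heckegen n).

Section Presentation.
Variable n : nat.

Let F : algType K := freealg K (heckegen n).

Definition heckefree_s (i : 'I_n.-1) : F := freegen K (inl i : heckegen n).
Definition heckefree_x (i : 'I_n) : F := freegen K (inr i : heckegen n).

Section Eval.
Variables (B : algType K) (s : 'I_n.-1 -> B) (x : 'I_n -> B).

Definition heckefree_eval : F -> B :=
  free_eval (fun i : heckegen n => match i with inl i => s i | inr i => x i end).

HB.instance Definition _ := GRing.LRMorphism.on heckefree_eval.

Lemma heckefree_eval_rel : (forall r, affHecke_rel s x r -> r = 0) ->
  forall r, affHecke_rel heckefree_s heckefree_x r -> heckefree_eval r = 0.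
Proof.
move=> rel0 r /affHecke_rel_morph rel_r; apply: rel0; apply: rel_r => i.
  exact: free_evalE.
exact: free_evalE.
Qed.

End Eval.

(* The one-dimensional representation s_i |-> 1, x_j |-> c + j - 1. *)
Lemma triv_rel (c : K) (r : K^o) :
  affHecke_rel (fun _ : 'I_n.-1 => 1 : K^o) (fun i : 'I_n => c + i%:R : K^o) r ->
  r = 0.
Proof.
case=> [i|i j _|i j _|j i _ _|i a b -> ->|i j]; rewrite ?expr1n ?mulr1 ?mul1r ?subrr //.
  by rewrite -[i.+1]addn1 natrD addrA addrK subrr.
by rewrite mulrC subrr.
Qed.

Lemma affHecke_proper : ~ ideal_gen (affHecke_rel heckefree_s heckefree_x) 1.
Proof.
exact: proper_of_lrmorphism (heckefree_eval_rel (@triv_rel 0)).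
Qed.

Definition affHecke : Type := quotalg affHecke_proper.
HB.instance Definition _ := GRing.Algebra.on affHecke.

Definition aff_s (i : 'I_n.-1) : affHecke := qproj affHecke_proper (heckefree_s i).
Definition aff_x (i : 'I_n) : affHecke := qproj affHecke_proper (heckefree_x i).

Lemma aff_rel0 r : affHecke_rel aff_s aff_x r -> r = 0.
Proof.
by case/(affHecke_rel_lift (f := qproj affHecke_proper)) => r' rel_r' ->;
  apply: qproj0.
Qed.

Lemma affHecke_ind (P : set affHecke) : subalgebra P ->
  (forall i, P (aff_s i)) -> (forall i, P (aff_x i)) -> forall a, P a.
Proof.
move=> [P1 PD PM] Ps Px; elim/qprojP => p.
have P0 : P 0 by rewrite -(addNr 1) -scaleN1r; apply: PD.
rewrite -[p]free_eval_id /free_eval mmapE raddf_sum /=.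
elim/big_rec: _ => // m q _ Pq; rewrite mulr_algl linearZ; apply: PD => //.
rewrite /word_eval rmorph_prod; elim/big_rec: _ => // -[] i r _ Pr; apply: PM => //.
  exact: Ps.
exact: Px.
Qed.

Lemma affHecke_comm (B : algType K) (f : {lrmorphism affHecke -> B}) (y : B) :
    (forall i, GRing.comm y (f (aff_s i))) ->
    (forall i, GRing.comm y (f (aff_x i))) ->
  forall a, GRing.comm y (f a).
Proof.
move=> ys yx; apply: (affHecke_ind (P := [set c | GRing.comm y (f c)])) ys yx.
split=> [|c u v yu yv|u v yu yv] /=.
- by rewrite rmorph1; apply: commr1.
- rewrite linearP; apply: commrD yv.
  by rewrite /GRing.comm -scalerAr -scalerAl yu.
- by rewrite rmorphM; apply: commrM.
Qed.

Section Lift.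
Variables (B : algType K) (s : 'I_n.-1 -> B) (x : 'I_n -> B).
Hypothesis rel0 : forall r, affHecke_rel s x r -> r = 0.

Definition affHecke_lift : affHecke -> B := quot_lift (heckefree_eval_rel rel0).

HB.instance Definition _ := GRing.LRMorphism.on affHecke_lift.

Lemma affHecke_lift_s i : affHecke_lift (aff_s i) = s i.
Proof. by rewrite /affHecke_lift quot_liftE; apply: free_evalE. Qed.

Lemma affHecke_lift_x i : affHecke_lift (aff_x i) = x i.
Proof. by rewrite /affHecke_lift quot_liftE; apply: free_evalE. Qed.

End Lift.
End Presentation.

(* [lam] stands for \sum_i (lam i) omega_i. In characteristic zero [int] indexes
   the image of Z in K, so the fundamental weights are indexed by [int]. *)
Definition weight : Type := {fsfun int -> nat with 0%N}.

Definition weight0 : weight := [fsfun].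

Definition cyclo_poly (A : algType K) (lam : weight) (x : A) : A :=
  \prod_(i <- finsupp lam) (x - i%:~R) ^+ lam i.

Lemma rmorph_cyclo_poly (A B : algType K) (f : {lrmorphism A -> B}) lam x :
  f (cyclo_poly lam x) = cyclo_poly lam (f x).
Proof.
rewrite /cyclo_poly rmorph_prod; apply: eq_bigr => i _.
by rewrite rmorphXn rmorphB rmorph_int.
Qed.

(* The generator of I_n^lam; there is none when n = 0. *)
Definition cyclo_rel n (lam : weight) : set (affHecke n) :=
  [set p | exists2 i : 'I_n, i = 0%N :> nat & p = cyclo_poly lam (aff_x i)].
Arguments cyclo_rel : clear implicits.

Section Quotient.
Variables (n : nat) (lam : weight).

Section Lift0.
Variables (B : algType K) (f : {lrmorphism affHecke n -> B}).

Lemma cyclo_rel0 :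
    (forall i : 'I_n, i = 0%N :> nat -> cyclo_poly lam (f (aff_x i)) = 0) ->
  forall p, cyclo_rel n lam p -> f p = 0.
Proof. by move=> h p [i i0 ->]; rewrite rmorph_cyclo_poly h. Qed.

End Lift0.

Hypothesis lam_neq0 : lam != weight0.

Lemma cycHecke_proper : ~ ideal_gen (cyclo_rel n lam) 1.
Proof.
have [c lam_c] : exists c, c \in finsupp lam.
  apply/fset0Pn; apply: contra_neq lam_neq0 => lam0.
  by apply/fsfunP => c; rewrite fsfun0E fsfun_dflt // lam0.
apply: (proper_of_lrmorphism (f := affHecke_lift (@triv_rel n c%:~R))).
apply: cyclo_rel0 => i i0; rewrite [X in cyclo_poly _ X]affHecke_lift_x i0 addr0.
rewrite /cyclo_poly (big_fsetD1 c) //= -[c%:~R : K^o]/(c%:~R : K).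
by rewrite subrr expr0n -memNfinsupp lam_c mul0r.
Qed.

Definition cycHecke : Type := quotalg cycHecke_proper.
HB.instance Definition _ := GRing.Algebra.on cycHecke.

Definition cyc_proj : affHecke n -> cycHecke := qproj cycHecke_proper.
HB.instance Definition _ := GRing.LRMorphism.on cyc_proj.

Lemma cyc_proj_rel0 (i : 'I_n) : i = 0%N :> nat ->
  cyclo_poly lam (cyc_proj (aff_x i)) = 0.
Proof.
by move=> i0; rewrite -rmorph_cyclo_poly; apply: qproj0; exists i.
Qed.

End Quotient.

Arguments cycHecke n {lam} lam_neq0.
Arguments cyc_proj n {lam} lam_neq0 _.

Section Inclusions.
Variables n k : nat.

Lemma leq_pred_addr : (n.-1 <= (n + k).-1)%N.
Proof. by rewrite -!subn1 leq_sub2r ?leq_addr. Qed.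

Lemma ltn_shift_pred (i : 'I_k.-1) : (n + i < (n + k).-1)%N.
Proof. by case: k i => [|[|k']] [i ilt] //=; rewrite addnS /= ltn_add2l. Qed.

Definition lidx (i : 'I_n.-1) : 'I_(n + k).-1 := widen_ord leq_pred_addr i.
Definition ridx (i : 'I_k.-1) : 'I_(n + k).-1 := Ordinal (ltn_shift_pred i).

Lemma aff_incl_rel r :
  affHecke_rel (fun i => aff_s (lidx i)) (fun i => aff_x (lshift k i)) r -> r = 0.
Proof. by move/(affHecke_rel_reindex (d := 0)) => /(_ _ _)/aff_rel0; apply. Qed.

Lemma aff_shift_rel r :
  affHecke_rel (fun i => aff_s (ridx i)) (fun i => aff_x (rshift n i)) r -> r = 0.
Proof. by move/(affHecke_rel_reindex (d := n)) => /(_ _ _)/aff_rel0; apply. Qed.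

(* H_n -> H_(n+k) : s_i |-> s_i, x_i |-> x_i *)
Definition aff_incl : affHecke n -> affHecke (n + k) := affHecke_lift aff_incl_rel.
HB.instance Definition _ := GRing.LRMorphism.on aff_incl.

Lemma aff_incl_s i : aff_incl (aff_s i) = aff_s (lidx i).
Proof. exact: affHecke_lift_s. Qed.

Lemma aff_incl_x i : aff_incl (aff_x i) = aff_x (lshift k i).
Proof. exact: affHecke_lift_x. Qed.

(* H_k -> H_(n+k) : s_i |-> s_(n+i), x_i |-> x_(n+i) *)
Definition aff_shift : affHecke k -> affHecke (n + k) :=
  affHecke_lift aff_shift_rel.
HB.instance Definition _ := GRing.LRMorphism.on aff_shift.

Lemma aff_shift_s i : aff_shift (aff_s i) = aff_s (ridx i).
Proof. exact: affHecke_lift_s. Qed.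

Lemma aff_shift_x i : aff_shift (aff_x i) = aff_x (rshift n i).
Proof. exact: affHecke_lift_x. Qed.

Variables (lam : weight) (lam_neq0 : lam != weight0).

Lemma cyc_incl_rel p : cyclo_rel n lam p ->
  (cyc_proj (n + k) lam_neq0 \o aff_incl) p = 0.
Proof.
apply: cyclo_rel0 => i i0 /=; rewrite aff_incl_x.
exact: cyc_proj_rel0.
Qed.

Definition cyc_incl : cycHecke n lam_neq0 -> cycHecke (n + k) lam_neq0 :=
  quot_lift cyc_incl_rel.
HB.instance Definition _ := GRing.LRMorphism.on cyc_incl.

Lemma cyc_inclE a :
  cyc_incl (cyc_proj n lam_neq0 a) = cyc_proj (n + k) lam_neq0 (aff_incl a).
Proof. exact: quot_liftE. Qed.

Definition cyc_shift : affHecke k -> cycHecke (n + k) lam_neq0 :=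
  cyc_proj (n + k) lam_neq0 \o aff_shift.
HB.instance Definition _ := GRing.LRMorphism.on cyc_shift.

Lemma aff_incl_shift_comm a b : GRing.comm (aff_incl a) (aff_shift b).
Proof.
have commE (u v : affHecke (n + k)) : u * v - v * u = 0 -> GRing.comm u v.
  by move/eqP; rewrite subr_eq0 => /eqP.
have lt_idx (i : 'I_n.-1) : (i.+1 < n)%N by rewrite -ltn_predRL.
have ss i j : GRing.comm (aff_s (lidx i)) (aff_s (ridx j)).
  apply/commE/aff_rel0/affHecke_rel_comm => /=.
  by rewrite (leq_trans (lt_idx i)) ?leq_addr.
have sx i j : GRing.comm (aff_s (lidx i)) (aff_x (rshift n j)).
  apply/commE/aff_rel0/affHecke_rel_sx => /=; rewrite neq_ltn.
    by rewrite (leq_trans (ltnW (lt_idx i))) ?leq_addr ?orbT.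
  by rewrite (leq_trans (lt_idx i)) ?leq_addr ?orbT.
have xs i j : GRing.comm (aff_x (lshift k i)) (aff_s (ridx j)).
  apply/commr_sym/commE/aff_rel0/affHecke_rel_sx; rewrite /= neq_ltn.
    by rewrite (leq_trans (ltn_ord i)) ?leq_addr.
  by rewrite ltnS (leq_trans (ltnW (ltn_ord i))) ?leq_addr.
have xx i j : GRing.comm (aff_x (lshift k i)) (aff_x (rshift n j)).
  exact/commE/aff_rel0/affHecke_rel_xx.
apply: affHecke_comm => j; apply: commr_sym; apply: affHecke_comm => i;
  apply: commr_sym.
- by rewrite /= aff_incl_s aff_shift_s.
- by rewrite /= aff_incl_x aff_shift_s.
- by rewrite /= aff_incl_s aff_shift_x.
- by rewrite /= aff_incl_x aff_shift_x.
Qed.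

(* The two maps have commuting images, so together they define an algebra
   morphism from the tensor product of H_n^lam and H_k to H_(n+k)^lam. *)
Lemma cyc_incl_shift_comm a b : GRing.comm (cyc_incl a) (cyc_shift b).
Proof.
elim/qprojP: a => a; rewrite /cyc_incl quot_liftE /cyc_shift /= /GRing.comm.
by rewrite -!rmorphM aff_incl_shift_comm.
Qed.

End Inclusions.

End AffineHecke.

Arguments cyclo_rel {K} n lam _.
Arguments cycHecke K n {lam} lam_neq0.
Arguments cyc_proj K n {lam} lam_neq0 _.
Arguments aff_incl K n k _.
Arguments aff_shift K n k _.
Arguments cyc_incl K n k {lam} lam_neq0 _.
Arguments cyc_shift K n k {lam} lam_neq0 _.

(* Main.v *)
(* Let d be the degree of f, the polynomial of lambda, and let x^l w range over
   the monomials with exponents < d times permutations.  They form a basis of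
   H_m^lambda: independence is seen on the span of such symbols, a subspace of
   the regular representation of H_m on which the s_i act by Demazure-type
   operators and x_1 is redefined so that f(x_1) = 0.

   Filter H_(n+k)^lambda by degree in the x_i.  Modulo lower terms, f(x_i) is the
   sum over j < i of tau_ji, where tau_ij = sum_(p+q=d-1) x_i^p x_j^q (i j).  If z
   of degree N commutes with x_1, .., x_n, its leading term is a sum of
   polynomial multiples c w of permutations with (x_i - x_(w^-1 i)) c = 0 for
   i <= n in degree N + 1; such a c w factors through tau_(l, w l) for every
   moved point l <= n, so that a cycle of w inside the first n indices
   contributes a word x_i^b tau_(k_1,i) .. tau_(k_t,i).

   In characteristic zero a z that also commutes with S_n is its own average
   over S_n, up to a scalar.  The averages of these leading terms come, up to
   terms supported on fewer indices, from f(x_j) with j > n (which is in H_k and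
   has leading term the sum of all tau_ij, i < j) and from the central elements
   sum_(i <= n) x_i^b f(x_i)^t of H_n^lambda.  Induction on the support and then
   on the degree concludes. *)

From HB Require Import structures.
Require Import Defs.
From mathcomp Require Import all_boot all_order all_algebra all_fingroup.
From mathcomp Require Import finmap.
From mathcomp Require Import boolp classical_sets.
From mathcomp.multinomials Require Import monalg.
From mathcomp Require Import zify.

Set Implicit Arguments.
Unset Strict Implicit.
Unset Printing Implicit Defensive.

Import GRing.Theory.

Local Open Scope ring_scope.

(** * Permutations and the lift to Coxeter generators *)

(** The obstacle is that x_i^d has degree below d, since the decorated transpositions have degree d
    - 1. To leading order the x_i are therefore nilpotent, and x_i - x_j is a zero divisor: it kills
    (x_i^d - x_j^d) / (x_i - x_j), the polynomial part of tau_ij. This is why a leading term that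
    commutes with x_1, .., x_n may still move the first n indices; splitting off a moved point costs
    one such factor. The averages are computed by comparing a word with a sum of words. A word u
    tau_lj with j > n and u supported away from l is one term of u times the sum of tau_ij over i <=
    n, and that sum is the leading term of a known element. The terms in which i already occurs in u
    have smaller support; the others are conjugate to the given word under permutations of the first
    n indices that fix the support of u. After averaging these agree to leading order, and the
    division by their number needs characteristic zero. Words coming from cycles are found in the
    same way inside the expansion of x_i^b f(x_i)^t. *)

Section AdjacentTranspositions.
Variable m : nat.

Lemma lo_proof (i : 'I_m.-1) : (i < m)%N.
Proof. by case: m i => [|m'] [i /= ilt]; lia. Qed.

Lemma hi_proof (i : 'I_m.-1) : (i.+1 < m)%N.
Proof. by case: m i => [|m'] [i /= ilt]; lia. Qed.

Definition lo (i : 'I_m.-1) : 'I_m := Ordinal (lo_proof i).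
Definition hi (i : 'I_m.-1) : 'I_m := Ordinal (hi_proof i).
Definition adj (i : 'I_m.-1) : 'S_m := tperm (lo i) (hi i).

Lemma lo_neq_hi i : lo i != hi i.
Proof. by rewrite -val_eqE /= neq_ltn ltnSn. Qed.

Lemma adj_lo i : adj i (lo i) = hi i. Proof. exact: tpermL. Qed.
Lemma adj_hi i : adj i (hi i) = lo i. Proof. exact: tpermR. Qed.

Lemma adjD (i : 'I_m.-1) (j : 'I_m) : j != i :> nat -> j != i.+1 :> nat -> adj i j = j.
Proof. by move=> ji ji1; rewrite /adj tpermD // eq_sym -val_eqE. Qed.

Lemma adj2 i : (adj i * adj i = 1)%g. Proof. exact: tperm2. Qed.

Lemma adjK i : involutive (adj i).
Proof. by move=> j; rewrite -permM adj2 perm1. Qed.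

Lemma adj_comm (i j : 'I_m.-1) : (i.+1 < j)%N -> (adj i * adj j = adj j * adj i)%g.
Proof.
move=> ij; apply/permP => x; rewrite !permM.
have D (k l : 'I_m.-1) : (k.+1 < l)%N || (l.+1 < k)%N ->
    adj k (lo l) = lo l /\ adj k (hi l) = hi l.
  by move=> kl; split; apply: adjD => /=; apply/eqP; lia.
have [|jli jhi] := D j i; first by rewrite ij orbT.
have [|ilj ihj] := D i j; first by rewrite ij.
have [->|xi] := eqVneq x (lo i); first by rewrite adj_lo jhi jli adj_lo.
have [->|xi'] := eqVneq x (hi i); first by rewrite adj_hi jhi jli adj_hi.
rewrite -!val_eqE /= in xi xi'; rewrite (adjD xi xi').
have [->|xj] := eqVneq x (lo j); first by rewrite adj_lo ihj.
have [->|xj'] := eqVneq x (hi j); first by rewrite adj_hi ilj.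
by rewrite -!val_eqE /= in xj xj'; rewrite (adjD xj xj') adjD.
Qed.

Lemma adj_braid (i j : 'I_m.-1) : j = i.+1 :> nat ->
  (adj i * adj j * adj i = adj j * adj i * adj j)%g.
Proof.
move=> ij; have hl : hi i = lo j by apply/val_inj; rewrite /= ij.
apply/permP => x; rewrite !permM.
have lij : adj j (lo i) = lo i by apply: adjD => /=; apply/eqP; lia.
have hij : adj i (hi j) = hi j by apply: adjD => /=; apply/eqP; lia.
have lj : adj i (lo j) = lo i by rewrite -hl adj_hi.
have [->|xi] := eqVneq x (lo i).
  by rewrite lij adj_lo hl adj_lo hij.
have [->|xj] := eqVneq x (lo j).
  by rewrite lj lij adj_lo hl adj_lo hij adj_hi.
have [->|xj'] := eqVneq x (hi j).
  by rewrite hij adj_hi lj lij.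
rewrite -!val_eqE /= in xi xj xj'.
by rewrite !adjD //; apply/eqP; lia.
Qed.

Definition desc (i : 'I_m.-1) (w : 'S_m) := (w (hi i) < w (lo i))%N.

(** A substitute for the Coxeter length. Permutations compose from left to right, so [adj i * w]
    exchanges the values of [w] at [i] and [i.+1]; at a descent this lowers the sum by the
    difference of the two values. *)
Definition disorder (w : 'S_m) := (\sum_(i < m) (m - i) * w i)%N.

Lemma disorder_desc i w : desc i w -> (disorder (adj i * w)%g < disorder w)%N.
Proof.
have split2 (F : 'I_m -> nat) : (\sum_j F j = F (lo i) + F (hi i) +
    \sum_(j | (j != lo i) && (j != hi i)) F j)%N.
  rewrite (bigD1 (lo i)) //= (bigD1 (hi i)) ?addnA //.
  by rewrite eq_sym lo_neq_hi.
move=> di; rewrite /disorder !split2 !permM adj_lo adj_hi.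
rewrite [X in (_ + X < _)%N](_ : _ =
    \sum_(j | (j != lo i) && (j != hi i)) (m - j) * w j)%N; last first.
  by apply: eq_bigr => j; rewrite -!val_eqE => /andP[ji ji']; rewrite permM adjD.
have := hi_proof i; rewrite /desc /= in di *; rewrite ltn_add2r.
nia.
Qed.

Lemma desc_adj i w : ~~ desc i w -> desc i (adj i * w)%g.
Proof.
rewrite /desc !permM adj_lo adj_hi -leqNgt leq_eqVlt => /orP[/eqP/val_inj|//].
by move/perm_inj => /eqP; rewrite (negPf (lo_neq_hi i)).
Qed.

Lemma desc1 i : ~~ desc i 1%g.
Proof. by rewrite /desc !perm1 /= -leqNgt. Qed.

(** Without descents the values of [w] rise by at least one at each step; measured from the first
    and from the last index, this leaves only [w i = i]. *)
Lemma nodesc (w : 'S_m) : (forall i, ~~ desc i w) -> w = 1%g.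
Proof.
move=> nd.
have mono (i j : 'I_m) : (i <= j)%N -> (w i + (j - i) <= w j)%N.
  case: j => j jm /=; elim: j jm => [|j IHj] jm ij.
    have -> : i = Ordinal jm by apply/val_inj => /=; lia.
    by rewrite subn0 addn0.
  have [e|ne] := eqVneq (i : nat) j.+1.
    have -> : i = Ordinal jm by apply/val_inj.
    by rewrite /= subnn addn0.
  have jm' : (j < m)%N by lia.
  have /(IHj jm') {IHj} : (i <= j)%N by lia.
  have jm1 : (j < m.-1)%N by lia.
  have := nd (Ordinal jm1); rewrite /desc -leqNgt leq_eqVlt => /orP[/eqP e|].
    move/val_inj/perm_inj/eqP: e; rewrite (negPf (lo_neq_hi _)) //.
  have -> : lo (Ordinal jm1) = Ordinal jm' by apply/val_inj.
  have -> : hi (Ordinal jm1) = Ordinal jm by apply/val_inj.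
  by lia.
apply/permP => i; rewrite perm1; apply/val_inj/eqP; rewrite eqn_leq.
have m0 : (0 < m)%N by have := ltn_ord i; lia.
have mm : (m.-1 < m)%N by lia.
apply/andP; split.
  have := mono i (Ordinal mm); have := ltn_ord (w (Ordinal mm)); have := ltn_ord i.
  by rewrite /=; lia.
by have := mono (Ordinal m0) i; rewrite /=; lia.
Qed.

(** A descent of a permutation supported on the interval has both of its points there, so the
    reduction along descents never leaves the interval. It serves for the first n indices and for
    the last k. *)
Lemma adj_interval_ind (a b : nat) (P : 'S_m -> Prop) : P 1%g ->
    (forall (i : 'I_m.-1) w, (a <= i)%N -> (i.+1 < b)%N -> P w -> P (adj i * w)%g) ->
  forall w, perm_on [set i : 'I_m | (a <= i < b)%N] w -> P w.
Proof.
move=> P1 Ps w; have [N] := ubnP (disorder w).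
elim: N w => // N IHN w wN wR; have [/existsP[i di]|] := boolP [exists i, desc i w]; last first.
  by rewrite negb_exists => /forallP nd; rewrite (nodesc nd).
have loR : lo i \in [set i : 'I_m | (a <= i < b)%N].
  apply: contraLR di => loR; rewrite /desc (out_perm wR loR) -leqNgt /=.
  have [hiR|hiR] := boolP (hi i \in [set i : 'I_m | (a <= i < b)%N]); last first.
    by rewrite (out_perm wR hiR) /=; lia.
  move: (hiR); rewrite -(perm_closed _ wR).
  move: hiR loR; rewrite !inE /=.
  by move: (nat_of_ord (w _)) (nat_of_ord i) => x y; lia.
have hiR : hi i \in [set i : 'I_m | (a <= i < b)%N].
  apply: contraLR di => hiR; rewrite /desc (out_perm wR hiR) -leqNgt /=.
  move: (loR); rewrite -(perm_closed _ wR).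
  move: hiR loR; rewrite !inE /=.
  by move: (nat_of_ord (w _)) (nat_of_ord i) => x y; lia.
have -> : w = (adj i * (adj i * w))%g by rewrite mulgA adj2 mul1g.
move: (loR) (hiR); rewrite !inE /= => /andP[? _] /andP[_ ?].
apply: Ps => //; apply: IHN.
  by rewrite -ltnS (leq_trans _ wN) // ltnS disorder_desc.
apply: perm_onM => //; apply/fintype.subsetP => j; rewrite inE.
have [->|jl] := eqVneq j (lo i); first by rewrite inE in loR.
have [->|jh] := eqVneq j (hi i); first by rewrite inE in hiR.
by rewrite inE /adj tpermD 1?eq_sym ?eqxx.
Qed.

Lemma adj_ind (P : 'S_m -> Prop) : P 1%g ->
  (forall i w, P w -> P (adj i * w)%g) -> forall w, P w.
Proof.
move=> P1 Ps w; apply: (@adj_interval_ind 0 m) => // [i w' _ _|]; first exact: Ps.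
by apply/fintype.subsetP => i _; rewrite inE /=.
Qed.

End AdjacentTranspositions.

(** * Independence of the reduced word *)

Section Coxeter.
Variables (m : nat) (B : pzRingType) (s : 'I_m.-1 -> B).
Hypothesis s2 : forall i, s i * s i = 1.
Hypothesis s_comm : forall i j : 'I_m.-1, (i.+1 < j)%N -> s i * s j = s j * s i.
Hypothesis s_braid : forall i j : 'I_m.-1, j = i.+1 :> nat ->
  s i * s j * s i = s j * s i * s j.

(** The descent is an arbitrary pick; [cox_desc] shows that the choice does not matter. [N] is fuel,
    sufficient once it exceeds [disorder w]. *)
Fixpoint cox_rec N (w : 'S_m) : B :=
  if N is N'.+1 then
    if [pick i | desc i w] is Some i then s i * cox_rec N' (adj i * w)%g else 1
  else 1.

Lemma cox_rec_stable N w : (disorder w < N)%N ->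
  cox_rec N w = cox_rec (disorder w).+1 w.
Proof.
elim: N {-2}N (leqnn N) w => [|M IHM] [|N] //= NM w wN.
case: pickP => // i di; have := disorder_desc di => lt.
congr (_ * _); rewrite (IHM N) //; last by lia.
by rewrite (IHM (disorder w)) //; lia.
Qed.

(* The lift of a permutation along any of its reduced words. *)
Definition cox w := cox_rec (disorder w).+1 w.

Lemma cox1 : cox 1 = 1.
Proof. by rewrite /cox /=; case: pickP => // i; rewrite (negPf (desc1 i)). Qed.

(** A diamond argument. Two descents [i] and [j] of [w] can be continued to a common smaller
    permutation, after one more step each if they are far apart and two more if they are adjacent;
    the commutation or the braid relation identifies the two words. *)
Lemma cox_desc i w : desc i w -> cox w = s i * cox (adj i * w).
Proof.
have [N] := ubnP (disorder w); elim: N w i => // N IHN w j wN dj.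
rewrite {1}/cox /=; case: pickP => [i di|/(_ j)]; last by rewrite dj.
rewrite cox_rec_stable ?disorder_desc // -/(cox _).
rewrite ltnS in wN.
wlog ij : i j di dj / (i < j)%N => [hw|].
  have [ij|ji|/val_inj-> //] := ltngtP i j; first exact: hw.
  by symmetry; apply: hw.
have [e|ne] := eqVneq (j : nat) i.+1; last first.
  have lt : (i.+1 < j)%N by lia.
  have dj' : desc j (adj i * w)%g.
    by rewrite /desc !permM !adjD //=; apply/eqP; lia.
  have di' : desc i (adj j * w)%g.
    by rewrite /desc !permM !adjD //=; apply/eqP; lia.
  have li := leq_trans (disorder_desc di) wN.
  have lj := leq_trans (disorder_desc dj) wN.
  by rewrite (IHN _ _ li dj') (IHN _ _ lj di') !mulrA (s_comm lt) !mulgA (adj_comm lt).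
have hl : hi i = lo j by apply/val_inj; rewrite /= e.
have lij : adj j (lo i) = lo i by apply: adjD => /=; apply/eqP; lia.
have hij : adj i (hi j) = hi j by apply: adjD => /=; apply/eqP; lia.
have lj : adj i (lo j) = lo i by rewrite -hl adj_hi.
move: (di) (dj); rewrite /desc hl => di0 dj0.
have d1 : desc j (adj i * w)%g by rewrite /desc !permM hij lj (ltn_trans dj0).
have d2 : desc i (adj j * w)%g by rewrite /desc !permM lij hl adj_lo (ltn_trans dj0).
have d3 : desc i (adj j * (adj i * w))%g.
  by rewrite /desc !permM lij adj_lo hl adj_lo hij.
have d4 : desc j (adj i * (adj j * w))%g.
  by rewrite /desc !permM lj lij hij adj_hi.
have li := leq_trans (disorder_desc di) wN.
have lj' := leq_trans (disorder_desc dj) wN.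
have lji := ltn_trans (disorder_desc d1) li.
have lij' := ltn_trans (disorder_desc d2) lj'.
rewrite (IHN _ _ li d1) (IHN _ _ lj' d2) (IHN _ _ lji d3) (IHN _ _ lij' d4).
by rewrite !mulrA (s_braid e) !mulgA (adj_braid e).
Qed.

Lemma cox_adjM i w : cox (adj i * w) = s i * cox w.
Proof.
have [di|nd] := boolP (desc i w).
  by rewrite (cox_desc di) mulrA s2 mul1r.
by rewrite (cox_desc (desc_adj nd)) mulgA adj2 mul1g.
Qed.

Lemma coxM u w : cox (u * w) = cox u * cox w.
Proof.
elim/adj_ind: u => [|i u IHu]; first by rewrite mul1g cox1 mul1r.
by rewrite -mulgA !cox_adjM IHu mulrA.
Qed.

Lemma cox_adj i : cox (adj i) = s i.
Proof. by rewrite -[adj i]mulg1 cox_adjM cox1 mulr1. Qed.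

Lemma coxV w : cox w * cox w^-1 = 1.
Proof. by rewrite -coxM mulgV cox1. Qed.

Lemma coxVl w : cox w^-1 * cox w = 1.
Proof. by rewrite -coxM mulVg cox1. Qed.

End Coxeter.

(** * Endomorphism algebras and free modules *)

Section EndomorphismAlgebra.
Variables (K : fieldType) (V : lmodType K) (v0 : V).

(* The nonzero vector makes the endomorphism ring nontrivial, as [algType]
   requires. *)
Record endo (v0_neq0 : v0 != 0) :=
  Endo { endo_fun :> V -> V; endo_linear : linear endo_fun }.

Variable v0_neq0 : v0 != 0.
Local Notation E := (endo v0_neq0).

HB.instance Definition _ := gen_eqMixin E.
HB.instance Definition _ := gen_choiceMixin E.

HB.instance Definition _ (f : E) :=
  GRing.isLinear.Build K V V *:%R (endo_fun f) (endo_linear f).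

Lemma endoP (f g : E) : (forall v, f v = g v) -> f = g.
Proof.
case: f g => f fl [g gl] /= /funext fg; case: _ / fg in gl *.
by congr Endo; apply: Prop_irrelevance.
Qed.

Definition endo_of (f : {linear V -> V}) : E := Endo v0_neq0 (@linearP _ _ _ _ f).

Lemma endo0_linear : linear (fun _ : V => 0 : V).
Proof. by move=> c u v; rewrite scaler0 addr0. Qed.
Lemma endo1_linear : linear (fun v : V => v).
Proof. by []. Qed.
Lemma endoN_linear (f : E) : linear (fun v => - f v).
Proof. by move=> c u v; rewrite linearP opprD scalerN. Qed.
Lemma endoD_linear (f g : E) : linear (fun v => f v + g v).
Proof. by move=> c u v; rewrite !linearP scalerDr addrACA. Qed.
Lemma endoM_linear (f g : E) : linear (fun v => f (g v)).
Proof. by move=> c u v; rewrite !linearP. Qed.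
Lemma endoZ_linear (c : K) (f : E) : linear (fun v => c *: f v).
Proof. by move=> b u v; rewrite linearP scalerDr !scalerA mulrC. Qed.

Let zero := Endo v0_neq0 endo0_linear.
Let one := Endo v0_neq0 endo1_linear.
Let opp f := Endo v0_neq0 (endoN_linear f).
Let add f g := Endo v0_neq0 (endoD_linear f g).
Let mul f g := Endo v0_neq0 (endoM_linear f g).
Let scale c f := Endo v0_neq0 (endoZ_linear c f).

Let addA : associative add.
Proof. by move=> f g h; apply: endoP => v /=; rewrite addrA. Qed.
Let addC : commutative add.
Proof. by move=> f g; apply: endoP => v /=; rewrite addrC. Qed.
Let add0 : left_id zero add.
Proof. by move=> f; apply: endoP => v /=; rewrite add0r. Qed.
Let addN : left_inverse zero opp add.
Proof. by move=> f; apply: endoP => v /=; rewrite addNr. Qed.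
HB.instance Definition _ := GRing.isZmodule.Build E addA addC add0 addN.

Let mulA : associative mul.
Proof. by move=> f g h; apply: endoP. Qed.
Let mul1l : left_id one mul.
Proof. by move=> f; apply: endoP. Qed.
Let mul1r : right_id one mul.
Proof. by move=> f; apply: endoP. Qed.
Let mulDl : left_distributive mul +%R.
Proof. by move=> f g h; apply: endoP. Qed.
Let mulDr : right_distributive mul +%R.
Proof. by move=> f g h; apply: endoP => v /=; rewrite linearD. Qed.
Let one_neq0 : one != 0.
Proof.
by apply: contra_neq v0_neq0 => /(congr1 (fun f : E => f v0)).
Qed.
HB.instance Definition _ := GRing.Zmodule_isNzRing.Build E
  mulA mul1l mul1r mulDl mulDr one_neq0.

Let scaleA a b f : scale a (scale b f) = scale (a * b) f.
Proof. by apply: endoP => v /=; rewrite scalerA. Qed.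
Let scale1 : left_id 1 scale.
Proof. by move=> f; apply: endoP => v /=; rewrite scale1r. Qed.
Let scaleDr : right_distributive scale +%R.
Proof. by move=> c f g; apply: endoP => v /=; rewrite scalerDr. Qed.
Let scaleDl f : {morph scale^~ f : a b / a + b}.
Proof. by move=> a b; apply: endoP => v /=; rewrite scalerDl. Qed.
HB.instance Definition _ := GRing.Zmodule_isLmodule.Build K E
  scaleA scale1 scaleDr scaleDl.

Let scaleAl (c : K) (f g : E) : c *: (f * g) = (c *: f) * g.
Proof. exact: endoP. Qed.
HB.instance Definition _ := GRing.Lmodule_isLalgebra.Build K E scaleAl.
Let scaleAr (c : K) (f g : E) : c *: (f * g) = f * (c *: g).
Proof. by apply: endoP => v /=; rewrite linearZ. Qed.
HB.instance Definition _ := GRing.Lalgebra_isAlgebra.Build K E scaleAr.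

Lemma endoDE (f g : E) v : (f + g) v = f v + g v. Proof. by []. Qed.
Lemma endoNE (f : E) v : (- f) v = - f v. Proof. by []. Qed.
Lemma endoME (f g : E) v : (f * g) v = f (g v). Proof. by []. Qed.
Lemma endoZE c (f : E) v : (c *: f) v = c *: f v. Proof. by []. Qed.
Lemma endo_sumE I (r : seq I) P (F : I -> E) v :
  (\sum_(i <- r | P i) F i) v = \sum_(i <- r | P i) F i v.
Proof. by elim/big_rec2: _ => // i a b _ <-. Qed.

Lemma endo_0 (f : E) : f 0 = 0. Proof. exact: linear0. Qed.
Lemma endo_N (f : E) v : f (- v) = - f v. Proof. exact: linearN. Qed.
Lemma endo_B (f : E) u v : f (u - v) = f u - f v. Proof. exact: linearB. Qed.
Lemma endo_Z (f : E) c v : f (c *: v) = c *: f v. Proof. exact: linearZ. Qed.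
Lemma endo_sum (f : E) I (r : seq I) P (F : I -> V) :
  f (\sum_(i <- r | P i) F i) = \sum_(i <- r | P i) f (F i).
Proof. exact: linear_sum. Qed.

End EndomorphismAlgebra.

(** * Linear extension and free modules *)

Section LinearExtension.
Variables (K : fieldType) (T : choiceType) (V : lmodType K) (phi : T -> V).

Definition lext (p : {malg K[T]}) : V := \sum_(b <- msupp p) p@_b *: phi b.

Lemma lextEw (D : {fset T}) p : (msupp p `<=` D)%fset ->
  lext p = \sum_(b <- D) p@_b *: phi b.
Proof.
move=> le; rewrite /lext (big_fset_incl _ le) //= => b _ /mcoeff_outdom ->.
by rewrite scale0r.
Qed.

Lemma lext_linear : linear lext.
Proof.
move=> c p q; pose D := (msupp (c *: p + q) `|` (msupp p `|` msupp q))%fset.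
rewrite !(@lextEw D) ?fsubsetUl //; last 2 first.
- by rewrite (fsubset_trans _ (fsubsetUr _ _)) // fsubsetUr.
- by rewrite (fsubset_trans _ (fsubsetUr _ _)) // fsubsetUl.
rewrite scaler_sumr -big_split; apply: eq_bigr => b _ /=.
by rewrite mcoeffD mcoeffZ scalerDl scalerA.
Qed.

HB.instance Definition _ :=
  GRing.isLinear.Build K {malg K[T]} V *:%R lext lext_linear.

Definition mvec (b : T) : {malg K[T]} := << 1 *g b >>.

Lemma lextU b : lext (mvec b) = phi b.
Proof.
rewrite (@lextEw [fset b]%fset) ?msuppU_le // big_seq_fset1.
by rewrite mcoeffUU scale1r.
Qed.

End LinearExtension.

Lemma mvec_sum (K : fieldType) (T : choiceType) (p : {malg K[T]}) :
  p = \sum_(b <- msupp p) p@_b *: mvec K b.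
Proof.
rewrite {1}[p]monalgE; apply: eq_bigr => b _; apply/malgP => b'.
by rewrite mcoeffZ !mcoeffU mulrnAr mulr1.
Qed.

Record free_lmod (K : fieldType) (T : choiceType) := FreeLmod {
  free_space : lmodType K;
  free_vec : T -> free_space;
  free_ext : forall V : lmodType K, (T -> V) -> {linear free_space -> V};
  free_extE : forall (V : lmodType K) (phi : T -> V) t,
    free_ext phi (free_vec t) = phi t;
  free_ext_uniq : forall (V : lmodType K) (f g : {linear free_space -> V}),
    (forall t, f (free_vec t) = g (free_vec t)) -> f =1 g }.

(* Deliberately opaque: only the universal property is used. *)
Lemma free_lmod_of (K : fieldType) (T : choiceType) : free_lmod K T.
Proof.
apply: (@FreeLmod K T {malg K[T]} (mvec K (T := T)) (fun V phi => lext phi)).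
  by move=> V phi t; apply: lextU.
move=> V f g fg p; rewrite [p]mvec_sum !linear_sum.
by apply: eq_bigr => t _; rewrite !linearZ /= fg.
Qed.

(** * The basis theorem for cyclotomic quotients *)

Section PolynomialModule.
Variables (K : fieldType) (m : nat).

Definition expo := {ffun 'I_m -> nat}.
Implicit Types (a : expo) (w : 'S_m) (l : 'I_m) (i j : 'I_m.-1).

(* The underlying space of the regular representation of the affine algebra:
   [ex a w] is the monomial x^a w. *)
Definition polymod := free_space (free_lmod_of K (expo * 'S_m)%type).
Definition ex a w : polymod := free_vec (free_lmod_of K _) (a, w).

Lemma ex_eq a a' w : a = a' -> ex a w = ex a' w. Proof. by move->. Qed.

Definition inc l a : expo := [ffun l' => a l' + (l' == l)]%N.
Definition perme i a : expo := [ffun l => a (adj i l)].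
Definition set2e i a (p q : nat) : expo :=
  [ffun l => if l == lo i then p else if l == hi i then q else a l].

Definition raise l : {linear polymod -> polymod} :=
  free_ext _ (fun b => ex (inc l b.1) b.2).

(** Both sums of the divided difference share these terms, so the two exponents need not be
    compared; for [t] below one of them the truncated subtraction is exact. *)
Definition dem_term i a w t := ex (set2e i a t (a (lo i) + a (hi i) - t.+1)) w.

(* The divided difference (x^a - s_i x^a) / (x_lo - x_hi). *)
Definition demazure i a w : polymod :=
  \sum_(t < a (lo i)) dem_term i a w t - \sum_(t < a (hi i)) dem_term i a w t.

(** Left multiplication by s_i in the regular representation: moving s_i past a polynomial p gives
    s_i(p) s_i minus the divided difference of p, and the latter term leaves [w] unchanged. *)
Definition pols i : {linear polymod -> polymod} :=
  free_ext _ (fun b => ex (perme i b.1) (adj i * b.2)%g - demazure i b.1 b.2).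

Lemma raiseE l a w : raise l (ex a w) = ex (inc l a) w.
Proof. by rewrite free_extE. Qed.

Lemma polsE i a w :
  pols i (ex a w) = ex (perme i a) (adj i * w)%g - demazure i a w.
Proof. by rewrite free_extE. Qed.

(** The value at [l] of the simple root of s_i, and the constant subtracted in s_i x_l = x_(s_i l)
    s_i - [crossing i l]. *)
Definition crossing i l : K := (l == lo i)%:R - (l == hi i)%:R.

Lemma polmod_ext (V : lmodType K) (f g : {linear polymod -> V}) :
  (forall a w, f (ex a w) = g (ex a w)) -> f =1 g.
Proof. by move=> fg; apply: free_ext_uniq => -[a w]; apply: fg. Qed.

Lemma inc_perme i l a : perme i (inc l a) = inc (adj i l) (perme i a).
Proof.
apply/ffunP => x; rewrite !ffunE; congr (_ + nat_of_bool _)%N.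
by rewrite (can2_eq (adjK i) (adjK i)).
Qed.

Lemma raise_demazure l i a w (F : nat -> polymod) :
    (forall t, (t < a (lo i) + a (hi i))%N -> raise l (dem_term i a w t) = F t) ->
  raise l (demazure i a w) = \sum_(t < a (lo i)) F t - \sum_(t < a (hi i)) F t.
Proof.
move=> rF; rewrite /demazure linearB /= !(linear_sum (raise l)).
congr (_ - _); apply: eq_bigr => t _; apply: rF; have := ltn_ord t; lia.
Qed.

(** Here and in the next two statements this is the twisted Leibniz rule: the divided difference of
    x_l p is that of x_l times p, plus the exchanged variable times that of p. *)
Lemma demazure_inc_lo i a w :
  demazure i (inc (lo i) a) w = ex a w + raise (hi i) (demazure i a w).
Proof.
have lh := negPf (lo_neq_hi i); have hl : hi i == lo i = false by rewrite eq_sym.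
rewrite (@raise_demazure _ _ _ _ (dem_term i (inc (lo i) a) w)) => [|t lt]; last first.
  rewrite raiseE; apply/ex_eq/ffunP => x; rewrite !ffunE eqxx hl.
  case: eqP => [->|_]; first by rewrite lh addn0.
  by case: eqP => _; rewrite ?addn0 //; lia.
rewrite /demazure !ffunE eqxx hl addn0 addn1 big_ord_recr /=.
have -> : dem_term i (inc (lo i) a) w (a (lo i)) = ex a w.
  apply/ex_eq/ffunP => x; rewrite !ffunE eqxx hl.
  case: eqP => [->//|_]; case: eqP => [->|_]; last by rewrite addn0.
  by rewrite addn1 addn0 addSn subSS addKn.
by rewrite addrAC addrC.
Qed.

Lemma demazure_inc_hi i a w :
  demazure i (inc (hi i) a) w = - ex a w + raise (lo i) (demazure i a w).
Proof.
have lh := negPf (lo_neq_hi i); have hl : hi i == lo i = false by rewrite eq_sym.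
pose F t := dem_term i (inc (hi i) a) w t.
rewrite (@raise_demazure _ _ _ _ (fun t => F t.+1)) => [|t lt]; last first.
  rewrite raiseE; apply/ex_eq/ffunP => x; rewrite !ffunE eqxx lh.
  case: eqP => _; first by rewrite addn1.
  by case: eqP => _; rewrite ?addn0 //; lia.
have -> : ex a w = F (a (lo i)).
  apply/ex_eq/ffunP => x; rewrite !ffunE eqxx lh.
  case: eqP => [->//|_]; case: eqP => [->|_]; last by rewrite addn0.
  by rewrite addn0 addn1 addnS subSS addKn.
rewrite /demazure !ffunE eqxx lh addn0 addn1 -/(F _) [X in _ - X]big_ord_recl /=.
have : \sum_(t < (a (lo i)).+1) F t = \sum_(t < a (lo i)) F t + F (a (lo i)).
  by rewrite big_ord_recr.
rewrite big_ord_recl => /esym/(canRL (addrK _)) ->; rewrite opprD !addrA.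
by congr (_ - _); rewrite addrAC [F _ + _]addrC addrK addrC.
Qed.

Lemma demazure_inc i l a w : l != lo i -> l != hi i ->
  demazure i (inc l a) w = raise l (demazure i a w).
Proof.
rewrite ![l == _]eq_sym => /negPf ll /negPf lh.
rewrite (@raise_demazure _ _ _ _ (dem_term i (inc l a) w)) => [|t lt].
  by rewrite /demazure !ffunE ll lh !addn0.
rewrite raiseE; apply/ex_eq/ffunP => x; rewrite !ffunE ll lh !addn0.
case: eqP => [->|_]; first by rewrite ll addn0.
by case: eqP => // ->; rewrite lh addn0.
Qed.

Lemma pols_raise i l v :
  pols i (raise l v) = raise (adj i l) (pols i v) - crossing i l *: v.
Proof.
move: v; apply: (polmod_ext (f := pols i \o raise l)
  (g := (raise (adj i l) \o pols i) \- crossing i l \*: idfun)) => a w.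
rewrite -[LHS]/(pols i (raise l (ex a w))).
rewrite -[RHS]/(raise (adj i l) (pols i (ex a w)) - crossing i l *: ex a w).
rewrite raiseE !polsE inc_perme (linearB (raise _)) raiseE /crossing -!addrA.
congr (_ + _).
have [->|ll] := eqVneq l (lo i).
  rewrite (negPf (lo_neq_hi i)) subr0 scale1r demazure_inc_lo adj_lo.
  by rewrite opprD addrC.
have [->|lh] := eqVneq l (hi i).
  by rewrite sub0r scaleN1r demazure_inc_hi adj_hi opprD !opprK addrC.
by rewrite subrr scale0r subr0 demazure_inc // adjD.
Qed.

Lemma expo_ind (P : expo -> Prop) : P [ffun=> 0%N] ->
  (forall l a, P a -> P (inc l a)) -> forall a, P a.
Proof.
move=> P0 PS a; have [N] := ubnP (\sum_l a l)%N.
elim: N a => // N IHN a aN.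
have [/existsP[l al]|] := boolP [exists l, a l != 0%N]; last first.
  rewrite negb_exists => /forallP a0; have -> // : a = [ffun=> 0%N].
  by apply/ffunP => l; rewrite ffunE; apply/eqP/negPn/a0.
pose a' : expo := [ffun l' => a l' - (l' == l)]%N.
have -> : a = inc l a'.
  apply/ffunP => l'; rewrite !ffunE; case: eqP => [->|_]; last by rewrite subn0 addn0.
  by rewrite subn1 addn1 prednK // lt0n.
apply: PS; apply: IHN; rewrite ltnS in aN; apply: leq_trans aN.
rewrite [ltnRHS](bigD1 l) //= (bigD1 l) //= ffunE eqxx subn1.
rewrite (eq_bigr a); first by rewrite ltn_add2r prednK // lt0n.
by move=> l' ll'; rewrite ffunE (negPf ll') subn0.
Qed.

(** Reduces the Coxeter relations to the monomials without variables, where they hold in the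
    symmetric group, and to the rule [pols_raise] for moving s_i past one variable. *)
Lemma pols_raise_ext (V : lmodType K) (f g : {linear polymod -> V}) :
    (forall w, f (ex [ffun=> 0%N] w) = g (ex [ffun=> 0%N] w)) ->
    (forall l v, f v = g v -> f (raise l v) = g (raise l v)) ->
  f =1 g.
Proof.
move=> fg0 fgS; apply: polmod_ext => a w.
by elim/expo_ind: a => [|l a IHa]; rewrite -?raiseE ?fg0 ?fgS.
Qed.

Lemma pols0 i w : pols i (ex [ffun=> 0%N] w) = ex [ffun=> 0%N] (adj i * w)%g.
Proof.
rewrite polsE /demazure !ffunE !big_ord0 !subr0.
by apply/ex_eq/ffunP => x; rewrite !ffunE.
Qed.

Lemma crossing_adj i l : crossing i (adj i l) = - crossing i l.
Proof.
rewrite /crossing !(can2_eq (adjK i) (adjK i)) adj_lo adj_hi opprB.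
by [].
Qed.

Lemma polsBZ i u c v : pols i (u - c *: v) = pols i u - c *: pols i v.
Proof. by rewrite (linearB (pols i)) (linearZ_LR (pols i)). Qed.

Lemma pols2 i v : pols i (pols i v) = v.
Proof.
move: v; apply: (pols_raise_ext (f := pols i \o pols i) (g := idfun)) => [w|l v /= IH].
- by rewrite /= !pols0 mulgA adj2 mul1g.
rewrite pols_raise polsBZ pols_raise IH adjK crossing_adj.
by rewrite scaleNr opprK addrK.
Qed.

Lemma crossing_far i j l : (i.+1 < j)%N || (j.+1 < i)%N ->
  crossing i (adj j l) = crossing i l.
Proof.
move=> ij; rewrite /crossing !(can2_eq (adjK j) (adjK j)).
by rewrite !adjD //=; apply/eqP; lia.
Qed.

Lemma pols_comm i j v : (i.+1 < j)%N -> pols i (pols j v) = pols j (pols i v).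
Proof.
move=> ij; move: v; apply: (pols_raise_ext (f := pols i \o pols j)
  (g := pols j \o pols i)) => [w|l v /= IH].
- by rewrite /= !pols0 !mulgA adj_comm.
rewrite !pols_raise !polsBZ !pols_raise IH.
by rewrite !crossing_far ?ij ?orbT // -!permM (adj_comm ij) addrAC.
Qed.

Lemma pols_braid i j v : j = i.+1 :> nat ->
  pols i (pols j (pols i v)) = pols j (pols i (pols j v)).
Proof.
move=> ij; have hl : hi i = lo j by apply/val_inj; rewrite /= ij.
have lij : adj j (lo i) = lo i by apply: adjD => /=; apply/eqP; lia.
have hij : adj i (hi j) = hi j by apply: adjD => /=; apply/eqP; lia.
have lj : adj i (lo j) = lo i by rewrite -hl adj_hi.
have li : adj i (lo i) = lo j by rewrite -hl adj_lo.
(* The scalars produced by the words s_i s_j s_i and s_j s_i s_j are the three positive roots of a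
   rank two system, in opposite orders; [c3] is the middle root. *)
have c1 l : crossing i (adj j (adj i l)) = crossing j l.
  rewrite /crossing !(can2_eq (adjK j) (adjK j)) !(can2_eq (adjK i) (adjK i)).
  by rewrite lij li hl adj_lo hij.
have c2 l : crossing j (adj i (adj j l)) = crossing i l.
  rewrite /crossing !(can2_eq (adjK i) (adjK i)) !(can2_eq (adjK j) (adjK j)).
  by rewrite lj lij hij adj_hi hl.
have c3 l : crossing j (adj i l) = crossing i (adj j l).
  rewrite /crossing !(can2_eq (adjK i) (adjK i)) !(can2_eq (adjK j) (adjK j)).
  by rewrite lj lij hij hl adj_lo.
move: v; apply: (pols_raise_ext (f := pols i \o pols j \o pols i)
  (g := pols j \o pols i \o pols j)) => [w|l v /= IH].
- by rewrite /= !pols0 !mulgA adj_braid.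
rewrite !(pols_raise, polsBZ) !pols2 IH c1 c2 c3.
have -> : adj i (adj j (adj i l)) = adj j (adj i (adj j l)).
  by rewrite -!permM !mulgA adj_braid.
by rewrite [LHS]addrAC [X in X - _ = _]addrAC [LHS]addrAC.
Qed.

End PolynomialModule.

(** * The span of the monomials with exponents below d *)

Section RestrictedModule.
Variables (K : fieldType) (m d : nat).
Hypothesis d_gt0 : (0 < d)%N.

Local Notation expo := (expo m).
Local Notation polymod := (polymod K m).
Implicit Types (a : expo) (w : 'S_m) (l z : 'I_m) (i j : 'I_m.-1).

Definition box a := [forall l, (a l < d)%N].
Definition boxexpo := {a : expo | box a}.
Definition boxmod := free_space (free_lmod_of K (boxexpo * 'S_m)%type).

(** Exponents outside the box give 0, so that [tobox] is a projection onto the restricted span. *)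
Definition bx a w : boxmod :=
  oapp (fun b : boxexpo => free_vec (free_lmod_of K _) (b, w)) 0 (insub a).

Definition unbox : {linear boxmod -> polymod} :=
  free_ext _ (fun b : boxexpo * 'S_m => ex K (val b.1) b.2).
Definition tobox : {linear polymod -> boxmod} :=
  free_ext _ (fun b => bx b.1 b.2).

Lemma toboxE a w : tobox (ex K a w) = bx a w.
Proof. by rewrite free_extE. Qed.

Lemma unboxE a w : box a -> unbox (bx a w) = ex K a w.
Proof. by move=> ba; rewrite /bx insubT /= free_extE. Qed.

Lemma boxP a : reflect (forall l, (a l < d)%N) (box a).
Proof. exact: forallP. Qed.

Lemma boxmod_ext (V : lmodType K) (f g : {linear boxmod -> V}) :
  (forall a w, box a -> f (bx a w) = g (bx a w)) -> f =1 g.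
Proof.
move=> fg; apply: free_ext_uniq => -[b w].
by have := fg (val b) w (valP b); rewrite /bx valK.
Qed.

Lemma unboxK v : tobox (unbox v) = v.
Proof.
move: v; apply: (boxmod_ext (f := tobox \o unbox) (g := idfun)) => a w ba.
by rewrite -[LHS]/(tobox (unbox (bx a w))) unboxE // toboxE.
Qed.

Definition boxed (p : polymod) := unbox (tobox p) = p.

Lemma boxed_ex a w : box a -> boxed (ex K a w).
Proof. by move=> ba; rewrite /boxed toboxE unboxE. Qed.

Lemma boxedB p q : boxed p -> boxed q -> boxed (p - q).
Proof. by rewrite /boxed (linearB tobox) (linearB unbox) => -> ->. Qed.

Lemma boxedZ c p : boxed p -> boxed (c *: p).
Proof. by rewrite /boxed (linearZ_LR tobox) (linearZ_LR unbox) => ->. Qed.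

Lemma boxed0 : boxed 0.
Proof. by rewrite /boxed !linear0. Qed.

Lemma boxed_sum I (r : seq I) (F : I -> polymod) :
  (forall k, boxed (F k)) -> boxed (\sum_(k <- r) F k).
Proof.
move=> bF; elim/big_rec: _ => [|k p _ bp]; first exact: boxed0.
by rewrite -[p]opprK -[- p]add0r; apply: boxedB => //; apply: boxedB => //; apply: boxed0.
Qed.

(** After cancellation only the [t] between the two exponents [a (lo i)] and [a (hi i)] remain, so
    both new exponents stay strictly below the larger one. The divided difference thus stays in the
    box, with room for one more factor x_lo or x_hi. *)
Lemma demazure_closed (Q : polymod -> Prop) i a w :
    Q 0 -> (forall p q, Q p -> Q q -> Q (p - q)) ->
    (forall a', box a' -> ((a' (lo i)).+1 < d)%N -> ((a' (hi i)).+1 < d)%N ->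
      (forall l, l != lo i -> l != hi i -> a' l = a l) -> Q (ex K a' w)) ->
  box a -> Q (demazure K i a w).
Proof.
move=> Q0 QB Qex /boxP ba.
have QD p q : Q p -> Q q -> Q (p + q).
  by move=> Qp Qq; rewrite -[q]opprK -[- q]add0r; apply: (QB) => //; apply: QB.
have Qsum p q (F : nat -> polymod) : (forall t, (q <= t < p)%N -> Q (F t)) ->
    Q (\sum_(q <= t < p) F t).
  by move=> QF; rewrite big_nat; elim/big_rec: _ => // t u qt Qu; apply: QD => //; apply: QF.
have hl : hi i == lo i = false by rewrite eq_sym (negPf (lo_neq_hi i)).
have Qt t : (minn (a (lo i)) (a (hi i)) <= t < maxn (a (lo i)) (a (hi i)))%N ->
    Q (dem_term K i a w t).
  have := ba (lo i); have := ba (hi i) => dl dh dt.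
  apply: Qex; rewrite ?ffunE ?eqxx ?hl; try lia.
    by apply/boxP => l; rewrite ffunE; case: eqP => _; [|case: eqP => _] => //; lia.
  by move=> l /negPf ll /negPf lh; rewrite ffunE ll lh.
rewrite /demazure -!(big_mkord xpredT (dem_term K i a w)).
have [le|/ltnW le] := leqP (a (hi i)) (a (lo i)).
  rewrite (big_cat_nat _ le) //= addrAC subrr add0r; apply: Qsum => t tl.
  by apply: Qt; lia.
rewrite (@big_cat_nat _ _ _ _ _ (a (hi i)) _ _ _ le) //= opprD addrA subrr.
by apply: QB => //; apply: Qsum => t tl; apply: Qt; lia.
Qed.

Lemma box_perme i a : box a -> box (perme i a).
Proof. by move/boxP=> ba; apply/boxP => l; rewrite ffunE. Qed.

Lemma boxed_pols i v : boxed (pols K i (unbox v)).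
Proof.
rewrite /boxed; move: v.
apply: (boxmod_ext (f := unbox \o (tobox \o (pols K i \o unbox))) (g := pols K i \o unbox)).
move=> a w ba; rewrite -[LHS]/(unbox (tobox (pols K i (unbox (bx a w))))).
rewrite -[RHS]/(pols K i (unbox (bx a w))) unboxE // polsE.
apply: boxedB; first exact/boxed_ex/box_perme.
apply: demazure_closed => //; first exact: boxed0.
  exact: boxedB.
by move=> a' ba' _ _ _; apply: boxed_ex.
Qed.

Definition bzero : expo := [ffun=> 0%N].

Lemma box0 : box bzero.
Proof. by apply/boxP => l; rewrite ffunE. Qed.

Lemma bx_neq0 a w : box a -> bx a w != 0.
Proof.
move=> ba; apply/eqP => /(congr1 unbox); rewrite unboxE // linear0.
pose f : {linear polymod -> K^o} := free_ext (free_lmod_of K _) (fun=> 1 : K^o).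
move/(congr1 f); rewrite linear0 [LHS]free_extE => /eqP.
by rewrite oner_eq0.
Qed.

Local Notation E := (endo (bx_neq0 1%g box0)).

Definition bsE i : E := endo_of _ (tobox \o pols K i \o unbox).

Lemma bsEE i v : bsE i v = tobox (pols K i (unbox v)). Proof. by []. Qed.

Lemma unbox_bs i v : unbox (bsE i v) = pols K i (unbox v).
Proof. by rewrite bsEE; apply: boxed_pols. Qed.

Lemma unbox_inj : injective unbox.
Proof. exact: can_inj unboxK. Qed.

Lemma bs2 i : bsE i * bsE i = 1.
Proof. by apply: endoP => v; apply: unbox_inj; rewrite !unbox_bs pols2. Qed.

Lemma bs_comm i j : (i.+1 < j)%N -> bsE i * bsE j = bsE j * bsE i.
Proof.
by move=> ij; apply: endoP => v; apply: unbox_inj; rewrite !unbox_bs pols_comm.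
Qed.

Lemma bs_braid i j : j = i.+1 :> nat ->
  bsE i * bsE j * bsE i = bsE j * bsE i * bsE j.
Proof.
by move=> ij; apply: endoP => v; apply: unbox_inj; rewrite !unbox_bs pols_braid.
Qed.

Lemma bs_bx i a w : box a ->
  bsE i (bx a w) = bx (perme i a) (adj i * w)%g - tobox (demazure K i a w).
Proof. by move=> ba; rewrite bsEE unboxE // polsE (linearB tobox) toboxE. Qed.

Lemma bs0 i w : bsE i (bx bzero w) = bx bzero (adj i * w)%g.
Proof. by rewrite bsEE unboxE ?box0 // pols0 toboxE. Qed.

Variable f : nat -> K.

Definition upd z t a : expo := [ffun l => if l == z then t else a l].

(** Multiplication by x_z followed by reduction modulo the monic polynomial of degree d whose lower
    coefficients are the [f t]. The representation uses it for the first variable. *)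
Definition redux z : {linear polymod -> polymod} :=
  free_ext _ (fun b : expo * 'S_m => if ((b.1 z).+1 < d)%N then ex K (inc z b.1) b.2
    else - \sum_(t < d) f t *: ex K (upd z t b.1) b.2).

Lemma reduxE z a w : redux z (ex K a w) =
  if ((a z).+1 < d)%N then ex K (inc z a) w
  else - \sum_(t < d) f t *: ex K (upd z t a) w.
Proof. by rewrite free_extE. Qed.

Lemma box_inc z a : box a -> ((a z).+1 < d)%N -> box (inc z a).
Proof.
move=> /boxP ba az; apply/boxP => l; rewrite ffunE.
by case: eqP => [->|_]; rewrite ?addn1 ?addn0.
Qed.

Lemma box_upd z t a : box a -> (t < d)%N -> box (upd z t a).
Proof. by move=> /boxP ba td; apply/boxP => l; rewrite ffunE; case: eqP. Qed.

Lemma boxed_redux z v : boxed (redux z (unbox v)).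
Proof.
rewrite /boxed; move: v.
apply: (boxmod_ext (f := unbox \o (tobox \o (redux z \o unbox))) (g := redux z \o unbox)).
move=> a w ba; rewrite -[LHS]/(unbox (tobox (redux z (unbox (bx a w))))).
rewrite -[RHS]/(redux z (unbox (bx a w))) unboxE // reduxE.
case: ifP => az; first by apply/boxed_ex/box_inc.
rewrite -sub0r; apply: boxedB; first exact: boxed0.
by apply: boxed_sum => t; apply/boxedZ/boxed_ex/box_upd.
Qed.

Definition bx1 z : E := endo_of _ (tobox \o redux z \o unbox).

Lemma bx1E z a w : box a -> bx1 z (bx a w) =
  if ((a z).+1 < d)%N then bx (inc z a) w
  else - \sum_(t < d) f t *: bx (upd z t a) w.
Proof.
move=> ba; rewrite -[LHS]/(tobox (redux z (unbox (bx a w)))) unboxE // reduxE.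
case: ifP => _; first exact: toboxE.
rewrite (linearN tobox) (linear_sum tobox); congr (- _).
by apply: eq_bigr => t _; rewrite (linearZ_LR tobox) toboxE.
Qed.

Lemma unbox_bx1 z v : unbox (bx1 z v) = redux z (unbox v).
Proof. exact: boxed_redux. Qed.

Definition substz z t : {linear polymod -> polymod} :=
  free_ext _ (fun b : expo * 'S_m => ex K (upd z t b.1) b.2).

Lemma substzE z t a w : substz z t (ex K a w) = ex K (upd z t a) w.
Proof. by rewrite free_extE. Qed.

Lemma demazure_substz i z t a w : z != lo i -> z != hi i ->
  substz z t (demazure K i a w) = demazure K i (upd z t a) w.
Proof.
rewrite ![z == _]eq_sym => /negPf zl /negPf zh.
rewrite /demazure (linearB (substz z t)) !(linear_sum (substz z t)) !ffunE zl zh.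
have e k : substz z t (dem_term K i a w k) = dem_term K i (upd z t a) w k.
  rewrite substzE; apply/ex_eq/ffunP => x; rewrite !ffunE zl zh.
  by case: (x =P z) => // ->; rewrite ![z == _]eq_sym zl zh.
by congr (_ - _); apply: eq_bigr => k _; rewrite e.
Qed.

Lemma redux_demazure i z a w : z != lo i -> z != hi i -> redux z (demazure K i a w) =
  if ((a z).+1 < d)%N then demazure K i (inc z a) w
  else - \sum_(t < d) f t *: demazure K i (upd z t a) w.
Proof.
move=> zl zh; have dz t : set2e i a t (a (lo i) + a (hi i) - t.+1) z = a z.
  by rewrite ffunE (negPf zl) (negPf zh).
have [az|az] := ifP.
  rewrite demazure_inc // /demazure (linearB (redux z)) (linearB (raise K z)).
  rewrite !(linear_sum (redux z)) !(linear_sum (raise K z)).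
  by congr (_ - _); apply: eq_bigr => t _; rewrite reduxE raiseE dz az.
under eq_bigr do rewrite -demazure_substz //.
have e k : redux z (dem_term K i a w k) = - \sum_(t < d) f t *: substz z t (dem_term K i a w k).
  rewrite reduxE dz az; congr (- _); apply: eq_bigr => t _.
  by rewrite substzE.
have RQ n : redux z (\sum_(k < n) dem_term K i a w k) =
    - \sum_(t < d) f t *: substz z t (\sum_(k < n) dem_term K i a w k).
  rewrite (linear_sum (redux z)) (eq_bigr _ (fun (k : 'I_n) _ => e k)) sumrN exchange_big.
  by congr (- _); apply: eq_bigr => t _; rewrite (linear_sum (substz z t)) scaler_sumr.
rewrite {1}/demazure (linearB (redux z)) !RQ -opprD -sumrB; congr (- _).
by apply: eq_bigr => t _; rewrite (linearB (substz z t)) scalerBr.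
Qed.

Lemma redux_pols i z p : z != lo i -> z != hi i ->
  redux z (pols K i p) = pols K i (redux z p).
Proof.
move=> zl zh; move: p.
apply: (polmod_ext (f := redux z \o pols K i) (g := pols K i \o redux z)) => a w.
rewrite -[LHS]/(redux z (pols K i (ex K a w))) -[RHS]/(pols K i (redux z (ex K a w))).
rewrite polsE (linearB (redux z)) redux_demazure // !reduxE ffunE adjD //.
case: ifP => _; first by rewrite polsE inc_perme adjD.
rewrite (linearN (pols K i)) (linear_sum (pols K i)) -opprD; congr (- _).
rewrite -sumrB; apply: eq_bigr => t _.
rewrite (linearZ_LR (pols K i)) polsE -scalerBr; congr (_ *: (_ - _)).
apply/ex_eq/ffunP => x; rewrite !ffunE (can2_eq (adjK i) (adjK i)).
by rewrite [adj i z]adjD.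
Qed.

Lemma bx1_bs i z : z != lo i -> z != hi i -> bx1 z * bsE i = bsE i * bx1 z.
Proof.
move=> zl zh; apply: endoP => v; apply: unbox_inj.
by rewrite !(unbox_bs, unbox_bx1) redux_pols.
Qed.

End RestrictedModule.

(* The degenerate affine Hecke algebra needs only s_1, .., s_(m-1), x_1; the other
   relations follow from x_(i+1) = s_i x_i s_i + s_i. *)
Section AffineGenerators.
Variables (m : nat) (B : nzRingType) (s : 'I_m.-1 -> B) (x : 'I_m -> B).
Hypothesis s2 : forall i, s i * s i = 1.
Hypothesis s_comm : forall i j : 'I_m.-1, (i.+1 < j)%N -> s i * s j = s j * s i.
Hypothesis s_braid : forall i j : 'I_m.-1, j = i.+1 :> nat ->
  s i * s j * s i = s j * s i * s j.
Hypothesis x_hi : forall i, x (hi i) = s i * x (lo i) * s i + s i.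
Hypothesis x0_s : forall (z : 'I_m) (i : 'I_m.-1), z = 0%N :> nat -> (0 < i)%N ->
  x z * s i = s i * x z.
Hypothesis x01 : forall i : 'I_m.-1, i = 0%N :> nat ->
  x (lo i) * x (hi i) = x (hi i) * x (lo i).

Lemma ord_hi n (i : 'I_m) : i = n.+1 :> nat ->
  exists2 k : 'I_m.-1, k = n :> nat & i = hi k.
Proof.
move=> e; have lt : (n < m.-1)%N by have := ltn_ord i; lia.
by exists (Ordinal lt) => //; apply/val_inj.
Qed.

(** Induction on [i], writing x_i as s_k x_k s_k + s_k. The generator s_j commutes with s_k and x_k
    unless k = j + 1; then x_k is expanded once more and the braid relation applies. *)
Lemma gen_s_x (j : 'I_m.-1) (i : 'I_m) : i != j :> nat -> i != j.+1 :> nat ->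
  GRing.comm (s j) (x i).
Proof.
have [n] := ubnP (i : nat); elim: n i j => // n IHn i j lt ij ij1.
case e : (i : nat) => [|n'].
  by rewrite /GRing.comm x0_s //; lia.
have [k kn ik] := ord_hi e.
have lok : (lo k < n)%N by move: lt; rewrite e /= kn; lia.
rewrite ik x_hi.
have [far|near] := boolP ((j.+1 < k)%N || (k.+1 < j)%N).
  have sjk : GRing.comm (s j) (s k).
    by case/orP: far => far; [exact: s_comm | apply: commr_sym; exact: s_comm].
  apply: commrD => //; apply: commrM => //; apply: commrM => //.
  by apply: IHn => //=; apply/eqP; lia.
have jk : (k : nat) = j.+1 by lia.
have lokj : lo k = hi j by apply/val_inj.
have skx : s k * x (lo j) = x (lo j) * s k.
  by apply: IHn; rewrite /=; [move: lok; rewrite /=; lia| |]; apply/eqP; lia.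
rewrite lokj x_hi mulrDr mulrDl -addrA.
have br := s_braid jk.
apply: commrD; rewrite /GRing.comm.
  rewrite !mulrA br -[_ * s k * x _]mulrA skx !mulrA.
  by rewrite -!mulrA; do 3!congr (_ * _); rewrite !mulrA br.
by rewrite mulrDr mulrDl -br !mulrA s2 mul1r -!mulrA s2 mulr1 addrC.
Qed.

(** The smaller index and then the larger one are lowered along x_(k+1) = s_k x_k s_k + s_k, until
    only the commutation of x_1 and x_2 is left. *)
Lemma gen_x_x (i j : 'I_m) : GRing.comm (x i) (x j).
Proof.
wlog ij : i j / (i < j)%N => [hw|].
  have [ij|ji|/val_inj->//] := ltngtP i j; first exact: hw.
  by apply: commr_sym; apply: hw.
have [n] := ubnP (i : nat); elim: n i j ij => // n IHn i j ij lt.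
case e : (i : nat) => [|p]; last first.
  have [k kn ->] := ord_hi e; rewrite x_hi; apply: commr_sym.
  have cs : GRing.comm (x j) (s k).
    by apply: commr_sym; apply: gen_s_x; apply/eqP; lia.
  apply: commrD => //; apply: commrM => //; apply: commrM => //.
  by apply: commr_sym; apply: IHn; rewrite /=; lia.
clear IHn lt; have [M] := ubnP (j : nat); elim: M j ij => // M IHn j ij lt.
case ej : (j : nat) => [|[|n']]; first by move: ij; rewrite e ej.
  have [k kn ->] := ord_hi ej; have -> : i = lo k by apply/val_inj; rewrite /= kn.
  exact: x01.
have [k kn ->] := ord_hi ej; rewrite x_hi.
have cs : GRing.comm (x i) (s k) by apply: x0_s => //; lia.
apply: commrD => //; apply: commrM => //; apply: commrM => //.
by apply: IHn; rewrite /= ?e; lia.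
Qed.

End AffineGenerators.

(** * The action of the cyclotomic quotient on restricted monomials *)

Section CyclotomicRepresentation.
Variables (K : fieldType) (m d : nat).
Hypothesis d_gt0 : (0 < d)%N.
Variable f : nat -> K.

Local Notation expo := (expo m).
Local Notation polymod := (polymod K m).
Local Notation V := (boxmod K m d).
Local Notation bx := (@bx K m d).
Local Notation bsE := (@bsE K m d d_gt0).
Local Notation bx1 := (@bx1 K m d d_gt0 f).
Local Notation tobox := (@tobox K m d).
Local Notation box := (@box m d).
Local Notation E := (endo (@bx_neq0 K m d _ 1%g (box0 m d_gt0))).
Implicit Types (a : expo) (w : 'S_m) (l z : 'I_m) (i j : 'I_m.-1).

(** The first variable is the reduced multiplication, and the others are forced by x_(i+1) = s_i x_i
    s_i + s_i. The default 0 concerns only numbers that index no variable. *)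
Fixpoint bxn n : E :=
  if n is n'.+1 then
    oapp (fun i : 'I_m.-1 => bsE i * bxn n' * bsE i + bsE i) 0 (insub n')
  else oapp bx1 0 (insub 0%N).

Definition bxE l : E := bxn l.

Lemma bxE0 z : z = 0%N :> nat -> bxE z = bx1 z.
Proof.
move=> z0; rewrite /bxE z0 /=; have -> : insub 0%N = Some z :> option 'I_m.
  by rewrite -z0 valK.
by [].
Qed.

Lemma bxE_hi i : bxE (hi i) = bsE i * bxE (lo i) * bsE i + bsE i.
Proof.
rewrite /bxE /=; have -> : insub (nat_of_ord i) = Some i :> option 'I_m.-1.
  exact: valK.
by [].
Qed.

(** The operator is defined by recursion through the s_i. Divided differences of a restricted
    monomial have room for one more factor, so below the bound no reduction occurs and the
    computation in the regular representation carries over. *)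
Lemma bxE_bx l a w : box a -> ((a l).+1 < d)%N -> bxE l (bx a w) = bx (inc l a) w.
Proof.
move: {2}(l : nat) (erefl (l : nat)) => n; elim: n l a w => [|n IHn] l a w e ba al.
  by rewrite bxE0 // bx1E // al.
have [k kn lk] := ord_hi e; rewrite {l e}lk in al *.
(* The property says that on [p] the preceding variable acts by plain multiplication without leaving
   the box; it passes to differences, so [demazure_closed] applies to it. *)
pose Q p := bxE (lo k) (tobox p) = tobox (raise K (lo k) p) /\
  boxed d (raise K (lo k) p).
have Q0 : Q 0.
  rewrite /Q (linear0 tobox) (linear0 (raise K _)) (linear0 tobox) endo_0.
  by split=> //; apply: boxed0.
have QB p q : Q p -> Q q -> Q (p - q).
  rewrite /Q (linearB tobox) (linearB (raise K _)) !(linearB tobox) endo_B.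
  by case=> -> bp [-> bq]; split => //; apply: boxedB.
have Qex a' w' : box a' -> ((a' (lo k)).+1 < d)%N -> Q (ex K a' w').
  move=> ba' al'; rewrite /Q raiseE !toboxE IHn //; split => //.
  exact/boxed_ex/box_inc.
have [Q1 Q2] : Q (pols K k (ex K a w)).
  rewrite polsE; apply: (QB).
    by apply: (Qex); [apply: box_perme|rewrite ffunE adj_lo].
  apply: (demazure_closed d_gt0 (Q := Q)) => //.
  by move=> a' ba' h1 _ _; apply: Qex.
rewrite bxE_hi endoDE !endoME.
have -> : bsE k (bx a w) = tobox (pols K k (ex K a w)) by rewrite bsEE unboxE.
rewrite Q1 bsEE Q2.
rewrite pols_raise pols2 adj_lo /crossing eqxx (negPf (lo_neq_hi k)) subr0 scale1r.
by rewrite (linearB tobox) subrK raiseE toboxE.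
Qed.

Section FirstVariable.
Variable z : 'I_m.
Let x1 : E := bx1 z.

Definition fbx1 : E := x1 ^+ d + \sum_(t < d) f t *: x1 ^+ t.

Lemma x1_upd a w t s : box a -> (t + s < d)%N ->
  (x1 ^+ s) (bx (upd z t a) w) = bx (upd z (t + s) a) w.
Proof.
move=> ba; elim: s => [|s IHs] ts; first by rewrite expr0 addn0.
rewrite exprS endoME IHs; last by lia.
rewrite bx1E ?box_upd //; last by lia.
rewrite ffunE eqxx -addnS ts; congr (bx _ w).
by apply/ffunP => x; rewrite !ffunE; case: eqP => _; rewrite ?addn1 ?addnS ?addn0.
Qed.

Lemma upd_id a : upd z (a z) a = a.
Proof. by apply/ffunP => x; rewrite ffunE; case: eqP => [->|]. Qed.

Lemma x1_gen a w t : box a -> (t < d)%N -> bx (upd z t a) w = (x1 ^+ t) (bx (upd z 0 a) w).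
Proof. by move=> ba td; rewrite x1_upd. Qed.

Lemma fbx1_comm : GRing.comm x1 fbx1.
Proof.
apply: commrD; first exact/commrX.
apply: commr_sum => t _; rewrite /GRing.comm -scalerAl -scalerAr; congr (_ *: _).
exact/commrX.
Qed.

(** f(x_1) commutes with x_1, so it suffices to kill the monomials with exponent 0 at [z]. There
    only the d-th application of x_1 is reduced, and it yields minus the lower part of f. *)
Lemma fbx1_0 : fbx1 = 0.
Proof.
apply: endoP; apply: (boxmod_ext (f := fbx1) (g := (0 : E))) => a w ba.
rewrite -[LHS]/(fbx1 (bx a w)) -[RHS]/(0 : V) -[a]upd_id x1_gen //; last exact/boxP.
rewrite -endoME (commrX (a z) (commr_sym fbx1_comm)) endoME.
suff -> : fbx1 (bx (upd z 0 a) w) = 0 by rewrite endo_0.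
have e : x1 ^+ d = x1 * x1 ^+ d.-1 by rewrite -exprS prednK.
rewrite endoDE endo_sumE e endoME x1_upd //; last by lia.
rewrite bx1E ?box_upd //; last by lia.
rewrite ffunE eqxx add0n prednK // ltnn addrC.
apply/eqP; rewrite subr_eq0; apply/eqP; apply: eq_bigr => t _.
rewrite endoZE x1_upd ?add0n //; congr (_ *: bx _ w).
by apply/ffunP => x; rewrite !ffunE; case: eqP.
Qed.

End FirstVariable.

Section FirstTwo.
Variables (k : 'I_m.-1) (z : 'I_m).
Hypothesis (k0 : k = 0%N :> nat) (z0 : z = 0%N :> nat).

Let zk : z = lo k. Proof. by apply/val_inj; rewrite /= k0. Qed.
Let x1 : E := bx1 z.
Let x2 : E := bxE (hi k).
Let D : E := x1 * x2 - x2 * x1.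

(** A formal consequence of T^2 = 1 and x_2 = T x_1 T + T, for T the action of s_1. It transports
    the vanishing of the commutator to monomials with the two exponents exchanged. *)
Lemma cross_comm_anti : D * bsE k = - (bsE k * D).
Proof.
have T2 : bsE k * bsE k = 1 by apply: bs2.
set T := bsE k in T2 *.
have e2 : x2 = T * x1 * T + T by rewrite /x2 bxE_hi -zk bxE0.
have x2T : x2 * T = T * x1 + 1 by rewrite e2 mulrDl -mulrA T2 mulr1.
have Tx2 : T * x2 = x1 * T + 1 by rewrite e2 mulrDr !mulrA T2 mul1r.
have x1T : x1 * T = T * x2 - 1 by rewrite Tx2 addrK.
have x12 : x1 * x2 * T = T * x2 * x1.
  by rewrite -mulrA x2T mulrDr mulr1 mulrA x1T mulrBl mul1r subrK.
have x21 : x2 * x1 * T = T * x1 * x2.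
  by rewrite -mulrA x1T mulrBr mulr1 mulrA x2T mulrDl mul1r addrK.
by rewrite /D mulrBl x12 x21 mulrBr opprB !mulrA.
Qed.

(** With room at x_2 both orders are computed directly. With room at x_1 only, s_1 exchanges the two
    exponents, up to divided differences that have room at both, and [cross_comm_anti] carries the
    vanishing back. *)
Lemma cross_comm_single a w : box a ->
  ((a z).+1 < d)%N || ((a (hi k)).+1 < d)%N -> D (bx a w) = 0.
Proof.
have zh : (hi k == z) = false by rewrite zk eq_sym (negPf (lo_neq_hi k)).
have zh' : (z == hi k) = false by rewrite eq_sym.
have Dhi a' w' : box a' -> ((a' (hi k)).+1 < d)%N -> D (bx a' w') = 0.
  move=> ba ah; apply/eqP; rewrite endoDE endoNE subr_eq0 !endoME; apply/eqP.
  have iz : inc (hi k) a' z = a' z by rewrite ffunE zh' addn0.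
  rewrite bxE_bx // !bx1E ?box_inc // iz; case: ifP => az.
    rewrite bxE_bx ?box_inc // ?ffunE ?zh ?addn0 //.
    congr (bx _ w'); apply/ffunP => x; rewrite !ffunE; lia.
  rewrite endo_N endo_sum; congr (- _); apply: eq_bigr => t _.
  rewrite endo_Z bxE_bx ?box_upd ?ffunE ?zh //; congr (_ *: bx _ w').
  by apply/ffunP => x; rewrite !ffunE; case: eqP => // ->; rewrite zh' addn0.
move=> ba; have [ah|ah] := boolP ((a (hi k)).+1 < d)%N; first by rewrite Dhi.
rewrite orbF => az.
pose u := bsE k (bx a w).
have -> : bx a w = bsE k u by rewrite -endoME bs2.
have D0 (v : V) : D v = 0 -> D (bsE k v) = 0.
  by move=> Dv; rewrite -endoME cross_comm_anti endoNE endoME Dv endo_0 oppr0.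
apply: D0; rewrite /u bs_bx // endo_B Dhi ?box_perme //; last first.
  by rewrite ffunE adj_hi -zk.
rewrite sub0r; apply/eqP; rewrite oppr_eq0; apply/eqP.
apply: (demazure_closed d_gt0 (Q := fun p => D (tobox p) = 0)) => //.
- by rewrite linear0 endo_0.
- by move=> p q; rewrite linearB endo_B => -> ->; rewrite subrr.
- by move=> a' ba' _ hh _; rewrite toboxE Dhi.
Qed.

(** What remains is the case of both exponents equal to d - 1. By the previous case x_2 moves past
    x_1^(d-1), and the commutator becomes f(x_1) applied to x_2 of the monomial with exponent 0 at
    x_1, which is 0. *)
Lemma cross_comm0 : x1 * x2 = x2 * x1.
Proof.
suff : D = 0 by move/eqP; rewrite subr_eq0 => /eqP.
apply: endoP; apply: (boxmod_ext (f := D) (g := (0 : E))) => a w ba.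
rewrite -[LHS]/(D (bx a w)) -[RHS]/(0 : V).
have [lt|] := boolP (((a z).+1 < d)%N || ((a (hi k)).+1 < d)%N).
  exact: cross_comm_single.
rewrite negb_or => /andP[az _].
have {az} az : a z = d.-1 by have /boxP/(_ z) := ba; lia.
pose e t := bx (upd z t a) w.
have eS t : (t < d)%N -> e t = (x1 ^+ t) (e 0) by move=> td; apply: x1_gen.
have x2e t : (t < d)%N -> x2 (e t) = (x1 ^+ t) (x2 (e 0%N)).
  elim: t => [|t IHt] td //; have td' : (t < d)%N by lia.
  have De : D (e t) = 0.
    by apply: cross_comm_single; rewrite ?box_upd // ffunE eqxx td.
  rewrite eS // exprS endoME -eS //; move/eqP: De.
  rewrite endoDE endoNE subr_eq0 !endoME => /eqP <-.
  by rewrite IHt.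
have ea : bx a w = e d.-1 by rewrite /e -az upd_id.
have dd : (d.-1 < d)%N by lia.
rewrite ea endoDE endoNE !endoME x2e // -[x1 (_ _)]endoME -exprS prednK //.
have -> : x1 (e d.-1) = - \sum_(t < d) f t *: e t.
  rewrite bx1E ?box_upd // ffunE eqxx prednK // ltnn; congr (- _).
  apply: eq_bigr => t _; congr (_ *: bx _ w).
  by apply/ffunP => x; rewrite !ffunE; case: eqP.
rewrite endo_N opprK endo_sum.
transitivity (fbx1 z (x2 (e 0%N))); last by rewrite fbx1_0.
rewrite endoDE endo_sumE; congr (_ + _); apply: eq_bigr => t _.
by rewrite endo_Z x2e.
Qed.

End FirstTwo.

Lemma bxE_bs i l : l != i :> nat -> l != i.+1 :> nat -> GRing.comm (bsE i) (bxE l).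
Proof.
apply: (gen_s_x (s := bsE) (x := bxE)).
- exact: bs2.
- exact: bs_comm.
- exact: bs_braid.
- exact: bxE_hi.
by move=> z j z0 j0; rewrite bxE0 //; apply: bx1_bs; rewrite -val_eqE /= z0 neq_ltn ?j0 ?orbT.
Qed.

Lemma bxE_comm l l' : GRing.comm (bxE l) (bxE l').
Proof.
apply: (gen_x_x (s := bsE) (x := bxE)).
- exact: bs2.
- exact: bs_comm.
- exact: bs_braid.
- exact: bxE_hi.
- by move=> z j z0 j0; rewrite bxE0 //; apply: bx1_bs; rewrite -val_eqE /= z0 neq_ltn ?j0 ?orbT.
- by move=> i i0; rewrite (bxE0 (z := lo i)) //; apply: cross_comm0.
Qed.

Lemma bE_rel0 r : affHecke_rel bsE bxE r -> r = 0.
Proof.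
have sub0 (u v : E) : u = v -> u - v = 0 by move=> ->; rewrite subrr.
case=> [i|i j ij|i j ij|j i ij ij'|i a b ai bi|i j]; apply: sub0.
- by rewrite expr2 bs2.
- by case/orP: ij => ij; [|symmetry]; apply: bs_comm.
- exact: bs_braid.
- exact: bxE_bs.
- have -> : a = lo i by apply/val_inj.
  have -> : b = hi i by apply/val_inj.
  by rewrite bxE_hi mulrDl -!mulrA bs2 mulr1 addrK.
- exact: bxE_comm.
Qed.

End CyclotomicRepresentation.

(** * The cyclotomic polynomial and consequences of the relations *)

Section CycloPoly.
Variables (K : fieldType) (lam : weight).

Definition level : nat := \sum_(i <- finsupp lam) lam i.
Definition charpoly : {poly K} :=
  \prod_(i <- finsupp lam) ('X - (i%:~R)%:P) ^+ lam i.

Lemma charpoly_monic : charpoly \is monic.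
Proof. by apply: monic_prod => i _; apply: monic_exp; apply: monicXsubC. Qed.

Lemma size_charpoly : size charpoly = level.+1.
Proof.
rewrite /charpoly /level; move: (finsupp lam : seq int) => r.
elim: r => [|i r IHr]; first by rewrite !big_nil size_poly1.
have mon_pow j e : ('X - (j%:~R)%:P : {poly K}) ^+ e \is monic.
  exact/monic_exp/monicXsubC.
rewrite !big_cons size_monicM ?mon_pow //; last first.
  by apply/monic_neq0/monic_prod => j _; apply: mon_pow.
by rewrite IHr size_exp_XsubC addnS.
Qed.

Lemma level_gt0 : lam != weight0 -> (0 < level)%N.
Proof.
move=> lam0; have [c lam_c] : exists c, c \in finsupp lam.
  apply/fset0Pn; apply: contra_neq lam0 => lam0.
  by apply/fsfunP => c; rewrite fsfun0E fsfun_dflt // lam0.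
rewrite /level (big_fsetD1 c) //= ltn_addr // lt0n.
by rewrite -memNfinsupp lam_c.
Qed.

Lemma cyclo_polyE (A : algType K) (y : A) :
  cyclo_poly lam y = horner_alg y charpoly.
Proof.
rewrite /cyclo_poly /charpoly rmorph_prod; apply: eq_bigr => i _.
by rewrite rmorphXn rmorphB /= horner_algX horner_algC /= scaler_int.
Qed.

Lemma horner_algE (A : algType K) (y : A) (p : {poly K}) :
  horner_alg y p = \sum_(t < size p) p`_t *: y ^+ t.
Proof.
rewrite -{1}[p]coefK poly_def linear_sum; apply: eq_bigr => t _.
by rewrite linearZ rmorphXn /= horner_algX mulr_algl.
Qed.

Lemma horner_alg_monic (A : algType K) (y : A) (p : {poly K}) e :
    p \is monic -> size p = e.+1 ->
  horner_alg y p = y ^+ e + \sum_(t < e) p`_t *: y ^+ t.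
Proof.
move=> pm ps; rewrite horner_algE ps big_ord_recr /= addrC; congr (_ + _).
by move: pm; rewrite monicE lead_coefE ps => /eqP ->; rewrite scale1r.
Qed.

End CycloPoly.

Section Monomials.
Variables (m : nat) (B : nzRingType) (s : 'I_m.-1 -> B) (x : 'I_m -> B).

Definition mon (l : seq 'I_m) : B := \prod_(i <- l) x i.
Definition cnt (l : seq 'I_m) : expo m := [ffun i => count_mem i l].

Lemma mon_cons i l : mon (i :: l) = x i * mon l.
Proof. exact: big_cons. Qed.

Lemma mon_cat l l' : mon (l ++ l') = mon l * mon l'.
Proof. exact: big_cat. Qed.

Lemma cnt_cons i l : cnt (i :: l) = inc i (cnt l).
Proof. by apply/ffunP => j; rewrite !ffunE /= eq_sym addnC. Qed.

End Monomials.

Section RelationConsequences.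
Variables (K : fieldType) (A : algType K) (m : nat).
Variables (s : 'I_m.-1 -> A) (x : 'I_m -> A).
Hypothesis rel0 : forall r, affHecke_rel s x r -> r = 0.

Lemma hecke_s2 i : s i * s i = 1.
Proof. by rewrite -expr2; apply: subr0_eq; apply/rel0/affHecke_rel_sqr. Qed.

Lemma hecke_s_comm (i j : 'I_m.-1) : (i.+1 < j)%N -> s i * s j = s j * s i.
Proof.
by move=> ij; apply: subr0_eq; apply/rel0/affHecke_rel_comm; rewrite ij.
Qed.

Lemma hecke_s_braid (i j : 'I_m.-1) : j = i.+1 :> nat ->
  s i * s j * s i = s j * s i * s j.
Proof. by move=> ij; apply: subr0_eq; apply/rel0/affHecke_rel_braid. Qed.

Lemma hecke_x_x i j : x i * x j = x j * x i.
Proof. by apply: subr0_eq; apply/rel0/affHecke_rel_xx. Qed.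

Lemma hecke_s_x j i : s j * x i = x (adj j i) * s j - crossing K j i *: 1.
Proof.
have lh := negPf (lo_neq_hi j).
have cr : s j * x (lo j) = x (hi j) * s j - 1.
  by apply: subr0_eq; apply: rel0; apply: affHecke_rel_cross.
rewrite /crossing; have [->|il] := eqVneq i (lo j).
  by rewrite lh subr0 scale1r adj_lo cr.
have [->|ih] := eqVneq i (hi j).
  rewrite adj_hi sub0r scaleN1r opprK.
  have := congr1 (fun z => s j * z * s j) cr.
  rewrite !mulrA hecke_s2 mul1r mulrBr mulrBl mulr1 hecke_s2 -!mulrA hecke_s2 mulr1.
  by move=> ->; rewrite subrK.
rewrite subr0 scale0r subr0 adjD //.
by apply: subr0_eq; apply/rel0/affHecke_rel_sx.
Qed.

End RelationConsequences.

(** * Linear independence of the restricted monomials *)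

Section Independence.
Variables (K : fieldType) (m : nat) (lam : weight) (lam_neq0 : lam != weight0).
Let d := level lam.
Let d_gt0 : (0 < d)%N := level_gt0 lam_neq0.
Local Notation H := (cycHecke K m lam_neq0).

Definition cyc_s (i : 'I_m.-1) : H := cyc_proj K m lam_neq0 (aff_s K i).
Definition cyc_x (i : 'I_m) : H := cyc_proj K m lam_neq0 (aff_x K i).

Let f t := (charpoly K lam)`_t.

Definition aff_rep := affHecke_lift (@bE_rel0 K m d d_gt0 f).
HB.instance Definition _ := GRing.LRMorphism.on aff_rep.

Lemma aff_rep_cyclo p : cyclo_rel m lam p -> aff_rep p = 0.
Proof.
apply: (cyclo_rel0 (f := aff_rep)) => z z0.
rewrite [X in cyclo_poly _ X](_ : _ = bxE d_gt0 f z); last exact: affHecke_lift_x.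
rewrite cyclo_polyE (horner_alg_monic _ (charpoly_monic _ _) (size_charpoly _ _)).
by rewrite bxE0 //; apply: (@fbx1_0 K m d d_gt0 f).
Qed.

Definition cyc_rep :=
  quot_lift (S_proper := cycHecke_proper (n := m) lam_neq0) aff_rep_cyclo.
HB.instance Definition _ := GRing.LRMorphism.on cyc_rep.

Lemma cyc_rep_s i : cyc_rep (cyc_s i) = bsE K d_gt0 i.
Proof. by rewrite /cyc_rep [LHS]quot_liftE; apply: affHecke_lift_s. Qed.

Lemma cyc_rep_x i : cyc_rep (cyc_x i) = bxE d_gt0 f i.
Proof. by rewrite /cyc_rep [LHS]quot_liftE; apply: affHecke_lift_x. Qed.

Definition coordbox (a : expo m) (w : 'S_m) : {linear boxmod K m d -> K^o} :=
  free_ext _ (fun b : boxexpo m d * 'S_m => ((val b.1 == a) && (b.2 == w))%:R : K^o).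

Lemma coordboxE a w a' w' : box d a' ->
  coordbox a w (bx K d a' w') = ((a' == a) && (w' == w))%:R.
Proof. by move=> ba; rewrite /bx insubT /= free_extE. Qed.

Lemma cyc_rel0 r : affHecke_rel cyc_s cyc_x r -> r = 0.
Proof.
move=> rr; have [r' /aff_rel0 -> ->] :=
  @affHecke_rel_lift K _ _ (cyc_proj K m lam_neq0) m (@aff_s K m) (@aff_x K m) r rr.
exact: raddf0.
Qed.

Local Notation G := (cox cyc_s).
Local Notation X := (mon cyc_x).
Local Notation v0 := (bx K d (bzero m) 1%g).

Lemma cyc_repM a b v : cyc_rep (a * b) v = cyc_rep a (cyc_rep b v).
Proof. by rewrite rmorphM. Qed.

Lemma cyc_rep_monomial l w : box d (cnt l) ->
  cyc_rep (X l * G w) v0 = bx K d (cnt l) w.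
Proof.
have Gv : cyc_rep (G w) v0 = bx K d (bzero m) w.
  elim/adj_ind: w => [|i w IHw]; first by rewrite cox1 rmorph1.
  rewrite (cox_adjM (hecke_s2 cyc_rel0) (hecke_s_comm cyc_rel0) (hecke_s_braid cyc_rel0)).
  by rewrite cyc_repM IHw cyc_rep_s bs0.
elim: l => [|i l IHl] bl.
  rewrite /mon big_nil mul1r Gv; suff -> : cnt [::] = bzero m by [].
  by apply/ffunP => j; rewrite !ffunE.
rewrite mon_cons -mulrA cyc_repM cyc_rep_x cnt_cons in bl *.
have al : ((cnt l i).+1 < d)%N.
  by have /boxP/(_ i) := bl; rewrite ffunE eqxx addn1.
have bl' : box d (cnt l).
  apply/boxP => j; have /boxP/(_ j) := bl; rewrite ffunE.
  by apply: leq_ltn_trans; apply: leq_addr.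
by rewrite IHl // bxE_bx.
Qed.

(** An element with exponents below d, applied to the vector of the trivial monomial, gives the
    corresponding basis vector; reading off a coordinate yields functionals dual to the restricted
    monomials. This is the form in which linear independence is used. *)
Lemma cyc_coord (a : expo m) (w : 'S_m) : exists kappa : H -> K,
  (forall c u v, kappa (c *: u + v) = c * kappa u + kappa v) /\
  (forall l w', box d (cnt l) ->
    kappa (X l * G w') = ((cnt l == a) && (w' == w))%:R).
Proof.
exists (fun z => coordbox a w (cyc_rep z v0)); split=> [c u v|l w' bl].
  have -> : cyc_rep (c *: u + v) v0 = c *: cyc_rep u v0 + cyc_rep v v0.
    by rewrite linearP.
  exact: linearP.
by rewrite cyc_rep_monomial // coordboxE.
Qed.

Lemma cyc_ind (P : set H) : subalgebra P ->
  (forall i, P (cyc_s i)) -> (forall i, P (cyc_x i)) -> forall a, P a.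
Proof.
move=> [P1 PD PM] Ps Px; elim/qprojP => p.
apply: (affHecke_ind (P := [set a | P (cyc_proj K m lam_neq0 a)])) Ps Px p.
split=> [|c u v Pu Pv|u v Pu Pv] /=; rewrite ?rmorph1 ?linearP ?rmorphM //.
  exact: PD.
exact: PM.
Qed.

Lemma cyc_x0 (z : 'I_m) : z = 0%N :> nat -> horner_alg (cyc_x z) (charpoly K lam) = 0.
Proof. by move=> z0; rewrite -cyclo_polyE; apply: cyc_proj_rel0. Qed.

End Independence.

(** * The degree filtration and leading terms of the centralizer *)

Section Subspaces.
Variables (K : fieldType) (A : lmodType K).
Implicit Types (Q : A -> Prop).

Definition subsp Q := Q 0 /\ forall c u v, Q u -> Q v -> Q (c *: u + v).

Variables (Q : A -> Prop) (sQ : subsp Q).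

Lemma subsp0 : Q 0. Proof. by case: sQ. Qed.
Lemma subspD u v : Q u -> Q v -> Q (u + v).
Proof. by move=> Qu Qv; rewrite -[u]scale1r; apply: (sQ.2). Qed.
Lemma subspZ c u : Q u -> Q (c *: u).
Proof. by move=> Qu; rewrite -[_ *: _]addr0; apply: (sQ.2) => //; apply: subsp0. Qed.
Lemma subspN u : Q u -> Q (- u).
Proof. by rewrite -scaleN1r; apply: subspZ. Qed.
Lemma subspB u v : Q u -> Q v -> Q (u - v).
Proof. by move=> Qu Qv; apply: subspD => //; apply: subspN. Qed.
Lemma subsp_sum I (r : seq I) (P : pred I) (F : I -> A) :
  (forall i, P i -> Q (F i)) -> Q (\sum_(i <- r | P i) F i).
Proof.
by move=> QF; elim/big_rec: _ => [|i u Pi Qu]; [apply: subsp0|apply: subspD => //; apply: QF].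
Qed.
Lemma subspBC u v : Q (u - v) -> Q (v - u).
Proof. by rewrite -[v - u]opprB; apply: subspN. Qed.
Lemma subsp_trans u v w : Q (u - v) -> Q (v - w) -> Q (u - w).
Proof. by move=> uv vw; rewrite -[u](subrK v) -addrA; apply: subspD. Qed.
Lemma subsp_cong u v : Q (u - v) -> Q v -> Q u.
Proof. by move=> uv Qv; rewrite -[u](subrK v); apply: subspD. Qed.

End Subspaces.

Lemma subsp_comp (K : fieldType) (A B : lmodType K) (f : A -> B) (Q : B -> Prop) :
  (forall c u v, f (c *: u + v) = c *: f u + f v) -> subsp Q ->
  subsp (fun u => Q (f u)).
Proof.
move=> fl sQ; split=> [|c u v Qu Qv]; last by rewrite fl; apply: (sQ.2).
have -> : f 0 = 0; last exact: subsp0.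
have := fl (-1) 0 0; rewrite scaler0 addr0 scaleN1r addNr; exact.
Qed.

Lemma card_setU_lt (T : finType) (S1 S2 : {set T}) a : a \in S1 -> a \in S2 ->
  (#|S1 :|: S2| < #|S1| + #|S2|)%N.
Proof.
move=> a1 a2; have a12 : (0 < #|S1 :&: S2|)%N.
  by apply/card_gt0P; exists a; rewrite inE a1.
have le := subset_leq_card (finset.subsetIl S1 S2).
by rewrite cardsU; lia.
Qed.

Section Filtration.
Variables (K : fieldType) (A : algType K) (m d : nat).
Hypothesis d_gt0 : (0 < d)%N.
Variables (s : 'I_m.-1 -> A) (x : 'I_m -> A) (pol : {poly K}).
Hypothesis rel0 : forall r, affHecke_rel s x r -> r = 0.
Hypothesis pol_monic : pol \is monic.
Hypothesis size_pol : size pol = d.+1.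
Hypothesis x0_root : forall z : 'I_m, z = 0%N :> nat -> horner_alg (x z) pol = 0.

Local Notation G := (cox s).
Local Notation X := (mon x).
Local Notation expo := (expo m).
Implicit Types (R : {set 'I_m}) (N M : nat) (l : seq 'I_m) (w : 'S_m) (i j k : 'I_m).

Let s2 := hecke_s2 rel0.
Let s_comm := hecke_s_comm rel0.
Let s_braid := hecke_s_braid rel0.
Let GM := coxM s2 s_comm s_braid.
Let GV := coxV s2 s_comm s_braid.
Let GVl := coxVl s2 s_comm s_braid.
Let G1 : G 1%g = 1 := cox1 s.
Let Gadj := cox_adj s2 s_comm s_braid.

Lemma mon_comm i l : x i * X l = X l * x i.
Proof.
elim: l => [|j l IHl]; first by rewrite /mon big_nil mulr1 mul1r.
by rewrite mon_cons -mulrA -IHl !mulrA (hecke_x_x rel0).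
Qed.

Lemma mon_perm l l' : perm_eq l l' -> X l = X l'.
Proof.
elim: l l' => [|i l IHl] l' pl.
  by move: (perm_size pl) => /esym/size0nil->.
have il' : i \in l' by rewrite -(perm_mem pl) mem_head.
case/splitPr: il' pl => p1 p2.
rewrite perm_sym -cat1s perm_catCA /= perm_cons perm_sym => /IHl e.
by rewrite mon_cons e !mon_cat mon_cons !mulrA mon_comm.
Qed.

Lemma cnt_perm l l' : cnt l = cnt l' -> perm_eq l l'.
Proof.
move=> e; apply/allP => i _ /=.
by have /ffunP/(_ i) := e; rewrite !ffunE => ->.
Qed.

Lemma mon_cnt l l' : cnt l = cnt l' -> X l = X l'.
Proof. by move/cnt_perm/mon_perm. Qed.

(* The span of the x^l w of degree < N whose x_i and w only involve indices in
   R, as the intersection of all subspaces containing them. *)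
Variant fil R N (u : A) : Prop := Fil of forall Q, subsp Q ->
  (forall l w, (size l < N)%N -> all [in R] l -> perm_on R w -> Q (X l * G w)) -> Q u.
Local Notation Fl := (fil [set: 'I_m]).

Lemma fil_subsp R N : subsp (fil R N).
Proof.
split=> [|c u v [fu] [fv]]; split=> Q sQ Qg; first exact: subsp0.
by apply: (sQ.2); [apply: fu|apply: fv].
Qed.
Hint Resolve fil_subsp : core.

Lemma fil0 R N : fil R N 0. Proof. exact: subsp0 (fil_subsp R N). Qed.
Lemma filD R N u v : fil R N u -> fil R N v -> fil R N (u + v).
Proof. exact: (subspD (fil_subsp R N)). Qed.
Lemma filB R N u v : fil R N u -> fil R N v -> fil R N (u - v).
Proof. exact: (subspB (fil_subsp R N)). Qed.
Lemma filN R N u : fil R N u -> fil R N (- u).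
Proof. exact: (subspN (fil_subsp R N)). Qed.
Lemma filZ R N c u : fil R N u -> fil R N (c *: u).
Proof. exact: (subspZ (fil_subsp R N)). Qed.
Lemma fil_sum R N I (r : seq I) (P : pred I) (F : I -> A) :
  (forall b, P b -> fil R N (F b)) -> fil R N (\sum_(b <- r | P b) F b).
Proof. exact: (subsp_sum (fil_subsp R N)). Qed.
Lemma filBC R N u v : fil R N (u - v) -> fil R N (v - u).
Proof. exact: (subspBC (fil_subsp R N)). Qed.
Lemma fil_trans R N v u u' : fil R N (u - v) -> fil R N (v - u') -> fil R N (u - u').
Proof. exact: (subsp_trans (fil_subsp R N)). Qed.
Lemma fil_cong R N v u : fil R N (u - v) -> fil R N v -> fil R N u.
Proof. exact: (subsp_cong (fil_subsp R N)). Qed.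

Lemma fil_gen R N l w : (size l < N)%N -> all [in R] l -> perm_on R w ->
  fil R N (X l * G w).
Proof. by move=> lN lR wR; split=> Q _; apply. Qed.

Lemma perm_onT w : perm_on [set: 'I_m] w.
Proof. by rewrite /perm_on; apply/fintype.subsetP => i _; rewrite inE. Qed.

Lemma all_setT l : all [in [set: 'I_m]] l.
Proof. by apply/allP => i _; rewrite /= inE. Qed.

Lemma Fl_gen N l w : (size l < N)%N -> Fl N (X l * G w).
Proof. by move=> lN; apply: fil_gen => //; [apply: all_setT|apply: perm_onT]. Qed.

Lemma Fl_ind N (Q : A -> Prop) : subsp Q ->
  (forall l w, (size l < N)%N -> Q (X l * G w)) -> forall u, Fl N u -> Q u.
Proof. by move=> sQ Qg u [h]; apply: h => // l w lN _ _; apply: Qg. Qed.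

Lemma fil_le R R' N N' u : R \subset R' -> (N <= N')%N -> fil R N u -> fil R' N' u.
Proof.
move=> RR NN [h]; apply: h => // l w lN lR wR; apply: fil_gen; first exact: leq_trans NN.
  by apply: sub_all lR => i /=; apply: (fintype.subsetP RR).
exact: fintype.subset_trans wR RR.
Qed.

Lemma Fl_le N N' u : (N <= N')%N -> Fl N u -> Fl N' u.
Proof. exact: fil_le. Qed.

Lemma fil_Fl R N u : fil R N u -> Fl N u.
Proof. by apply: fil_le. Qed.

Lemma Fl0 u : Fl 0 u -> u = 0.
Proof.
apply: (@Fl_ind _ (fun u => u = 0)) => //; split=> // c a b -> ->.
by rewrite scaler0 addr0.
Qed.

Lemma Fl_X N l : (size l < N)%N -> Fl N (X l).
Proof. by move=> lN; rewrite -[X l]mulr1 -G1; apply: Fl_gen. Qed.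

Lemma Fl_x i : Fl 2 (x i).
Proof. by have -> : x i = X [:: i]; [rewrite /mon big_seq1|apply: Fl_X]. Qed.

Lemma mon_nseq p i : X (nseq p i) = x i ^+ p.
Proof. by elim: p => [|p IHp]; rewrite ?[LHS]big_nil // mon_cons IHp exprS. Qed.

Lemma Fl_G N w : (0 < N)%N -> Fl N (G w).
Proof. by move=> N0; have := @Fl_gen N [::] w N0; rewrite /mon big_nil mul1r. Qed.

Lemma subsp_mull Q (a : A) : subsp Q -> subsp (fun u => Q (a * u)).
Proof.
by apply: subsp_comp => c u v; rewrite mulrDr scalerAr.
Qed.

Lemma subsp_mulr Q (a : A) : subsp Q -> subsp (fun u => Q (u * a)).
Proof.
by apply: subsp_comp => c u v; rewrite mulrDl scalerAl.
Qed.
Hint Resolve subsp_mull subsp_mulr : core.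

Lemma Fl_mulG N u w : Fl N u -> Fl N (u * G w).
Proof.
move: u; apply: Fl_ind => [|l w' lN]; first exact: subsp_mulr.
by rewrite -mulrA -GM; apply: Fl_gen.
Qed.

Lemma Fl_mulX N l u : Fl N u -> Fl (size l + N) (X l * u).
Proof.
move: u; apply: Fl_ind => [|l' w' lN]; first exact: subsp_mull.
by rewrite mulrA -mon_cat; apply: Fl_gen; rewrite size_cat ltn_add2l.
Qed.

Lemma Fl_mulx N i u : Fl N u -> Fl N.+1 (x i * u).
Proof. by move/(Fl_mulX [:: i]); rewrite /mon big_seq1. Qed.

Lemma s_mon (j : 'I_m.-1) l : Fl (size l) (s j * X l - X (map (adj j) l) * s j).
Proof.
elim: l => [|i l IHl]; first by rewrite /mon !big_nil mulr1 mul1r subrr; apply: fil0.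
rewrite /= !mon_cons mulrA (hecke_s_x rel0) mulrBl -scalerAl mul1r -!mulrA addrAC -mulrBr.
apply: filB; first exact: Fl_mulx.
by apply: filZ; apply: Fl_X.
Qed.

(** Straightening to leading order. The inverse comes from composing permutations from left to
    right: [adj j * w] stands for the word s_j w, and its inverse applies [w^-1] before [adj j]. *)
Lemma G_mon w l : Fl (size l) (G w * X l - X (map (w^-1)%g l) * G w).
Proof.
elim/adj_ind: w => [|j w IHw].
  rewrite G1 mul1r mulr1 invg1 (eq_map (perm1 (T := _))) map_id subrr.
  exact: fil0.
rewrite (cox_adjM s2 s_comm s_braid) -mulrA.
apply: (fil_trans (v := s j * (X (map (w^-1)%g l) * G w))).
  rewrite -mulrBr.
  have sF u : Fl (size l) u -> Fl (size l) (s j * u).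
    move: u; apply: Fl_ind => [|l' w' lN]; first exact: subsp_mull.
    apply: (fil_cong (v := X (map (adj j) l') * s j * G w')).
      rewrite mulrA -mulrBl; apply: Fl_mulG.
      exact: Fl_le (ltnW _) (s_mon j l').
    by rewrite -mulrA -Gadj -GM; apply: Fl_gen; rewrite size_map.
  exact: sF.
have -> : [seq (adj j * w)^-1%g i | i <- l] = map (adj j) (map (w^-1)%g l).
  rewrite -map_comp; apply: eq_map => i /=.
  by rewrite invMg permM /adj tpermV.
rewrite mulrA [X in _ - X]mulrA -mulrBl; apply: Fl_mulG.
by have := s_mon j [seq w^-1%g i | i <- l]; rewrite size_map.
Qed.

(** Degrees below N and below M add up to at most N + M - 2, whence the bound [(N + M).-1]; the
    three statements that follow are its forms without predecessor. *)
Lemma Fl_M N M u v : Fl N u -> Fl M v -> Fl (N + M).-1 (u * v).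
Proof.
move=> fu fv; move: u fu; apply: Fl_ind => [|l w lN]; first exact: subsp_mulr.
move: v fv; apply: Fl_ind => [|l' w' lM]; first exact: subsp_mull.
apply: (fil_cong (v := X (l ++ map (w^-1)%g l') * G (w * w')%g)); last first.
  apply: Fl_gen; rewrite size_cat size_map.
  by move: (size l) (size l') lN lM => a b; lia.
rewrite mon_cat GM !mulrA -mulrBl; apply: Fl_mulG.
rewrite -!mulrA -mulrBr; apply: (Fl_le _ (Fl_mulX l (G_mon w l'))).
by move: (size l) (size l') lN lM => a b; lia.
Qed.

Lemma Fl_Mlt N M u v : Fl N.+1 u -> Fl M v -> Fl (N + M) (u * v).
Proof. by move=> fu fv; have := Fl_M fu fv. Qed.

Lemma Fl_Mrt N M u v : Fl N u -> Fl M.+1 v -> Fl (N + M) (u * v).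
Proof. by move=> fu fv; have := Fl_M fu fv; rewrite addnS. Qed.

Lemma Fl_MS N M u v : Fl N.+1 u -> Fl M.+1 v -> Fl (N + M).+1 (u * v).
Proof. by move=> fu fv; have := Fl_M fu fv; rewrite addSn addnS. Qed.

Lemma Fl_congM N M u u' v v' : Fl N.+1 u' -> Fl M.+1 v ->
  Fl N (u - u') -> Fl M (v - v') -> Fl (N + M) (u * v - u' * v').
Proof.
move=> fu fv uu vv; have -> : u * v - u' * v' = (u - u') * v + u' * (v - v').
  by rewrite mulrBl mulrBr addrA subrK.
by apply: filD; [apply: Fl_Mrt|apply: Fl_Mlt].
Qed.

Lemma conj_monomial h l w :
  Fl (size l) (G h * (X l * G w) * G h^-1%g - X (map (h^-1)%g l) * G (h * w * h^-1)%g).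
Proof.
have := Fl_mulG (w * h^-1)%g (G_mon h l).
by rewrite mulrBl !GM !mulrA.
Qed.

(** * Divided differences and decorated transpositions *)

Definition hsum (a b : A) t := \sum_(p < t) a ^+ p * b ^+ (t.-1 - p).

Lemma hsumSl a b t : hsum a b t.+1 = b ^+ t + a * hsum a b t.
Proof.
rewrite /hsum big_ord_recl expr0 mul1r subn0 mulr_sumr; congr (_ + _).
apply: eq_bigr => p _; rewrite mulrA -exprS; congr (_ * _ ^+ _).
by rewrite /= /bump /=; have := ltn_ord p; lia.
Qed.

Lemma hsumSr a b t : hsum a b t.+1 = a ^+ t + hsum a b t * b.
Proof.
rewrite /hsum big_ord_recr /= subnn mulr1 addrC mulr_suml; congr (_ + _).
apply: eq_bigr => p _; rewrite -mulrA -exprSr; congr (_ * _ ^+ _).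
by have := ltn_ord p; lia.
Qed.

Lemma hsum_comm i j k t : GRing.comm (x i) (hsum (x j) (x k) t).
Proof.
have c := hecke_x_x rel0; apply: commr_sum => p _.
by apply: commrM; apply: commrX; apply: c.
Qed.

Lemma s_lo_exp (j : 'I_m.-1) t :
  s j * x (lo j) ^+ t = x (hi j) ^+ t * s j - hsum (x (lo j)) (x (hi j)) t.
Proof.
have lh := negPf (lo_neq_hi j).
elim: t => [|t IHt]; first by rewrite !expr0 mulr1 mul1r /hsum big_ord0 subr0.
rewrite exprS mulrA (hecke_s_x rel0) /crossing eqxx lh subr0 scale1r adj_lo.
rewrite mulrBl mul1r -mulrA IHt mulrBr mulrA -exprS -addrA -opprD.
by congr (_ - _); rewrite hsumSr addrC hsum_comm.
Qed.

Lemma s_hi_exp (j : 'I_m.-1) t :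
  s j * x (hi j) ^+ t = x (lo j) ^+ t * s j + hsum (x (lo j)) (x (hi j)) t.
Proof.
have hl : (hi j == lo j) = false by rewrite eq_sym (negPf (lo_neq_hi j)).
elim: t => [|t IHt]; first by rewrite !expr0 mulr1 mul1r /hsum big_ord0 addr0.
rewrite exprS mulrA (hecke_s_x rel0) /crossing eqxx hl sub0r scaleN1r opprK adj_hi.
rewrite mulrDl mul1r -mulrA IHt mulrDr mulrA -exprS -addrA.
by congr (_ + _); rewrite hsumSl addrC.
Qed.

Lemma s_other_exp (j : 'I_m.-1) i t : i != lo j -> i != hi j ->
  s j * x i ^+ t = x i ^+ t * s j.
Proof.
move=> il ih; apply: commrX; rewrite /GRing.comm (hecke_s_x rel0) /crossing.
by rewrite (negPf il) (negPf ih) subr0 scale0r subr0 adjD.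
Qed.

(** For commuting arguments [hsum a b t] plays the role of (a^t - b^t) / (a - b), of degree t - 1;
    hence this is the divided difference (q(a) - q(b)) / (a - b). *)
Definition hpol (q : {poly K}) a b := \sum_(t < size q) q`_t *: hsum a b t.

Lemma s_lo_horner (j : 'I_m.-1) q : s j * horner_alg (x (lo j)) q =
  horner_alg (x (hi j)) q * s j - hpol q (x (lo j)) (x (hi j)).
Proof.
rewrite !horner_algE mulr_sumr mulr_suml -sumrB; apply: eq_bigr => t _.
by rewrite -scalerAr s_lo_exp scalerBr scalerAl.
Qed.

Lemma s_hi_horner (j : 'I_m.-1) q : s j * horner_alg (x (hi j)) q =
  horner_alg (x (lo j)) q * s j + hpol q (x (lo j)) (x (hi j)).
Proof.
rewrite !horner_algE mulr_sumr mulr_suml -big_split; apply: eq_bigr => t _.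
by rewrite -scalerAr s_hi_exp scalerDr scalerAl.
Qed.

(** The divided differences in [s_lo_horner] and [s_hi_horner] have opposite signs and cancel, and
    s_j commutes with every other x_i. This is the source of the central elements of H_n^lambda. *)
Lemma sum_horner_s (j : 'I_m.-1) q :
  GRing.comm (s j) (\sum_i horner_alg (x i) q).
Proof.
rewrite (bigD1 (lo j)) //= (bigD1 (hi j)) ?[_ == lo j]eq_sym ?lo_neq_hi //= addrA.
apply: commrD.
  by rewrite /GRing.comm mulrDr mulrDl s_lo_horner s_hi_horner addrACA addNr addr0 addrC.
apply: commr_sum => i /andP[il ih]; rewrite horner_algE.
apply: commr_sum => t _; rewrite /GRing.comm -scalerAr -scalerAl; congr (_ *: _).
exact: s_other_exp.
Qed.

Lemma horner_x_comm i j q : GRing.comm (x i) (horner_alg (x j) q).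
Proof.
rewrite horner_algE; apply: commr_sum => t _.
rewrite /GRing.comm -scalerAr -scalerAl; congr (_ *: _).
by apply: commrX; apply: hecke_x_x rel0 _ _.
Qed.

Lemma hsumE i j t :
  hsum (x i) (x j) t = \sum_(p < t) X (nseq p i ++ nseq (t.-1 - p) j).
Proof. by apply: eq_bigr => p _; rewrite mon_cat !mon_nseq. Qed.

Lemma Fl_hsum i j t : Fl t (hsum (x i) (x j) t).
Proof.
rewrite hsumE; apply: fil_sum => p _; apply: Fl_X.
by rewrite size_cat !size_nseq; have := ltn_ord p; lia.
Qed.

(* A "decorated" transposition: the sum of the x_i^p x_j^q (i j) over
   p + q = d - 1. *)
Definition tau i j := hsum (x i) (x j) d * G (tperm i j).

Lemma tau_fil R i j : i \in R -> j \in R -> fil R d (tau i j).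
Proof.
move=> iR jR; rewrite /tau hsumE mulr_suml; apply: fil_sum => p _; apply: fil_gen.
- by rewrite size_cat !size_nseq; have := ltn_ord p; lia.
- by rewrite all_cat !all_nseq /= iR jR !orbT.
rewrite /perm_on; apply/fintype.subsetP => k; rewrite inE; apply: contraR => kR.
by rewrite tpermD //; apply: contraNneq kR => <-.
Qed.

Lemma Fl_tau i j : Fl d (tau i j).
Proof. by apply: fil_Fl (@tau_fil [set: _] _ _ _ _); rewrite inE. Qed.

Lemma tau_conj h i j :
  Fl d.-1 (G h * tau i j * G h^-1%g - tau ((h^-1)%g i) ((h^-1)%g j)).
Proof.
rewrite /tau !hsumE !mulr_suml mulr_sumr mulr_suml -sumrB; apply: fil_sum => p _.
set l := nseq p i ++ _; have sl : size l = d.-1.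
  by rewrite size_cat !size_nseq; have := ltn_ord p; lia.
have e : (h * tperm i j * h^-1)%g = tperm (h^-1%g i) (h^-1%g j).
  by rewrite -tpermJ conjgE invgK mulgA.
by have := conj_monomial h l (tperm i j); rewrite sl map_cat !map_nseq e.
Qed.

Lemma hpol_tau (j : 'I_m.-1) :
  Fl d.-1 (hpol pol (x (lo j)) (x (hi j)) * s j - tau (lo j) (hi j)).
Proof.
rewrite /hpol size_pol big_ord_recr /=.
have -> : pol`_d = 1.
  by move: pol_monic; rewrite monicE lead_coefE size_pol => /eqP.
rewrite scale1r mulrDl -Gadj addrK mulr_suml; apply: fil_sum => t _.
rewrite -scalerAl; apply: filZ; apply: Fl_mulG; apply: (Fl_le _ (Fl_hsum _ _ _)).
by have := ltn_ord t; lia.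
Qed.

(* The key congruence: modulo lower terms f(x_i), for f the cyclotomic polynomial,
   is a decorated Jucys-Murphy element. *)
Lemma horner_pol_tau i :
  Fl d.-1 (horner_alg (x i) pol - \sum_(k : 'I_m | (k < i)%N) tau k i).
Proof.
move: {2}(i : nat) (erefl (i : nat)) => n; elim: n i => [|n IHn] i e.
  rewrite x0_root // big_pred0 ?subrr; first exact: fil0.
  by move=> k; rewrite e ltn0.
have [j jn ij] := ord_hi e; rewrite {i e}ij.
have IH := IHn (lo j) jn.
have -> : horner_alg (x (hi j)) pol = s j * horner_alg (x (lo j)) pol * s j +
    hpol pol (x (lo j)) (x (hi j)) * s j.
  by rewrite s_lo_horner mulrBl -mulrA s2 mulr1 subrK.
(* Conjugation by s_j turns each [tau k (lo j)] into [tau k (hi j)] to leading order, and the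
   divided difference supplies the new summand [tau (lo j) (hi j)]. *)
rewrite (bigD1 (lo j)) /=; last by rewrite ltnSn.
rewrite [X in X - _]addrC opprD addrACA; apply: filD; first exact: hpol_tau.
rewrite (eq_bigl (fun k : 'I_m => (k < lo j)%N)); last first.
  by move=> k; rewrite -val_eqE /= ltnS andbC ltn_neqAle.
apply: (fil_trans (v := s j * (\sum_(k : 'I_m | (k < lo j)%N) tau k (lo j)) * s j)).
  rewrite -mulrBl -mulrBr -Gadj.
  rewrite -[d.-1]add0n; apply: Fl_mulG.
  by apply: (Fl_Mlt (N := 0)) => //; apply: Fl_G.
rewrite mulr_sumr mulr_suml -sumrB; apply: fil_sum => k kl.
have := tau_conj (adj j) k (lo j); rewrite /adj tpermV -/(adj j) Gadj adj_lo adjD //.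
  by rewrite neq_ltn kl.
by rewrite neq_ltn (ltn_trans kl) //=.
Qed.

(** f is monic of degree d while f(x_i) is congruent to a sum of elements of degree d - 1, so x_i^d
    drops in degree, for every [i] and not only for the first index. *)
Lemma x_exp_d i : Fl d (x i ^+ d).
Proof.
have e := horner_alg_monic (x i) pol_monic size_pol.
have -> : x i ^+ d = horner_alg (x i) pol - \sum_(t < d) pol`_t *: x i ^+ t.
  by rewrite e addrK.
apply: filB.
  apply: (fil_cong (v := \sum_(k : 'I_m | (k < i)%N) tau k i)).
    by apply: (Fl_le _ (horner_pol_tau i)); lia.
  by apply: fil_sum => k _; apply: Fl_tau.
apply: fil_sum => t _; apply: filZ; rewrite -mon_nseq; apply: Fl_X.
by rewrite size_nseq.
Qed.

Lemma Fl_overflow l : ~~ box d (cnt l) -> Fl (size l) (X l).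
Proof.
rewrite negb_forall => /existsP[i]; rewrite ffunE -leqNgt => di.
pose l' := filter (predC1 i) l ++ nseq (count_mem i l - d) i.
have pl : perm_eq l (nseq d i ++ l').
  apply/cnt_perm/ffunP => j; rewrite !ffunE !count_cat !count_nseq count_filter /=.
  have [e|ji] := eqVneq i j.
    have z0 : count (predI (pred1 j) (predC1 j)) l = 0%N.
      by apply/eqP; rewrite -leqn0 leqNgt -has_count; apply/hasPn => k _ /=; case: eqP.
    by rewrite e z0 !mul1n add0n subnKC //; move: di; rewrite e.
  rewrite !mul0n addn0 add0n; apply: eq_count => k /=.
  by case: (k =P j) => //= ->; rewrite eq_sym ji.
rewrite (mon_perm pl) (perm_size pl) size_cat mon_cat mon_nseq size_nseq.
by apply: Fl_Mrt; [apply: x_exp_d|apply: Fl_X].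
Qed.

(** * Coordinates and leading forms *)

Hypothesis coord : forall (e : expo) w, exists kappa : A -> K,
  (forall c u v, kappa (c *: u + v) = c * kappa u + kappa v) /\
  (forall l w', box d (cnt l) ->
    kappa (X l * G w') = ((cnt l == e) && (w' == w))%:R).

Definition deg (e : expo) := (\sum_i e i)%N.

Lemma deg_cnt l : deg (cnt l) = size l.
Proof.
rewrite /deg (eq_bigr (fun i => count_mem i l)) => [|i _]; last by rewrite ffunE.
elim: l => [|j l IHl]; first by rewrite big1.
rewrite big_split /= IHl (bigD1 j) //= eqxx big1 // => i ij.
by rewrite eq_sym (negPf ij).
Qed.

Lemma deg_inc i e : deg (inc i e) = (deg e).+1.
Proof.
rewrite /deg (eq_bigr (fun j => e j + (j == i))%N) => [|j _]; last by rewrite ffunE.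
have e1 : (\sum_j (j == i) = 1)%N.
  by rewrite (bigD1 i) //= eqxx big1 // => j /negPf->.
by rewrite big_split /= e1 addn1.
Qed.

Definition lst (e : expo) : seq 'I_m := flatten [seq nseq (e i) i | i <- enum 'I_m].

Lemma cnt_lst e : cnt (lst e) = e.
Proof.
apply/ffunP => j; rewrite ffunE count_flatten -map_comp sumnE big_map.
rewrite (eq_bigr (fun i => (i == j) * e i)%N); last by move=> i _; rewrite /= count_nseq.
rewrite big_enum /= (bigD1 j) //= eqxx mul1n big1 ?addn0 // => i ij.
by rewrite (negPf ij).
Qed.

Lemma size_lst e : size (lst e) = deg e.
Proof. by rewrite -deg_cnt cnt_lst. Qed.

Local Notation Mo e := (X (lst e)).

Lemma mon_lst l : X l = Mo (cnt l).
Proof. by apply: mon_cnt; rewrite cnt_lst. Qed.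

Section Coordinate.
Variable kappa : A -> K.
Hypothesis kappa_lin : forall c u v, kappa (c *: u + v) = c * kappa u + kappa v.

Lemma kappaD u v : kappa (u + v) = kappa u + kappa v.
Proof. by have := kappa_lin 1 u v; rewrite scale1r mul1r. Qed.
Lemma kappa0 : kappa 0 = 0.
Proof. by apply: (addrI (kappa 0)); rewrite -kappaD !addr0. Qed.
Lemma kappaZ c u : kappa (c *: u) = c * kappa u.
Proof. by have := kappa_lin c u 0; rewrite !addr0 kappa0 addr0. Qed.
Lemma kappaB u v : kappa (u - v) = kappa u - kappa v.
Proof. by rewrite kappaD -scaleN1r kappaZ mulN1r. Qed.
Lemma kappa_sum I (r : seq I) (P : pred I) (F : I -> A) :
  kappa (\sum_(b <- r | P b) F b) = \sum_(b <- r | P b) kappa (F b).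
Proof. by elim/big_rec2: _ => [|b u v _ <-]; [apply: kappa0|rewrite kappaD]. Qed.

End Coordinate.

(** A monomial outside the box is congruent to terms of lower degree, so a coordinate at [e] kills
    everything of degree below [deg e]. In degree exactly [deg e] its values are therefore known
    without the box condition. *)
Lemma coord_top (e : expo) w : box d e -> exists kappa : A -> K,
  [/\ forall c u v, kappa (c *: u + v) = c * kappa u + kappa v,
      forall N u, (N <= deg e)%N -> Fl N u -> kappa u = 0,
      forall l w', size l = deg e ->
        kappa (X l * G w') = ((cnt l == e) && (w' == w))%:R &
      forall l w', box d (cnt l) ->
        kappa (X l * G w') = ((cnt l == e) && (w' == w))%:R].
Proof.
move=> be; have [kap [kl kE]] := coord e w; exists kap.
have kF N u : (N <= deg e)%N -> Fl N u -> kap u = 0.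
  elim: N u => [|N IHN] u Ne; first by move/Fl0->; apply: kappa0.
  move: u; apply: Fl_ind => [|l w' lN].
    by split=> [|c u v ku kv]; rewrite ?(kappa0 kl) // kl ku kv mulr0 addr0.
  have [bl|nb] := boolP (box d (cnt l)).
    rewrite kE //; case: eqP => //= le; move: lN Ne.
    by rewrite -deg_cnt le; move: (deg e) => a; lia.
  apply: IHN; first exact: ltnW.
  by apply: Fl_mulG; apply: (Fl_le _ (Fl_overflow nb)).
split=> // l w' sl; have [bl|nb] := boolP (box d (cnt l)); first exact: kE.
rewrite (kF (size l)) ?sl //; last by rewrite -sl; apply/Fl_mulG/Fl_overflow.
by case: eqP => // le; move: nb; rewrite le be.
Qed.

Definition toe (b : {ffun 'I_m -> 'I_d}) : expo := [ffun i => nat_of_ord (b i)].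

Lemma box_toe b : box d (toe b).
Proof. by apply/boxP => i; rewrite ffunE. Qed.

Lemma toe_inj : injective toe.
Proof.
move=> b b' /ffunP e; apply/ffunP => i; apply/val_inj.
by have := e i; rewrite !ffunE.
Qed.

Lemma toe_surj e : box d e -> exists b, toe b = e.
Proof.
move=> /boxP be; exists [ffun i => Ordinal (be i)].
by apply/ffunP => i; rewrite !ffunE.
Qed.

Lemma sum_toe (V : nmodType) e (F : expo -> V) : box d e ->
  (forall e', e' != e -> F e' = 0) -> \sum_b F (toe b) = F e.
Proof.
case/toe_surj => b <- F0; rewrite (bigD1 b) //= big1 ?addr0 // => b' b'b.
by apply: F0; apply: contra b'b => /eqP/toe_inj->.
Qed.

Definition pure (c : expo -> K) w : A := \sum_b c (toe b) *: (Mo (toe b) * G w).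

Definition supported R N (c : expo -> K) :=
  forall e, c e != 0 -> [/\ box d e, deg e = N & forall i, e i != 0%N -> i \in R].

Lemma fil_pure R N c w : supported R N c -> perm_on R w -> fil R N.+1 (pure c w).
Proof.
move=> cR wR; apply: fil_sum => b _.
have [->|/cR[be dN eR]] := eqVneq (c (toe b)) 0; first by rewrite scale0r; apply: fil0.
apply: filZ; apply: fil_gen => //; first by rewrite size_lst dN.
apply/allP => i; rewrite -has_pred1 has_count => li; apply: eR.
by have /ffunP/(_ i) := cnt_lst (toe b); rewrite ffunE => <-; rewrite -lt0n.
Qed.

Definition represents R N (c : 'S_m -> expo -> K) u :=
  [/\ forall w, supported R N (c w), forall w, ~~ perm_on R w -> c w =1 (fun=> 0) &
      Fl N (u - \sum_w pure (c w) w)].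

Lemma fil_rep R N u : fil R N.+1 u -> exists c, represents R N c u.
Proof.
case=> h; apply: (h (fun u => exists c, represents R N c u)) => [|l w lN lR wR].
  split=> [|k u1 u2 [c [cs cp cu]] [c' [cs' cp' cv]]].
    exists (fun _ _ => 0); split=> //; first by move=> w e; rewrite eqxx.
    rewrite big1 ?subrr; first exact: fil0.
    by move=> w _; rewrite /pure big1 // => b _; rewrite scale0r.
  exists (fun w e => k * c w e + c' w e); split=> [w e|w wR e|].
  - have [c0|/cs//] := eqVneq (c w e) 0.
    by rewrite c0 mulr0 add0r => /cs'.
  - by rewrite cp // cp' // mulr0 addr0.
  have -> : \sum_w pure (fun e => k * c w e + c' w e) w =
      k *: (\sum_w pure (c w) w) + \sum_w pure (c' w) w.
    rewrite scaler_sumr -big_split; apply: eq_bigr => w _ /=.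
    rewrite /pure scaler_sumr -big_split; apply: eq_bigr => b _ /=.
    by rewrite scalerDl scalerA.
  rewrite opprD addrACA -scalerBr; apply: filD => //; exact: filZ.
have triv : Fl N (X l * G w) -> exists c, represents R N c (X l * G w).
  move=> fl; exists (fun _ _ => 0); split=> //; first by move=> w' e; rewrite eqxx.
  rewrite big1 ?subr0 // => w' _; rewrite /pure big1 // => b _; exact: scale0r.
have [sN|Ns] := ltnP (size l) N; first by apply/triv/Fl_gen.
have {lN Ns} lN : size l = N by apply/eqP; rewrite eqn_leq Ns -ltnS lN.
have [bl|nb] := boolP (box d (cnt l)); last first.
  by apply: triv; rewrite -lN; apply/Fl_mulG/Fl_overflow.
exists (fun w' e => ((w' == w) && (e == cnt l))%:R); split=> [w' e|w' w'R e|].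
- case: (w' == w) => /=; last by rewrite eqxx.
  case: (e =P cnt l) => [-> _|_]; last by rewrite eqxx.
  split; rewrite ?deg_cnt // => i; rewrite ffunE -lt0n -has_count has_pred1.
  by move=> il; apply: (allP lR i il).
- by case: eqP => // e'; move: w'R; rewrite e' wR.
rewrite (bigD1 w) //= [X in _ - (_ + X)]big1 ?addr0 => [|w' /negPf w'w]; last first.
  by rewrite /pure big1 // => b _; rewrite w'w scale0r.
rewrite /pure (sum_toe (F := fun e => (((w == w) && (e == cnt l))%:R *: (Mo e * G w))) bl).
  by rewrite !eqxx scale1r -mon_lst subrr; apply: fil0.
by move=> e /negPf->; rewrite andbF scale0r.
Qed.

Lemma kappa_pure (kap : A -> K) e w c w' : box d e ->
    (forall c u v, kap (c *: u + v) = c * kap u + kap v) ->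
    (forall l w', box d (cnt l) ->
      kap (X l * G w') = ((cnt l == e) && (w' == w))%:R) ->
  kap (pure c w') = c e * (w' == w)%:R.
Proof.
move=> be kl kE; rewrite /pure (kappa_sum kl).
rewrite (eq_bigr (fun b => c (toe b) * ((toe b == e) && (w' == w))%:R)) => [|b _]; last first.
  by rewrite (kappaZ kl) kE cnt_lst // box_toe.
rewrite (sum_toe (F := fun e' => c e' * ((e' == e) && (w' == w))%:R) be) ?eqxx //.
by move=> e' /negPf->; rewrite mulr0.
Qed.

(** Each coefficient of a leading form of [u] is recovered by a coordinate functional, so [u] drops
    in degree once all of these vanish. The properties of [kap] are passed on so that it can be
    evaluated on explicit elements. *)
Lemma Fl_coord0 N u : Fl N.+1 u ->
    (forall e w (kap : A -> K), box d e -> deg e = N ->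
      (forall c u v, kap (c *: u + v) = c * kap u + kap v) ->
      (forall N' u, (N' <= N)%N -> Fl N' u -> kap u = 0) ->
      (forall l w', size l = N -> kap (X l * G w') = ((cnt l == e) && (w' == w))%:R) ->
      (forall l w', box d (cnt l) ->
        kap (X l * G w') = ((cnt l == e) && (w' == w))%:R) ->
      kap u = 0) -> Fl N u.
Proof.
move=> fu k0; have [c [cs cp cu]] := fil_rep fu.
apply: (fil_cong cu); apply: fil_sum => w _; apply: fil_sum => b _.
have [->|ce] := eqVneq (c w (toe b)) 0; first by rewrite scale0r; apply: fil0.
have [be de _] := cs _ _ ce.
have [kap [kl kF kE kB]] := coord_top w be; rewrite de in kF kE.
move: (k0 _ _ _ be de kl kF kE kB) => ku; case/eqP: ce.
have : kap (u - \sum_w pure (c w) w) = 0 by apply: kF cu.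
rewrite (kappaB kl) ku sub0r (kappa_sum kl) (bigD1 w) //= (kappa_pure _ _ be kl kB).
rewrite eqxx mulr1 big1 ?addr0 => [/eqP|w' /negPf w'w]; first by rewrite oppr_eq0 => /eqP.
by rewrite (kappa_pure _ _ be kl kB) w'w mulr0.
Qed.

(** * Leading terms that commute with the first variables *)

Variable low : {set 'I_m}.

(* Elements of degree N, supported on R up to lower terms, commuting with x_i
   (i in low) up to lower terms. *)
Definition qcent R N u := (exists2 u0, fil R N.+1 u0 & Fl N (u - u0)) /\
  forall i, i \in low -> Fl N.+1 (x i * u - u * x i).

(* The coefficient of x^b in x_i times the polynomial with coefficients c. *)
Definition shift i (c : expo -> K) (b : expo) := if b i is p.+1 then c (upd i p b) else 0.

(* Vanishing of the leading term (x_i - x_(w^-1 i)) c w of the commutator of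
   x_i with c w. *)
Definition adm R N (c : expo -> K) w :=
  [/\ supported R N c, perm_on R w &
      forall i b, i \in low -> box d b -> shift i c b = shift ((w^-1)%g i) c b].

Lemma inc_upd i p (b : expo) : b i = p.+1 -> inc i (upd i p b) = b.
Proof.
move=> bi; apply/ffunP => j; rewrite !ffunE; case: eqP => [->|_]; last by rewrite addn0.
by rewrite addn1 bi.
Qed.

Lemma upd_inc i (b : expo) : upd i (b i) (inc i b) = b.
Proof.
by apply/ffunP => j; rewrite !ffunE; case: eqP => [->//|_]; rewrite addn0.
Qed.

Lemma box_updle i p (b : expo) : box d b -> (p <= b i)%N -> box d (upd i p b).
Proof.
move=> /boxP bb pb; apply/boxP => j; rewrite ffunE; case: eqP => // _.
exact: leq_ltn_trans pb (bb i).
Qed.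

Lemma sum_shift i c e : box d e ->
  \sum_b c (toe b) * (inc i (toe b) == e)%:R = shift i c e.
Proof.
move=> be; rewrite /shift; case ei : (e i) => [|p].
  rewrite big1 // => b _; case: eqP => [eb|_]; last by rewrite mulr0.
  by move: ei; rewrite -eb ffunE eqxx addn1.
rewrite (sum_toe (e := upd i p e) (F := fun e' => c e' * (inc i e' == e)%:R)).
- by rewrite inc_upd // eqxx mulr1.
- by apply: box_updle; rewrite // ei.
move=> e' ne; case: eqP => [ie|_]; last by rewrite mulr0.
case/eqP: ne; rewrite -ie; have <- : e' i = p; last by rewrite upd_inc.
by move: ei; rewrite -ie ffunE eqxx addn1 => -[].
Qed.

Definition pure_shift i c w := \sum_b c (toe b) *: (X (i :: lst (toe b)) * G w).

Lemma x_pure i c w : x i * pure c w = pure_shift i c w.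
Proof.
rewrite /pure mulr_sumr; apply: eq_bigr => b _.
by rewrite -scalerAr mon_cons mulrA.
Qed.

Lemma pure_x R N i c w : supported R N c ->
  Fl N.+1 (pure c w * x i - pure_shift ((w^-1)%g i) c w).
Proof.
move=> cR; rewrite /pure mulr_suml -sumrB; apply: fil_sum => b _.
rewrite -scalerAl -scalerBr.
have [->|/cR[_ dN _]] := eqVneq (c (toe b)) 0; first by rewrite scale0r; apply: fil0.
apply: filZ; have := Fl_mulX (lst (toe b)) (G_mon w [:: i]).
by rewrite size_lst dN /= /mon !big_seq1 big_cons -/(X _) mon_comm addn1 mulrBr !mulrA.
Qed.

Lemma Fl_pure_shift R N i c w : supported R N c -> Fl N.+2 (pure_shift i c w).
Proof.
move=> cR; apply: fil_sum => b _.
have [->|/cR[_ dN _]] := eqVneq (c (toe b)) 0; first by rewrite scale0r; apply: fil0.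
by apply/filZ/Fl_gen; rewrite /= size_lst dN.
Qed.

Lemma kappa_shift (kap : A -> K) R N e w0 i c w : supported R N c -> box d e ->
    (forall c u v, kap (c *: u + v) = c * kap u + kap v) ->
    (forall l w', size l = N.+1 -> kap (X l * G w') = ((cnt l == e) && (w' == w0))%:R) ->
  kap (pure_shift i c w) = shift i c e * (w == w0)%:R.
Proof.
move=> cR be kl kE; rewrite /pure_shift (kappa_sum kl) -sum_shift // mulr_suml.
apply: eq_bigr => b _; rewrite (kappaZ kl).
have [->|/cR[_ dN _]] := eqVneq (c (toe b)) 0; first by rewrite !mul0r.
by rewrite kE /= ?size_lst ?dN // cnt_cons cnt_lst -mulrA -natrM mulnb.
Qed.

Lemma shift_deg R N i c b : supported R N c -> deg b != N.+1 -> shift i c b = 0.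
Proof.
move=> cR; rewrite /shift; case bi : (b i) => [//|p] db.
apply/eqP; apply: contraNT db => /cR[_ <- _].
by rewrite -(deg_inc i) inc_upd.
Qed.

Lemma comm_pure R N i c w : supported R N c -> Fl N.+1
  (x i * pure c w - pure c w * x i - (pure_shift i c w - pure_shift ((w^-1)%g i) c w)).
Proof.
move=> cR; rewrite x_pure opprB addrC addrA subrK; apply: filBC.
exact: pure_x cR.
Qed.

Lemma qcent_pure R N c w : adm R N c w -> qcent R N (pure c w).
Proof.
move=> [cR wR rel]; split.
  by exists (pure c w); [apply: fil_pure|rewrite subrr; apply: fil0].
move=> i il; apply: (fil_cong (comm_pure i w cR)).
apply: Fl_coord0; first by apply: filB; apply: Fl_pure_shift cR.
move=> e w0 kap be de kl _ kE _; rewrite (kappaB kl) !(kappa_shift _ _ cR be kl kE).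
by rewrite rel // subrr.
Qed.

(** The leading term of the commutator with x_i is the sum over [w] of (x_i - x_(w^-1 i)) c_w w.
    Distinct permutations are independent, so its vanishing in degree N + 1 gives the relation for
    each [w] separately. *)
Lemma qcent_decomp R N u : qcent R N u -> exists c : 'S_m -> expo -> K,
  [/\ forall w, perm_on R w -> adm R N (c w) w, forall w, ~~ perm_on R w -> c w =1 (fun=> 0) &
      Fl N (u - \sum_w pure (c w) w)].
Proof.
move=> [[u0 fu0 uu0] uc]; have [c [cs cp cu]] := fil_rep fu0.
exists c; set P := \sum_w pure (c w) w in cu *.
have uP : Fl N (u - P) by apply: fil_trans uu0 cu.
split=> // w wR; split=> // i b il bb.
have [db|nd] := eqVneq (deg b) N.+1; last by rewrite !(shift_deg _ (cs w) nd).
have [kap [kl kF kE kB]] := coord_top w bb; rewrite db in kF kE.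
have fP : Fl N.+1 (\sum_w' (pure_shift i (c w') w' - pure_shift ((w'^-1)%g i) (c w') w')).
  apply: (fil_cong (v := x i * P - P * x i)).
    rewrite mulr_sumr mulr_suml -sumrB; apply: filBC; rewrite -sumrB.
    by apply: fil_sum => w' _; apply: comm_pure (cs w').
  apply: (fil_cong (v := x i * u - u * x i)); last exact: uc.
  have -> : x i * P - P * x i - (x i * u - u * x i) = (u - P) * x i - x i * (u - P).
    by rewrite mulrBl mulrBr !opprB [LHS]addrACA [RHS]addrACA; congr (_ + _); rewrite addrC.
  apply: filB; last exact: Fl_mulx.
  by rewrite -[N.+1]addn1; apply: Fl_Mrt => //; apply: Fl_x.
have := kF _ _ (leqnn _) fP; rewrite (kappa_sum kl).
rewrite (eq_bigr (fun w' => (shift i (c w') b - shift ((w'^-1)%g i) (c w') b) * (w' == w)%:R)).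
  rewrite (bigD1 w) //= eqxx mulr1 big1 ?addr0 => [|w' /negPf->]; last by rewrite mulr0.
  by move/subr0_eq.
move=> w' _; rewrite (kappaB kl) mulrBl.
by rewrite !(kappa_shift _ _ (cs w') bb kl kE).
Qed.

(* The relations (x_l - x_j) f = 0 move all of the exponent at j to l. *)
Lemma adm_move R N c w (l j : 'I_m) (k : nat) (e : expo) : adm R N c w -> l \in low ->
    j = (w^-1)%g l -> j != l -> box d e -> (e l + k < d)%N ->
  c e = if (k <= e j)%N then c (upd l (e l + k) (upd j (e j - k) e)) else 0.
Proof.
move=> [cR wR rel] ll -> {j}; set j := (w^-1)%g l => jl be.
have lj : l == j = false by rewrite eq_sym (negPf jl).
elim: k => [|k IHk] elk.
  rewrite leq0n addn0 subn0; congr c; apply/ffunP => i; rewrite !ffunE.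
  by case: eqP => [->//|_]; case: eqP => [->|].
rewrite IHk; last by lia.
set e1 := upd l _ _; have be1 : box d e1.
  apply/boxP => i; rewrite !ffunE; case: eqP => _; first by lia.
  by have /boxP be' := be; case: eqP => // _; have := be' j; lia.
have e1l : e1 l = (e l + k)%N by rewrite ffunE eqxx.
have bb : box d (inc l e1) by apply: box_inc => //; rewrite e1l -addnS.
have := rel _ _ ll bb; rewrite -/j /shift ffunE eqxx addn1 upd_inc => ->.
rewrite ffunE (negPf jl) addn0 ffunE (negPf jl) ffunE eqxx.
case: (ltngtP k (e j)) => [lt|gt|eq].
- have -> : (e j - k = (e j - k.+1).+1)%N by lia.
  congr c; apply/ffunP => i; rewrite !ffunE.
  have [->|il] := eqVneq i l; first by rewrite lj addn1 addnS.
  by rewrite addn0; case: eqP.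
- by [].
- by rewrite eq subnn.
Qed.

(** * Splitting off one index *)

Definition pure_cat (c : expo -> K) L w :=
  \sum_b c (toe b) *: (X (lst (toe b) ++ L) * G w).

Lemma pure_mulmon R N c w L v : supported R N c ->
  Fl (N + size L)
    (pure c w * (X L * G v) - pure_cat c (map (w^-1)%g L) (w * v)%g).
Proof.
move=> cR; rewrite /pure mulr_suml -sumrB; apply: fil_sum => b _.
rewrite -scalerAl -scalerBr.
have [->|/cR[_ dN _]] := eqVneq (c (toe b)) 0; first by rewrite scale0r; apply: fil0.
apply: filZ; have := Fl_mulG v (Fl_mulX (lst (toe b)) (G_mon w L)).
by rewrite size_lst dN mon_cat GM mulrBr mulrBl !mulrA.
Qed.

(** Neither [cf p] nor [L p] involves [l], so x_l has exponent exactly [p] in the p-th summand. At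
    the exponent [e] only [p = e l] contributes, and comparing coordinates leaves one identity of
    coefficients. *)
Lemma peel_collapse R N c w (l : 'I_m) (cf : nat -> expo -> K) (L : nat -> seq 'I_m) :
    supported R N c ->
    (forall p e, (p < d)%N -> cf p e != 0 ->
      e l = 0%N /\ (deg e + (p + size (L p)) = N)%N) ->
    (forall p, count_mem l (L p) = 0%N) ->
    (forall e, box d e -> deg e = N ->
      \sum_b cf (e l) (toe b) * (cnt (lst (toe b) ++ nseq (e l) l ++ L (e l)) == e)%:R = c e) ->
  Fl N (pure c w - \sum_(p < d) pure_cat (cf p) (nseq p l ++ L p) w).
Proof.
move=> cR cfR Ll cE.
have szc p b : (p < d)%N -> cf p (toe b) != 0 ->
    size (lst (toe b) ++ nseq p l ++ L p) = N.
  by move=> pd /cfR[] // _ <-; rewrite !size_cat size_nseq size_lst.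
apply: Fl_coord0.
  apply: filB; first by apply: fil_sum => b _;
    have [->|/cR[_ dN _]] := eqVneq (c (toe b)) 0;
    [rewrite scale0r; apply: fil0|apply/filZ/Fl_gen; rewrite size_lst dN].
  apply: fil_sum => p _; apply: fil_sum => b _.
  have [->|cb] := eqVneq (cf p (toe b)) 0; first by rewrite scale0r; apply: fil0.
  by apply/filZ/Fl_gen; rewrite szc.
move=> e w0 kap be de kl _ kE kB.
rewrite (kappaB kl) (kappa_pure _ _ be kl kB) (kappa_sum kl).
have kp (p : 'I_d) : kap (pure_cat (cf p) (nseq p l ++ L p) w) =
    (\sum_b cf p (toe b) * (cnt (lst (toe b) ++ nseq p l ++ L p) == e)%:R) * (w == w0)%:R.
  rewrite (kappa_sum kl) mulr_suml; apply: eq_bigr => b _; rewrite (kappaZ kl).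
  have [->|cb] := eqVneq (cf p (toe b)) 0; first by rewrite !mul0r.
  by rewrite kE ?szc // -mulrA -natrM mulnb.
rewrite (eq_bigr _ (fun p _ => kp p)) -mulr_suml.
have eld : (e l < d)%N by have /boxP := be.
rewrite (bigD1 (Ordinal eld)) //= cE // big1 ?addr0 ?subrr // => p pe.
rewrite big1 // => b _; have [->|cb] := eqVneq (cf p (toe b)) 0; first by rewrite mul0r.
case: eqP => [ee|_]; last by rewrite mulr0.
case/eqP: pe; apply/val_inj => /=; have /ffunP/(_ l) := ee.
rewrite ffunE !count_cat count_nseq /= eqxx mul1n Ll addn0.
have [el _] := cfR _ _ (ltn_ord p) cb.
by have /ffunP/(_ l) := cnt_lst (toe b); rewrite ffunE el => ->.
Qed.

Lemma supported_upd R N c (l : 'I_m) p : supported R N c -> l \in R ->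
  supported (R :\ l) (N - p) (fun e => if e l == 0%N then c (upd l p e) else 0).
Proof.
move=> cR lR e; case: (e l =P 0%N) => [el|]; last by rewrite eqxx.
move=> /cR[be de eR]; split.
- apply/boxP => i; have /boxP/(_ i) := be; rewrite ffunE.
  by case: eqP => [->|//]; rewrite el d_gt0.
- rewrite -de /deg (bigD1 l) //= [in RHS](bigD1 l) //= ffunE eqxx el add0n addKn.
  by apply: eq_bigr => i /negPf il; rewrite ffunE il.
move=> i ei; rewrite in_setD1; have [il|il] := eqVneq i l; first by rewrite il el in ei.
by apply: eR; rewrite ffunE (negPf il).
Qed.

Lemma deg_upd (l : 'I_m) p (e : expo) : e l = 0%N -> deg (upd l p e) = (deg e + p)%N.
Proof.
move=> el; rewrite /deg (bigD1 l) //= [in RHS](bigD1 l) //= ffunE eqxx el add0n addnC.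
by congr (_ + _)%N; apply: eq_bigr => i /negPf il; rewrite ffunE il.
Qed.

Lemma shift_upd i (l : 'I_m) p (c : expo -> K) (b : expo) : i != l ->
  shift i (fun e => if e l == 0%N then c (upd l p e) else 0) b =
  if b l == 0%N then shift i c (upd l p b) else 0.
Proof.
move=> /negPf il; have li : (l == i) = false by rewrite eq_sym.
rewrite /shift; case: (b l =P 0%N) => bl.
  rewrite [upd l p b i]ffunE il; case bi : (b i) => [//|q].
  rewrite [upd i q b l]ffunE li bl eqxx.
  congr c; apply/ffunP => k; rewrite !ffunE; case: (k =P l) => [->|//].
  by rewrite li.
by case bi : (b i) => [//|q]; rewrite ffunE li; case: eqP.
Qed.

Lemma perm_on_peel R w (l : 'I_m) : perm_on R w -> l \in R ->
  perm_on (R :\ l) (w * tperm l (w l))%g.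
Proof.
move=> wR lR; rewrite /perm_on; apply/fintype.subsetP => k; rewrite inE permM in_setD1.
have wlR : w l \in R by rewrite perm_closed.
apply: contraR; rewrite negb_and negbK; case: eqP => [->|/eqP kl] /=.
  by rewrite tpermR.
move=> kR; rewrite (out_perm wR kR) tpermD //; first by rewrite eq_sym.
by apply: contraNneq kR => <-.
Qed.

(* Splitting off a moved point l: f w = (f' w') tau_(l, w l). *)
Lemma peel_tau R N c w (l : 'I_m) : adm R N c w -> l \in low -> l \in R -> w l != l ->
    (d.-1 <= N)%N ->
  exists2 c', adm (R :\ l) (N - d.-1) c' (w * tperm l (w l))%g &
    Fl N (pure c w - pure c' (w * tperm l (w l))%g * tau l (w l)).
Proof.
move=> ad ll lR wl dN; have [cR wR rel] := ad.
(* By [adm_move] exponent can be moved from [j] to [l] until [l] carries d - 1, so [c] is determined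
   by its coefficients with the full exponent at [l]; [c'] keeps exactly those. *)
pose c' (e : expo) := if e l == 0%N then c (upd l d.-1 e) else 0.
set w' := (w * tperm l (w l))%g; pose j := (w^-1)%g l.
have jl : j != l by apply: contra wl => /eqP {1}<-; rewrite permKV.
have lj : (l == j) = false by rewrite eq_sym (negPf jl).
have w'l : (w'^-1)%g l = l by apply: (canLR (permK w')); rewrite permM tpermR.
have w'j : (w'^-1)%g (w l) = j.
  by apply: (canLR (permK w')); rewrite permM permKV tpermL.
have c'R : supported (R :\ l) (N - d.-1) c' by apply: supported_upd.
exists c'.
  split=> //; first exact: perm_on_peel.
  move=> i b il bb.
  have [->|ne] := eqVneq i l; first by rewrite w'l.
  have ne' : (w'^-1)%g i != l.
    by apply: contra ne => /eqP e; rewrite -[i](permKV w') e permM tpermR.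
  rewrite !shift_upd //; case: eqP => // bl.
  have bb' : box d (upd l d.-1 b).
    apply/boxP => k; rewrite ffunE; case: eqP => _; first by rewrite ltn_predL.
    by have /boxP := bb.
  (* Only [i = w l] changes its preimage, from [l] to [j]; there the relations of [c] at [w l] and
     at [l] are chained. *)
  rewrite rel //; have [e|ni] := eqVneq i (w l); last first.
    congr (shift _ c _); rewrite invMg permM tpermV tpermD // eq_sym //.
  by rewrite e permK w'j rel.
have eqL p : map (w'^-1)%g (nseq p l ++ nseq (d.-1 - p) (w l)) = nseq p l ++ nseq (d.-1 - p) j.
  by rewrite map_cat !map_nseq w'l w'j.
apply: (fil_trans (v := \sum_(p < d) pure_cat c' (nseq p l ++ nseq (d.-1 - p) j) w)).
  apply: (@peel_collapse R N c w l (fun=> c') (fun p => nseq (d.-1 - p) j)) => //.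
  - move=> p e pd ce; have [_ de eR] := c'R _ ce; split.
      by apply/eqP; apply: contraT => /eR; rewrite in_setD1 eqxx.
    by rewrite size_nseq de; lia.
  - by move=> p; rewrite count_nseq /= (negPf jl).
  move=> e be de; pose k := (d.-1 - e l)%N.
  have eld : (e l < d)%N by have /boxP := be.
  have cntE b : cnt (lst (toe b) ++ nseq (e l) l ++ nseq k j) =
      [ffun i => toe b i + ((l == i) * e l + (j == i) * k)]%N.
    apply/ffunP => i; rewrite !ffunE !count_cat !count_nseq.
    by have /ffunP/(_ i) := cnt_lst (toe b); rewrite !ffunE => ->.
  have elk : (e l + k = d.-1)%N by rewrite /k subnKC // -ltnS prednK.
  rewrite (adm_move ad ll (erefl j) jl be (k := k)); last by rewrite elk ltn_predL.
  have [kj|jk] := leqP k (e j); last first.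
    rewrite big1 // => b _; rewrite cntE; case: eqP => [ee|_]; last by rewrite mulr0.
    move: jk; rewrite -[in X in (X < _)%N]ee ffunE eqxx mul1n lj mul0n add0n.
    by move: (toe b j) => q; lia.
  pose e' := upd l 0 (upd j (e j - k) e).
  have be' : box d e'.
    apply/boxP => i; rewrite !ffunE; case: eqP => // _; have /boxP be' := be.
    by case: eqP => // _; apply: leq_ltn_trans (leq_subr _ _) (be' j).
  rewrite (eq_bigr (fun b => c' (toe b) *
    ([ffun i => toe b i + ((l == i) * e l + (j == i) * k)]%N == e)%:R)); last first.
    by move=> b _; rewrite cntE.
  rewrite (sum_toe (e := e')
    (F := fun a => c' a * ([ffun i => a i + ((l == i) * e l + (j == i) * k)]%N == e)%:R)) //.
    rewrite (_ : [ffun i => _] = e) ?eqxx ?mulr1.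
      rewrite /c' {1}ffunE eqxx /=; congr c; apply/ffunP => i; rewrite !ffunE.
      by case: eqP => // _; rewrite elk.
    apply/ffunP => i; rewrite !ffunE ![_ == i]eq_sym.
    have [->|il] := eqVneq i l; first by rewrite lj mul1n mul0n addn0.
    by have [->|ij] := eqVneq i j; [rewrite mul0n mul1n add0n subnK|rewrite !mul0n !addn0].
  move=> a ae; rewrite /c'; case: eqP => al; last by rewrite mul0r.
  case: eqP => [ee|_]; last by rewrite mulr0.
  case/eqP: ae; apply/ffunP => i; rewrite !ffunE -ee !ffunE ![_ == i]eq_sym.
  have [->//|il] := eqVneq i l.
  have [->|ij] := eqVneq i j; last by rewrite !mul0n !addn0.
  by rewrite lj eqxx mul0n mul1n add0n addnK.
rewrite /tau hsumE [X in pure c' w' * X]mulr_suml mulr_sumr -sumrB; apply: fil_sum => p _.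
apply: filBC; have := pure_mulmon w' (nseq p l ++ nseq (d.-1 - p) (w l)) (tperm l (w l)) c'R.
rewrite eqL -mulgA tperm2 mulg1 => h; apply: (Fl_le _ h).
by rewrite size_cat !size_nseq; have := ltn_ord p; lia.
Qed.

(** By [adm_move] a nonzero coefficient has exponents at [l] and at its preimage adding up to at
    least d - 1, so moving a point of [low] forces the degree to be at least d - 1. *)
Lemma pure_small R N c w (l : 'I_m) : adm R N c w -> l \in low -> w l != l ->
  (N < d.-1)%N -> pure c w = 0.
Proof.
move=> ad ll wl Nd; have [cR _ _] := ad; rewrite /pure big1 // => b _.
have [->|ce] := eqVneq (c (toe b)) 0; first by rewrite scale0r.
have [be de _] := cR _ ce; set e := toe b in ce be de *.
have jl : (w^-1)%g l != l by apply: contra wl => /eqP {1}<-; rewrite permKV.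
have eld : (e l < d)%N by have /boxP := be.
have elk : (e l + (d.-1 - e l) = d.-1)%N by rewrite subnKC // -ltnS prednK.
have := adm_move (k := (d.-1 - e l)%N) ad ll erefl jl be; rewrite elk ltn_predL => /(_ d_gt0).
case: leqP => [le|_ c0]; last by rewrite c0 eqxx in ce.
have : (e l + e ((w^-1)%g l) <= N)%N.
  rewrite -de /deg (bigD1 l) //= leq_add2l (bigD1 ((w^-1)%g l)) //=.
  exact: leq_addr.
by move: (e _) (e _) le Nd elk => p q; lia.
Qed.

(** At a fixed point the relation at [l] is void, and [c] splits by the exponent of x_l. Exponents
    above [N] contribute nothing; they are excluded because [N - p] is a truncated subtraction. *)
Lemma peel_fix R N c w (l : 'I_m) : adm R N c w -> l \in R -> w l = l ->
  exists2 cf : nat -> expo -> K,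
    forall p, (p <= N)%N -> adm (R :\ l) (N - p) (cf p) w &
    Fl N (pure c w - \sum_(p < d | (p <= N)%N) pure (cf p) w * x l ^+ p).
Proof.
move=> ad lR wl; have [cR wR rel] := ad.
have wVl : (w^-1)%g l = l by apply: (canLR (permK w)).
pose cf p (e : expo) := if e l == 0%N then c (upd l p e) else 0.
have cfR p : supported (R :\ l) (N - p) (cf p) by apply: supported_upd.
have cfN p e : cf p e != 0 -> e l = 0%N /\ (deg e + p)%N = N.
  rewrite /cf; case: (e l =P 0%N) => [el|]; last by rewrite eqxx.
  by move=> /cR[_ <- _]; rewrite deg_upd.
exists cf => [p pN|].
  split=> //.
    rewrite /perm_on; apply/fintype.subsetP => k; rewrite inE in_setD1 => wk.
    rewrite (fintype.subsetP wR k) ?inE // andbT.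
    by apply: contra wk => /eqP->; rewrite wl.
  move=> i b il bb; have [->|ne] := eqVneq i l; first by rewrite wVl.
  have ne' : (w^-1)%g i != l by apply: contra ne => /eqP e; rewrite -[i](permKV w) e wl.
  rewrite !shift_upd //; case: eqP => // bl.
  have [pd|dp] := ltnP p d.
    rewrite rel //; apply/boxP => k; rewrite ffunE; case: eqP => // _.
    by have /boxP := bb.
  have c0 (k : 'I_m) : k != l -> shift k c (upd l p b) = 0.
    move=> kl; rewrite /shift; case: (upd l p b k) => // q.
    apply/eqP; apply: contraLR dp => /cR[/boxP/(_ l) + _ _].
    by rewrite !ffunE eq_sym (negPf kl) eqxx -ltnNge.
  by rewrite !c0.
apply: (fil_trans (v := \sum_(p < d) pure_cat (cf p) (nseq p l ++ [::]) w)).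
  apply: (@peel_collapse R N c w l cf (fun=> [::])) => //.
    by move=> p e pd /cfN[]; rewrite addn0.
  move=> e be de; pose e' := upd l 0 e.
  have be' : box d e' by apply: box_updle.
  rewrite (sum_toe (e := e')
    (F := fun a => cf (e l) a * (cnt (lst a ++ nseq (e l) l ++ [::]) == e)%:R)) //.
    have -> : cnt (lst e' ++ nseq (e l) l ++ [::]) = e.
      apply/ffunP => i; rewrite ffunE !count_cat count_nseq.
      have /ffunP/(_ i) := cnt_lst e'; rewrite !ffunE => ->.
      by rewrite /= eq_sym; case: eqP => [->|_]; rewrite ?mul1n ?mul0n ?add0n ?addn0.
    rewrite eqxx mulr1 /cf ffunE eqxx /=; congr c; apply/ffunP => i.
    by rewrite !ffunE; case: eqP => [->|].
  move=> a ae; case: eqP => [ee|_]; last by rewrite mulr0.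
  have [->|/cfN[al _]] := eqVneq (cf (e l) a) 0; first by rewrite mul0r.
  case/eqP: ae; apply/ffunP => i; rewrite ffunE.
  have [->//|il] := eqVneq i l.
  have /ffunP/(_ i) := ee; rewrite ffunE !count_cat count_nseq /= eq_sym (negPf il).
  have /ffunP/(_ i) := cnt_lst a; rewrite ffunE => ->.
  by rewrite mul0n !addn0.
rewrite (bigID (fun p : 'I_d => (p <= N)%N)) /= [X in _ + X - _]big1 ?addr0 => [|p pN]; last first.
  rewrite /pure_cat big1 // => b _; have [->|/cfN[_ e]] := eqVneq (cf p (toe b)) 0.
    by rewrite scale0r.
  by move: pN; rewrite -e leq_addl.
rewrite -sumrB; apply: fil_sum => p pN; apply: filBC.
have := pure_mulmon w (nseq p l) 1%g (cfR p).
rewrite map_nseq wVl mulg1 G1 mulr1 size_nseq subnK // mon_nseq.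
by rewrite cats0.
Qed.

Lemma fil_M R N M u v : fil R N.+1 u -> fil R M.+1 v ->
  exists2 u0, fil R (N + M).+1 u0 & Fl (N + M) (u * v - u0).
Proof.
pose P M' t := exists2 u0, fil R M'.+1 u0 & Fl M' (t - u0).
have sP M' : subsp (P M').
  split=> [|c a b [a0 fa aa] [b0 fb bb]]; first by exists 0; rewrite ?subrr; apply: fil0.
  exists (c *: a0 + b0); first by apply: filD => //; apply: filZ.
  by rewrite opprD addrACA -scalerBr; apply: filD => //; apply: filZ.
case=> hu; apply: (hu (fun u => fil R M.+1 v -> P (N + M)%N (u * v))).
  split=> [_|c a b ha hb fv]; first by rewrite mul0r; apply: subsp0.
  by rewrite mulrDl -scalerAl; apply: ((sP _).2); [apply: ha|apply: hb].
move=> l w lN lR wR [hv]; apply: (hv (fun v => P (N + M)%N (X l * G w * v))).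
  exact: subsp_mull.
move=> l' w' lM lR' wR'; exists (X (l ++ map (w^-1)%g l') * G (w * w')%g).
  apply: fil_gen; first by rewrite size_cat size_map ltnS leq_add.
    rewrite all_cat lR all_map; apply/allP => i il /=.
    by rewrite perm_closed ?perm_onV //; apply: (allP lR').
  exact: perm_onM.
rewrite mon_cat GM !mulrA -mulrBl; apply: Fl_mulG.
rewrite -!mulrA -mulrBr; apply: (Fl_le _ (Fl_mulX l (G_mon w l'))).
by rewrite leq_add.
Qed.

Lemma qcent_Fl R N u : qcent R N u -> Fl N.+1 u.
Proof.
move=> [[u0 fu uu] _]; apply: (fil_cong (v := u0)); last exact: fil_Fl fu.
exact: Fl_le uu.
Qed.

Lemma qcent_M R N M u v : qcent R N u -> qcent R M v -> qcent R (N + M) (u * v).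
Proof.
move=> qu qv; have fu := qcent_Fl qu; have fv := qcent_Fl qv.
have [[u0 fu0 uu] uc] := qu; have [[v0 fv0 vv] vc] := qv; split.
  have [t ft tt] := fil_M fu0 fv0; exists t => //.
  by apply: fil_trans tt; apply: Fl_congM => //; apply: fil_Fl fu0.
move=> i il; have -> : x i * (u * v) - u * v * x i =
    (x i * u - u * x i) * v + u * (x i * v - v * x i).
  by rewrite mulrBl mulrBr !mulrA addrA subrK.
apply: filD; first by rewrite -addSn; apply: Fl_Mrt => //; apply: uc.
by rewrite -addnS; apply: Fl_Mlt => //; apply: vc.
Qed.

Lemma qcent_le R R' N u : R \subset R' -> qcent R N u -> qcent R' N u.
Proof.
move=> RR [[u0 fu uu] uc]; split=> //; exists u0 => //.
exact: fil_le fu.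
Qed.

Lemma qcent_x R i : i \in R -> qcent R 1 (x i).
Proof.
move=> iR; split.
  exists (x i); last by rewrite subrr; apply: fil0.
  have := @fil_gen R 2 [:: i] 1%g; rewrite /mon big_seq1 G1 mulr1; apply => //=.
    by rewrite iR.
  exact: perm_on1.
by move=> j _; rewrite (hecke_x_x rel0) subrr; apply: fil0.
Qed.

Lemma qcent_1 R : qcent R 0 1.
Proof.
split.
  exists 1; last by rewrite subrr; apply: fil0.
  have := @fil_gen R 1 [::] 1%g; rewrite /mon big_nil G1 mulr1; apply => //.
  exact: perm_on1.
by move=> j _; rewrite mulr1 mul1r subrr; apply: fil0.
Qed.

Lemma qcent_xn R i b : i \in R -> qcent R b (x i ^+ b).
Proof.
move=> iR; elim: b => [|b IHb]; first exact: qcent_1.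
by rewrite exprS -add1n; apply: qcent_M => //; apply: qcent_x.
Qed.

Lemma hsum_sub i j : (x i - x j) * hsum (x i) (x j) d = x i ^+ d - x j ^+ d.
Proof.
have hl := hsumSl (x i) (x j) d; have hr := hsumSr (x i) (x j) d.
have e : x j ^+ d + x i * hsum (x i) (x j) d = x i ^+ d + hsum (x i) (x j) d * x j.
  by rewrite -hl hr.
apply/eqP; rewrite mulrBl (hsum_comm j i j) subr_eq addrAC eq_sym subr_eq -e.
by rewrite addrC.
Qed.

(** The commutator with x_k has leading term (x_k - x_k') times the polynomial part and (i j), where
    k' is the image of k. The polynomial is 0 or, up to sign, telescopes to x_i^d - x_j^d, which
    drops in degree by [x_exp_d]. *)
Lemma qcent_tau R i j : i \in R -> j \in R -> qcent R d.-1 (tau i j).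
Proof.
move=> iR jR; split.
  exists (tau i j); last by rewrite subrr; apply: fil0.
  by rewrite prednK //; apply: tau_fil.
move=> k _; rewrite prednK // /tau.
apply: (fil_cong (v := (x k - x (tperm i j k)) * hsum (x i) (x j) d * G (tperm i j))).
  have := G_mon (tperm i j) [:: k]; rewrite /= /mon !big_seq1 tpermV => h.
  have -> : x k * (hsum (x i) (x j) d * G (tperm i j)) - hsum (x i) (x j) d * G (tperm i j) * x k -
      (x k - x (tperm i j k)) * hsum (x i) (x j) d * G (tperm i j) =
      - (hsum (x i) (x j) d * (G (tperm i j) * x k - x (tperm i j k) * G (tperm i j))).
    rewrite !mulrBl mulrBr opprB !mulrA.
    by rewrite [x (tperm i j k) * _]hsum_comm addrC addrA subrK opprB.
  by apply: filN; rewrite -[d in fil _ d]addn0; apply: Fl_Mrt => //; apply: Fl_hsum.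
apply: Fl_mulG; case: tpermP => [->|->|_ _]; last by rewrite subrr mul0r; apply: fil0.
  by rewrite hsum_sub; apply: filB; apply: x_exp_d.
by rewrite -[x j - _]opprB mulNr hsum_sub; apply: filN; apply: filB; apply: x_exp_d.
Qed.

(** * Conjugation of words of decorated transpositions *)

Definition cj h u := G h * u * G h^-1%g.

Lemma cjM h u v : cj h (u * v) = cj h u * cj h v.
Proof. by rewrite /cj !mulrA -[_ * G h]mulrA GVl mulr1. Qed.

Lemma cjB h u v : cj h (u - v) = cj h u - cj h v.
Proof. by rewrite /cj mulrBr mulrBl. Qed.

Lemma Fl_cj h N u : Fl N u -> Fl N (cj h u).
Proof.
move=> fu; apply: Fl_mulG; rewrite -[N]add0n.
by apply: Fl_Mlt => //; apply: Fl_G.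
Qed.

Lemma cj_fix R h N u : perm_on (~: R) h -> qcent R N u -> Fl N (cj h u - u).
Proof.
move=> hR [[u0 fu uu] _].
have hV : perm_on (~: R) h^-1%g by rewrite perm_onV.
have fixR g k : perm_on (~: R) g -> k \in R -> g k = k.
  by move=> gR kR; apply: (out_perm gR); rewrite inE kR.
apply: (fil_trans (v := cj h u0)); first by rewrite -cjB; apply: Fl_cj.
apply: (fil_trans (v := u0)); last exact: filBC.
case: fu => hu; apply: (hu (fun u0 => Fl N (cj h u0 - u0))) => [|l w lN lR wR].
  split=> [|c a b ha hb]; first by rewrite /cj mulr0 mul0r subrr; apply: fil0.
  have -> : cj h (c *: a + b) = c *: cj h a + cj h b.
    by rewrite /cj mulrDr mulrDl -scalerAr -scalerAl.
  by rewrite opprD addrACA -scalerBr; apply: filD => //; apply: filZ.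
have := conj_monomial h l w; have -> : map (h^-1)%g l = l.
  rewrite -[RHS]map_id; apply/eq_in_map => k kl; apply: fixR => //.
  exact: (allP lR).
have -> : (h * w * h^-1)%g = w; last by apply: Fl_le.
apply/permP => k; rewrite !permM; have [kR|kR] := boolP (k \in R).
  by rewrite (fixR h) // fixR // perm_closed.
have hk : h k \notin R by have := perm_closed k hR; rewrite !inE => /negb_inj->.
by rewrite (out_perm wR hk) permK (out_perm wR kR).
Qed.

Lemma cj_xn h i b : Fl b (cj h (x i ^+ b) - x ((h^-1)%g i) ^+ b).
Proof.
have := conj_monomial h (nseq b i) 1%g.
by rewrite map_nseq !mon_nseq size_nseq mulg1 mulgV G1 !mulr1.
Qed.

Lemma Fl_xn i b : Fl b.+1 (x i ^+ b).
Proof. by rewrite -mon_nseq; apply: Fl_X; rewrite size_nseq. Qed.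

Definition tword i (f : seq 'I_m) := \prod_(k <- f) tau k i.

Lemma tword_cons i k f : tword i (k :: f) = tau k i * tword i f.
Proof. exact: big_cons. Qed.

Lemma qcent_tword R i f : i \in R -> all [in R] f -> qcent R (size f * d.-1) (tword i f).
Proof.
move=> iR; elim: f => [|k f IHf] /=.
  by move=> _; rewrite mul0n /tword big_nil; apply: qcent_1.
case/andP => kR fR; rewrite tword_cons mulSn; apply: qcent_M; last exact: IHf.
exact: qcent_tau.
Qed.

Lemma Fl_tword i f : Fl (size f * d.-1).+1 (tword i f).
Proof.
apply: (@qcent_Fl [set: 'I_m]); apply: qcent_tword; first by rewrite inE.
exact: all_setT.
Qed.

Lemma cj_tword h i f :
  Fl (size f * d.-1) (cj h (tword i f) - tword ((h^-1)%g i) (map (h^-1)%g f)).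
Proof.
elim: f => [|k f IHf].
  by rewrite /tword !big_nil /cj mulr1 GV subrr; apply: fil0.
rewrite /= !tword_cons cjM mulSn; apply: Fl_congM => //.
- by rewrite prednK //; apply: Fl_tau.
- exact/Fl_cj/Fl_tword.
exact: tau_conj.
Qed.

Definition word u b i f := u * x i ^+ b * tword i f.

Lemma qcent_word R N u b i f : i \in R -> all [in R] f -> qcent R N u ->
  qcent R (N + b + size f * d.-1) (word u b i f).
Proof.
move=> iR fR qu; apply: qcent_M; last exact: qcent_tword.
by apply: qcent_M => //; apply: qcent_xn.
Qed.

Lemma cj_word R h N u b i f : perm_on (~: R) h -> qcent R N u ->
  Fl (N + b + size f * d.-1)
    (cj h (word u b i f) - word u b ((h^-1)%g i) (map (h^-1)%g f)).
Proof.
move=> hR qu; rewrite /word !cjM; have fu := qcent_Fl qu.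
have fx i' : Fl (N + b).+1 (u * x i' ^+ b) by apply: Fl_MS => //; apply: Fl_xn.
apply: Fl_congM => //.
- exact/Fl_cj/Fl_tword.
- apply: Fl_congM => //; last exact: cj_xn.
    exact/Fl_cj/Fl_xn.
  exact: cj_fix hR qu.
exact: cj_tword.
Qed.

(** Together with [cj_word], this makes all words with the same [u], the same length and distinct
    indices outside [R] conjugate to leading order. *)
Lemma perm_ext_list R (t t' : seq 'I_m) : uniq t -> uniq t' -> size t = size t' ->
    all [in ~: R] t -> all [in ~: R] t' ->
  exists2 h : 'S_m, perm_on (~: R) h & map h t = t'.
Proof.
elim: t t' => [|a t IHt] [|a' t'] //=; first by exists 1%g => //; apply: perm_on1.
case/andP=> at_ ut /andP[at' ut'] [st] /andP[aR tR] /andP[aR' tR'].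
have [h hR ht] := IHt _ ut ut' st tR tR'.
exists (h * tperm (h a) a')%g.
  apply: perm_onM => //; rewrite /perm_on; apply/fintype.subsetP => k; rewrite inE.
  apply: contraR => kR; rewrite tpermD //.
    by apply: contraNneq kR => <-; rewrite perm_closed.
  by apply: contraNneq kR => <-.
rewrite permM tpermL; congr (_ :: _); rewrite -ht; apply/eq_in_map => k kt.
rewrite permM tpermD //.
  by rewrite (inj_eq perm_inj); apply: contraNneq at_ => ->.
by apply: contraNneq at' => ->; rewrite -ht map_f.
Qed.

Definition jm i := \sum_(k : 'I_m | (k < i)%N) tau k i.

Lemma jm_exp i t : jm i ^+ t =
  \sum_(g in ffun_on (fun k : 'I_m => (k < i)%N)) tword i (codom (g : {ffun 'I_t -> 'I_m})).
Proof.
have := prodr_const 'I_t (jm i); rewrite card_ord => <-.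
rewrite bigA_distr_big; apply: eq_bigr => g _.
by rewrite /tword codomE big_map enumT /index_enum unlock.
Qed.

Lemma Fl_jm i t : Fl (t * d.-1).+1 (jm i ^+ t).
Proof.
rewrite jm_exp; apply: fil_sum => g _.
by have := Fl_tword i (codom g); rewrite size_codom card_ord.
Qed.

(** The polynomials ['X^b * pol ^+ t] are chosen so that the leading term of their value at x_i
    expands into words with [t] decorated transpositions. *)
Lemma horner_jm i b t : Fl (b + t * d.-1)
  (horner_alg (x i) ('X^b * pol ^+ t) - x i ^+ b * jm i ^+ t).
Proof.
rewrite rmorphM !rmorphXn /= horner_algX.
have yj : Fl d.-1 (horner_alg (x i) pol - jm i) by exact: horner_pol_tau.
have fj e : Fl (e * d.-1).+1 (jm i ^+ e) by apply: Fl_jm.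
have fy : Fl d.-1.+1 (horner_alg (x i) pol).
  apply: (fil_cong (v := jm i)); first exact: Fl_le yj.
  by have := fj 1%N; rewrite mul1n expr1.
have fye e : Fl (e * d.-1).+1 (horner_alg (x i) pol ^+ e).
  elim: e => [|e IHe]; first by rewrite expr0 -G1; apply: Fl_G.
  by rewrite exprS mulSn; apply: Fl_MS.
apply: Fl_congM => //; [exact: Fl_xn|by rewrite subrr; apply: fil0|].
elim: t => [|t IHt]; first by rewrite !expr0 subrr; apply: fil0.
rewrite !exprS mulSn; apply: Fl_congM => //.
by have := fj 1%N; rewrite mul1n expr1.
Qed.

Lemma Fl_horner_jm i b t : Fl (b + t * d.-1).+1 (horner_alg (x i) ('X^b * pol ^+ t)).
Proof.
apply: (fil_cong (v := x i ^+ b * jm i ^+ t)); first exact: Fl_le (horner_jm i b t).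
by apply: Fl_MS; [apply: Fl_xn|apply: Fl_jm].
Qed.

(* A permutation of R preserving R :&: low is unwound one cycle at a time from
   the chosen point i, by splitting off the predecessor of i. *)
Lemma cycle_peel R N c w i (Q : A -> Prop) : subsp Q -> (forall u, Fl N u -> Q u) ->
    adm R N c w -> i \in R -> i \in low ->
    (forall k, k \in R -> k \in low -> w k \in low) ->
    (forall R' N' b u f, uniq (i :: f) -> all [in R :&: low] f ->
       R' = R :\: [set k in i :: f] ->
       qcent R' N' u -> (N' + b + size f * d.-1)%N = N -> Q (word u b i f)) ->
  Q (pure c w).
Proof.
have [n] := ubnP #|R|; elim: n R N c w Q => // n IHn R N c w Q Rn sQ QF ad iR il wl Qw.
have [cR wR rel] := ad.
have [wi|wi] := eqVneq (w i) i.
  have [cf cfa cfe] := peel_fix ad iR wi.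
  apply: (subsp_cong sQ) (QF _ cfe) _; apply: (subsp_sum sQ) => p pN.
  have := Qw (R :\ i) (N - p)%N p (pure (cf p) w) [::].
  rewrite /word /tword big_nil mulr1; apply => //=.
  - by apply/setP => k; rewrite !inE andbC.
  - by apply: qcent_pure; apply: cfa.
  by rewrite mul0n addn0 subnK.
pose l := (w^-1)%g i; have wli : w l = i by rewrite permKV.
have li : l != i by apply: contraNneq wi => e; have := wli; rewrite e => ->.
(* [w] maps [R :&: low] into itself and is injective, so it permutes this finite set, which
   therefore contains the predecessor of [i]. *)
have [lR ll] : l \in R /\ l \in low.
  have : i \in w @: (R :&: low).
    have -> : w @: (R :&: low) = R :&: low; last by rewrite inE iR.
    apply/eqP; rewrite eqEcard card_imset ?leqnn ?andbT; last exact: perm_inj.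
    apply/fintype.subsetP => _ /imsetP[k + ->]; rewrite !inE => /andP[kR kl].
    by rewrite perm_closed // kR wl.
  case/imsetP => k + ik; rewrite !inE => /andP[kR kl].
  by have -> : l = k by rewrite /l ik permK.
have wll : w l != l by rewrite wli eq_sym.
have [Nd|dN] := ltnP N d.-1.
  by rewrite (pure_small ad ll wll Nd); apply: subsp0 sQ.
have [c' ad' e] := peel_tau ad ll lR wll dN; rewrite wli in ad' e.
apply: (subsp_cong sQ) (QF _ e) _.
(* The factor [tau l i] is absorbed into the property, so the word grows on the right while the set
   shrinks; the new predecessor of [i] is the old predecessor of [l]. *)
apply: (IHn (R :\ l) (N - d.-1)%N c' _ (fun u => Q (u * tau l i))) => //.
- by move: Rn; rewrite (cardsD1 l R) lR.
- exact: subsp_mulr.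
- move=> u fu; apply: QF; rewrite -(subnK dN); apply: Fl_Mrt => //.
  by rewrite prednK //; apply: Fl_tau.
- by rewrite in_setD1 eq_sym li.
- move=> k; rewrite in_setD1 => /andP[kl kR] kL; rewrite permM.
  by case: tpermP => // _ _; apply: wl.
move=> R' N' b u f; rewrite /= => /andP[if_ uf] fR eR qu eN.
have -> : word u b i f * tau l i = word u b i (rcons f l).
  by rewrite /word -mulrA /tword -cats1 big_cat big_seq1.
have lf : l \notin f.
  by apply: contraL (_ : l \notin R :\ l) => [/(allP fR)|]; rewrite !inE ?eqxx.
apply: (Qw R' N' b) => //=.
- by rewrite mem_rcons inE eq_sym negb_or li if_ rcons_uniq lf.
- rewrite all_rcons /= inE lR ll; apply: sub_all fR => k /=.
  by rewrite !inE => /andP[/andP[_ ->] ->].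
- rewrite eR; apply/setP => k; rewrite !inE mem_rcons inE !negb_or.
  by case: (k == i) (k == l) (k \in f) (k \in R) => [] [] [] [].
by rewrite size_rcons mulSn addnCA eN addnC subnK.
Qed.

Hypothesis low_initial : forall i j, i \in low -> (j < i)%N -> j \in low.
Hypothesis charK0 : [pchar K] =i pred0.
(* B is to be the algebra generated by H_k and the center of H_n^lambda, with
   low the first n indices. *)
Variable B : A -> Prop.
Hypothesis B_subsp : subsp B.
Hypothesis B1 : B 1.
Hypothesis BM : forall u v, B u -> B v -> B (u * v).
Hypothesis B_x : forall i, i \notin low -> B (x i).
Hypothesis B_G : forall w, perm_on (~: low) w -> B (G w).
Hypothesis B_sum : forall q, B (\sum_(i in low) horner_alg (x i) q).
Hypothesis B_comm : forall b h, B b -> perm_on low h -> GRing.comm b (G h).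

(** * Elements whose leading term is represented in B *)

Definition symb N t := exists2 b, B b /\ Fl N.+1 b & Fl N (t - b).

Lemma symb_subsp N : subsp (symb N).
Proof.
split=> [|c u v [b [Bb fb] ub] [b' [Bb' fb'] vb']].
  by exists 0; [split; [apply: subsp0 B_subsp|apply: fil0]|rewrite subrr; apply: fil0].
exists (c *: b + b').
  by split; [apply: (B_subsp.2)|apply: filD => //; apply: filZ].
by rewrite opprD addrACA -scalerBr; apply: filD => //; apply: filZ.
Qed.

Lemma symb_Fl N u : Fl N u -> symb N u.
Proof.
move=> fu; exists 0; last by rewrite subr0.
by split; [apply: subsp0 B_subsp|apply: fil0].
Qed.

Lemma symb_B N b : B b -> Fl N.+1 b -> symb N b.
Proof. by move=> Bb fb; exists b => //; rewrite subrr; apply: fil0. Qed.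

Lemma symb_cong N u v : Fl N (u - v) -> symb N v -> symb N u.
Proof. by move=> uv sv; apply: (subsp_cong (symb_subsp N)) sv; apply: symb_Fl. Qed.

(** * Averaging over the symmetric group *)

(** Left unnormalised; the divisions are collected in [symb_div]. *)
Definition avg u := \sum_(h | perm_on low h) cj h u.

Lemma cj_lin h c u v : cj h (c *: u + v) = c *: cj h u + cj h v.
Proof. by rewrite /cj mulrDr mulrDl -scalerAr -scalerAl. Qed.

Lemma avg_lin c u v : avg (c *: u + v) = c *: avg u + avg v.
Proof.
rewrite /avg scaler_sumr -big_split; apply: eq_bigr => h _.
exact: cj_lin.
Qed.

Lemma avg_subsp Q : subsp Q -> subsp (fun u => Q (avg u)).
Proof. by apply: subsp_comp; apply: avg_lin. Qed.

Lemma avg_Fl N u : Fl N u -> Fl N (avg u).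
Proof. by move=> fu; apply: fil_sum => h _; apply: Fl_cj. Qed.

Lemma avgB u v : avg (u - v) = avg u - avg v.
Proof. by rewrite /avg -sumrB; apply: eq_bigr => h _; apply: cjB. Qed.

Lemma avg_sum I (r : seq I) (P : pred I) (F : I -> A) :
  avg (\sum_(a <- r | P a) F a) = \sum_(a <- r | P a) avg (F a).
Proof.
rewrite /avg [RHS]exchange_big; apply: eq_bigr => h _.
by rewrite /cj mulr_sumr mulr_suml.
Qed.

Lemma avg_cong N u v : Fl N (u - v) -> Fl N (avg u - avg v).
Proof. by rewrite -avgB; apply: avg_Fl. Qed.

Lemma cj_B h b : B b -> perm_on low h -> cj h b = b.
Proof. by move=> Bb hl; rewrite /cj -(B_comm Bb hl) -mulrA GV mulr1. Qed.

Lemma avg_mulB u b : B b -> avg (u * b) = avg u * b.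
Proof.
move=> Bb; rewrite /avg mulr_suml; apply: eq_bigr => h hl.
by rewrite cjM (cj_B Bb hl).
Qed.

Lemma avg_fixed u : (forall h, perm_on low h -> cj h u = u) ->
  avg u = u *+ #|[pred h : 'S_m | perm_on low h]|.
Proof.
move=> fu; rewrite /avg (eq_bigr (fun=> u)) => [|h]; last exact: fu.
by rewrite sumr_const.
Qed.

Lemma avg_cj g u : perm_on low g -> avg (cj g u) = avg u.
Proof.
move=> gl; rewrite /avg [RHS](reindex_inj (mulIg g)) /=; apply: eq_big => h.
  have [hl|hl] := boolP (perm_on low h); first by rewrite perm_onM.
  apply/esym/negbTE; apply: contra hl => hgl.
  by rewrite -(mulgK g h) perm_onM // perm_onV.
by move=> _; rewrite /cj invMg !GM !mulrA.
Qed.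

Lemma natr_neq0 p : (0 < p)%N -> p%:R != 0 :> K.
Proof. by have /GRing.pcharf0P -> := charK0; rewrite lt0n. Qed.

(** Every use of characteristic zero passes through this division. *)
Lemma symb_div N u p : (0 < p)%N -> symb N (u *+ p) -> symb N u.
Proof.
move=> p0 su; have -> : u = p%:R^-1 *: (u *+ p).
  by rewrite -[u *+ p]scaler_nat scalerA mulVf ?scale1r // natr_neq0.
exact: (subspZ (symb_subsp N)).
Qed.

(** To leading order [t] may be replaced by its representative in B, which is invariant under
    conjugation by permutations of [low] and can be taken out of the average. *)
Lemma avg_symbM N M u t : Fl N.+1 u -> symb N (avg u) -> symb M t ->
  symb (N + M) (avg (u * t)).
Proof.
move=> fu [a [Ba fa] ua] [b [Bb fb] tb]; exists (a * b).
  by split; [apply: BM|apply: Fl_MS].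
apply: (fil_trans (v := avg (u * b))).
  apply: avg_cong; rewrite -mulrBr; exact: Fl_Mlt.
rewrite avg_mulB // -mulrBl; exact: Fl_Mrt.
Qed.

Lemma B_mon l : all [in ~: low] l -> B (X l).
Proof.
elim: l => [|i l IHl] /=; first by rewrite /mon big_nil.
case/andP => il ll; rewrite mon_cons; apply: BM; last exact: IHl.
by apply: B_x; move: il; rewrite inE.
Qed.

Lemma fil_B N u : fil (~: low) N u -> B u.
Proof.
by case=> h; apply: h => // l w lN lR wR; apply: BM; [apply: B_mon|apply: B_G].
Qed.

Lemma symb_avg_K N u : qcent (~: low) N u -> symb N (avg u).
Proof.
move=> [[u0 fu uu] _]; apply: (symb_cong (avg_cong uu)).
have Bu := fil_B fu; rewrite avg_fixed => [|h hl]; last exact: cj_B.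
rewrite -scaler_nat; apply: (subspZ (symb_subsp N)); apply: symb_B => //.
exact: fil_Fl fu.
Qed.

Lemma symb_jm b t :
  symb (b + t * d.-1) (\sum_(i in low) x i ^+ b * jm i ^+ t).
Proof.
exists (\sum_(i in low) horner_alg (x i) ('X^b * pol ^+ t)).
  by split; [apply: B_sum|apply: fil_sum => i _; apply: Fl_horner_jm].
by apply: filBC; rewrite -sumrB; apply: fil_sum => i _; apply: horner_jm.
Qed.

(** The leading term of f(x_j) is the sum of [tau k j] over all [k < j]. As [low] is initial it lies
    entirely below [j], and the terms with [k] outside [low] belong to B. *)
Lemma symb_tau_low j : j \notin low -> symb d.-1 (\sum_(i in low) tau i j).
Proof.
move=> jl; have Btau k : k \notin low -> B (tau k j).
  move=> kl; apply: (@fil_B d); apply: tau_fil; by rewrite inE.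
have sj : symb d.-1 (jm j).
  exists (horner_alg (x j) pol); last by apply: filBC; apply: horner_pol_tau.
  have := Fl_horner_jm j 0 1; rewrite expr0 mul1r expr1 add0n mul1n => fj.
  split=> //; rewrite horner_algE; apply: (subsp_sum B_subsp) => t _.
  apply: (subspZ B_subsp); elim: (nat_of_ord t) => [|e IHe]; first by rewrite expr0.
  by rewrite exprS; apply: BM => //; apply: B_x.
have -> : \sum_(i in low) tau i j =
    jm j - \sum_(k : 'I_m | (k < j)%N && (k \notin low)) tau k j.
  rewrite /jm [X in _ = X - _](bigID (fun k : 'I_m => k \in low)) /= addrK; apply: eq_bigl => k.
  case kl : (k \in low); rewrite ?andbF ?andbT //.
  have [//|jk] := ltnP k j; have [e|ne] := eqVneq k j; first by rewrite -e kl in jl.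
  case/negP: jl; apply: (low_initial kl); rewrite ltn_neqAle jk andbT.
  by rewrite eq_sym.
apply: (subspB (symb_subsp _)) => //; apply: (subsp_sum (symb_subsp _)) => k /andP[_ kl].
by apply: symb_B; [apply: Btau|rewrite prednK //; apply: Fl_tau].
Qed.

(** Induction on the size of the support, one leading term [c w] at a time; indices outside [low]
    always count as available, since B contains all that is supported on them. If [w] sends a point
    of [R :&: low] out of [low], that point is split off alone; otherwise [w] permutes [R :&: low]
    and a whole cycle is unwound. *)
Lemma symb_avg R N u : ~: low \subset R -> qcent R N u -> symb N (avg u).
Proof.
have [n] := ubnP #|R|; elim: n R N u => // n IHn R N u Rn KR qu.
have [c [cad c0 cu]] := qcent_decomp qu.
apply: (symb_cong (avg_cong cu)); rewrite avg_sum.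
apply: (subsp_sum (symb_subsp N)) => w _.
have [wR|nwR] := boolP (perm_on R w); last first.
  rewrite /pure big1 => [|b _]; last by rewrite c0 // scale0r.
  by apply: symb_Fl; rewrite /avg big1 => [|h _]; [apply: fil0|rewrite /cj mulr0 mul0r].
have {cu c0} ad := cad w wR; move: (c w) ad => {cad u qu} {}c ad.
have [/existsP[l /and3P[lR ll wl]]|] :=
    boolP [exists l, [&& l \in R, l \in low & w l \notin low]].
  have wll : w l != l by apply: contraNneq wl => ->.
  have [Nd|dN] := ltnP N d.-1.
    by rewrite (pure_small ad ll wll Nd); apply: symb_Fl; rewrite /avg big1 => [|h _];
      [apply: fil0|rewrite /cj mulr0 mul0r].
  have [c' ad' e] := peel_tau ad ll lR wll dN.
  apply: (symb_cong (avg_cong e)); set w' := (w * _)%g in ad' e *.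
  set u := pure c' w'; set j := w l in wl e *.
  have KR' : ~: low \subset R :\ l.
    apply/fintype.subsetP => k kK; rewrite in_setD1 (fintype.subsetP KR) // andbT.
    by apply: contraTneq kK => ->; rewrite inE ll.
  have R'n : (#|R :\ l| < n)%N by move: Rn; rewrite (cardsD1 l R) lR.
  have qu : qcent (R :\ l) (N - d.-1) u by apply: qcent_pure.
  have su := IHn _ _ _ R'n KR' qu.
  have jR' : j \in R :\ l by rewrite (fintype.subsetP KR') // inE.
  (* The single factor [tau l j] is replaced by the sum of all [tau i j] with [i] in [low], whose
     leading term is represented in B. *)
  have := avg_symbM (qcent_Fl qu) su (symb_tau_low wl).
  rewrite subnK // mulr_sumr avg_sum (bigID (fun i : 'I_m => i \in R :\ l)) /= => st.
  (* For [i] in [R :\ l] the term is still supported on [R :\ l] and falls under the induction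
     hypothesis. *)
  have {}st : symb N (\sum_(i in low | i \notin R :\ l) avg (u * tau i j)).
    rewrite -[X in symb _ X](addKr (\sum_(i in low | i \in R :\ l) avg (u * tau i j))).
    apply: (subspD (symb_subsp _)) => //; apply: (subspN (symb_subsp _)).
    apply: (subsp_sum (symb_subsp _)) => i /andP[_ iR]; apply: (IHn (R :\ l)) => //.
    by rewrite -(subnK dN); apply: qcent_M => //; apply: qcent_tau.
  (* The transposition of [l] and [i] fixes [R :\ l], hence [u] to leading order as well as [j]; all
     remaining terms have the average of the term [i = l]. *)
  apply: (@symb_div _ _ #|[pred i in low | i \notin R :\ l]|).
    by apply/card_gt0P; exists l; rewrite !inE ll eqxx.
  apply: symb_cong st; rewrite -sumr_const -sumrB; apply: fil_sum => i /andP[il iR].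
  have hR : perm_on (~: (R :\ l)) (tperm l i).
    rewrite /perm_on; apply/fintype.subsetP => k; rewrite inE; apply: contraR.
    rewrite inE negbK => kR; rewrite tpermD //.
      by apply: contraTneq kR => <-; rewrite !inE eqxx.
    by apply: contraTneq kR => <-.
  have hl : perm_on low (tperm l i).
    rewrite /perm_on; apply/fintype.subsetP => k; rewrite inE; apply: contraR => kl.
    by rewrite tpermD //; apply: contraNneq kl => <-.
  rewrite -(avg_cj _ hl); apply: avg_cong.
  have := cj_word 0 j [:: l] hR qu.
  rewrite /word /= !expr0 !mulr1 addn0 mul1n subnK // tpermV tpermL tpermD; first last.
  - by apply: contraNneq iR => ->.
  - by apply: contraTneq jR' => <-; rewrite !inE eqxx.
  by rewrite /tword !big_seq1.
rewrite negb_exists => /forallP wlow.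
have {}wlow k : k \in R -> k \in low -> w k \in low.
  by move=> kR kl; have := wlow k; rewrite kR kl negbK.
have [/existsP[k0 k0P]|] := boolP [exists k, k \in R :&: low]; last first.
  rewrite negb_exists => /forallP R0.
  have RK : R \subset ~: low.
    by apply/fintype.subsetP => k kR; have := R0 k; rewrite !inE kR.
  by apply: symb_avg_K; apply: qcent_le RK _; apply: qcent_pure.
(* [jm i] involves only indices below [i]. Unwinding from the largest index of [R :&: low] ensures
   that the word obtained occurs in the expansion of [jm i ^+ t]. *)
have [i iP imax] := @arg_maxnP _ k0 [in R :&: low] (fun k => nat_of_ord k) k0P.
move: (iP); rewrite inE => /andP[iR il].
have sQ := avg_subsp (symb_subsp N).
apply: (cycle_peel sQ _ ad iR il wlow) => [u fu|]; first by apply/symb_Fl/avg_Fl.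
move=> R' N' b u f uf fR R'E qu eN.
set t := size f in eN *.
have KR' : ~: low \subset R'.
  rewrite R'E; apply/fintype.subsetP => k kK; rewrite !inE (fintype.subsetP KR) // andbT.
  rewrite inE in kK; rewrite negb_or; apply/andP; split; first by apply: contraNneq kK => ->.
  by apply: contra kK => /(allP fR); rewrite inE => /andP[].
have F_notR' : all [in ~: R'] (i :: f).
  by apply/allP => k kf; rewrite /= R'E !inE negb_and negbK -in_cons kf.
have cardR : #|R| = (#|R'| + t.+1)%N.
  have FR : [set k in i :: f] \subset R.
    apply/fintype.subsetP => k; rewrite !inE => /orP[/eqP->//|/(allP fR)].
    by rewrite inE => /andP[].
  rewrite -(cardsID [set k in i :: f] R) addnC (finset.setIidPr FR) -R'E cardsE.
  by rewrite (card_uniqP uf).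
have R'n : (#|R'| < n)%N.
  by apply: leq_trans (_ : #|R| <= n)%N => //; rewrite cardR addnS ltnS leq_addr.
have := avg_symbM (qcent_Fl qu) (IHn _ _ _ R'n KR' qu) (symb_jm b t).
rewrite addnA eN mulr_sumr avg_sum.
have expand i' : avg (u * (x i' ^+ b * jm i' ^+ t)) =
    \sum_(g in ffun_on (fun k : 'I_m => (k < i')%N))
      avg (word u b i' (codom (g : {ffun 'I_t -> 'I_m}))).
  by rewrite mulrA jm_exp mulr_sumr avg_sum.
rewrite (eq_bigr _ (fun i' _ => expand i')) pair_big_dep /=.
(* A good word has distinct indices avoiding [R']. Any other word, together with [R'], involves
   fewer than [#|R'| + t.+1 = #|R|] indices, so the induction hypothesis covers it. *)
pose good (p : 'I_m * {ffun 'I_t -> 'I_m}) :=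
  uniq (p.1 :: codom p.2) && all [in ~: R'] (p.1 :: codom p.2).
have szp (p : 'I_m * {ffun 'I_t -> 'I_m}) : size (p.1 :: codom p.2) = t.+1.
  by rewrite /= size_codom card_ord.
rewrite (bigID good) /= => st.
set bad := \sum_(p | _ && ~~ _) _ in st.
have sbad : symb N bad.
  apply: (subsp_sum (symb_subsp _)) => p /andP[_ np].
  pose F := [set k in p.1 :: codom p.2].
  apply: (IHn (R' :|: F)).
  - have FF : (#|F| <= t.+1)%N by rewrite cardsE -(szp p) card_size.
    suff lt : (#|R' :|: F| < #|R|)%N by apply: leq_trans lt _; rewrite -ltnS.
    rewrite cardR; move: np; rewrite negb_and => /orP[nu|].
      apply: (leq_ltn_trans (leq_card_setU _ _)); rewrite ltn_add2l.
      rewrite ltn_neqAle FF andbT; apply: contra nu => /eqP e.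
      by apply/card_uniqP; rewrite szp -e cardsE.
    case/allPn => k kF; rewrite inE negbK => kR'.
    by apply: leq_trans (card_setU_lt kR' _) _; rewrite ?inE // leq_add2l.
  - exact: fintype.subset_trans KR' (finset.subsetUl _ _).
  have <- : (N' + b + size (codom p.2) * d.-1)%N = N by rewrite size_codom card_ord.
  apply: qcent_word; first by rewrite !inE eqxx orbT.
    by apply/allP => k kc; rewrite /= !inE kc !orbT.
  by apply: qcent_le qu; apply: finset.subsetUl.
have {sbad} st' := subspB (symb_subsp N) st sbad; rewrite addrK in st'.
pose ngood := #|[pred p : 'I_m * {ffun 'I_t -> 'I_m} |
  (p.1 \in low) && (p.2 \in ffun_on (fun k : 'I_m => (k < p.1)%N)) && good p]|.
apply: (@symb_div _ _ ngood).
  pose g : {ffun 'I_t -> 'I_m} := finfun (tnth (in_tuple f)).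
  have gf : codom g = f.
    rewrite codomE -[RHS](map_tnth_enum (in_tuple f)).
    by apply: eq_map => k; rewrite ffunE.
  have gd : good (i, g) by rewrite /good -[(i, g).1]/i -[(i, g).2]/g gf uf F_notR'.
  have gon : g \in ffun_on (fun k : 'I_m => (k < i)%N).
    apply/ffun_onP => k; have gk : g k \in f by rewrite -gf codom_f.
    have gi : (g k <= i)%N by apply: imax; apply: (allP fR).
    rewrite /in_mem /= ltn_neqAle gi andbT.
    by move/andP: uf => [+ _]; apply: contraNneq => /val_inj <-.
  by apply/card_gt0P; exists (i, g); rewrite inE gd andbT; apply/andP.
(* Each good word is carried to the given one by a permutation that fixes [R'], hence is supported
   on [low]; all good words thus have the same average to leading order. *)
apply: symb_cong st'; rewrite -sumr_const -sumrB.
apply: fil_sum => -[i' g] /andP[_ /andP[/= ug gR]].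
have [h0 h0R /= [h0i h0f]] :=
  @perm_ext_list R' (i :: f) (i' :: codom g) uf ug (esym (szp (i', g))) F_notR' gR.
have hR : perm_on (~: R') h0^-1%g by rewrite perm_onV.
have hl : perm_on low h0^-1%g.
  apply: fintype.subset_trans hR _; apply/fintype.subsetP => k; rewrite inE.
  by apply: contraR => kl; apply: (fintype.subsetP KR'); rewrite inE.
rewrite -(avg_cj _ hl); apply: avg_cong.
by have := cj_word b i f hR qu; rewrite invgK h0i h0f eN.
Qed.

(** Induction on the degree. Invariance under conjugation makes [u] its own average up to a nonzero
    integer, so it agrees to leading order with some [b] in B; since [b] centralizes as well,
    [u - b] satisfies the same hypotheses in smaller degree. *)
Lemma centralized_in_B u : (forall i, i \in low -> GRing.comm (x i) u) ->
    (forall h, perm_on low h -> GRing.comm (G h) u) ->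
    (forall b i, i \in low -> B b -> GRing.comm (x i) b) ->
    (forall a, exists N, Fl N a) -> B u.
Proof.
move=> xu Gu xB total; have [N fN] := total u.
elim: N u xu Gu fN => [|N IHN] u xu Gu fu; first by rewrite (Fl0 fu); apply: subsp0 B_subsp.
have qu : qcent [set: 'I_m] N u.
  split; first by exists u => //; rewrite subrr; apply: fil0.
  by move=> i il; rewrite xu // subrr; apply: fil0.
have su : symb N (avg u) by apply: symb_avg qu; apply: finset.subsetT.
rewrite avg_fixed in su; last first.
  by move=> h hl; rewrite /cj Gu // -mulrA GV mulr1.
have {su} [b [Bb fb] ub] : symb N u.
  by apply: symb_div su; apply/card_gt0P; exists 1%g; rewrite inE perm_on1.
apply: (subsp_cong B_subsp (v := b)) => //; apply: IHN => //.
  by move=> i il; apply: commrB; [apply: xu|apply: xB].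
by move=> h hl; apply: commrB; [apply: Gu|apply/commr_sym/B_comm].
Qed.

End Filtration.

(** * The centralizer *)

Local Open Scope classical_set_scope.

Section SubalgebraFacts.
Variables (K : fieldType) (A : algType K).

Lemma subalg_gen_subalgebra (S : set A) : subalgebra (subalg_gen S).
Proof.
split=> [B [[B1 _ _] _] //|c u v Su Sv B [sB SB]|u v Su Sv B [sB SB]].
  by have [_ BD _] := sB; apply: BD; [apply: Su|apply: Sv].
by have [_ _ BM] := sB; apply: BM; [apply: Su|apply: Sv].
Qed.

Lemma sub_subalg_gen (S : set A) : S `<=` subalg_gen S.
Proof. by move=> u Su B [_]; apply. Qed.

Lemma centralizer_subalgebra (S : set A) : subalgebra (centralizer S).
Proof.
split=> [u _|c u v Su Sv y Sy|u v Su Sv y Sy]; first exact: commr_sym (commr1 _).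
  apply: commr_sym; apply: commrD; last exact/commr_sym/Sv.
  by rewrite /GRing.comm -scalerAr -scalerAl (Su _ Sy).
by apply: commr_sym; apply: commrM; apply: commr_sym; [apply: Su|apply: Sv].
Qed.

Lemma comm_subalgebra (u : A) : subalgebra [set y | GRing.comm y u].
Proof.
split=> [|c y z yu zu|y z yu zu] /=; first exact/commr_sym/commr1.
  apply: commr_sym; apply: commrD; last exact/commr_sym.
  by rewrite /GRing.comm -scalerAr -scalerAl yu.
by apply: commr_sym; apply: commrM; apply: commr_sym.
Qed.

Lemma subalgebra_subsp (B : set A) : subalgebra B -> subsp B.
Proof.
by case=> B1 BD _; split=> //; rewrite -(addNr 1) -scaleN1r; apply: BD.
Qed.

End SubalgebraFacts.

Lemma rmorph_horner_alg (K : fieldType) (A B : algType K) (f : {lrmorphism A -> B})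
  (y : A) q : f (horner_alg y q) = horner_alg (f y) q.
Proof.
rewrite !horner_algE linear_sum; apply: eq_bigr => t _.
by rewrite linearZ rmorphXn.
Qed.

Section CentralizerTheorem.
Variables (K : fieldType) (n k : nat) (lam : weight) (lam_neq0 : lam != weight0).

Local Notation m := (n + k)%N.
Local Notation H := (cycHecke K m lam_neq0).
Local Notation Hn := (cycHecke K n lam_neq0).
Local Notation s := (cyc_s K (m := m) lam_neq0).
Local Notation x := (cyc_x K (m := m) lam_neq0).
Local Notation incl := (cyc_incl K n k lam_neq0).
Local Notation shft := (cyc_shift K n k lam_neq0).
Local Notation G := (cox s).

Let low : {set 'I_m} := [set i : 'I_m | (i < n)%N].
Let B : set H := subalg_gen (range shft `|` incl @` center Hn).

Lemma cyc_sum_central q :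
  center Hn (\sum_i horner_alg (cyc_x K (m := n) lam_neq0 i) q).
Proof.
have rel0 := @cyc_rel0 K n lam lam_neq0.
move=> y _; apply: commr_sym; move: y.
apply: (cyc_ind (comm_subalgebra _)) => i /=.
  exact: (sum_horner_s (level_gt0 lam_neq0) rel0 (charpoly_monic _ _)
    (size_charpoly K lam) i q).
by apply: commr_sum => j _; apply: (horner_x_comm rel0).
Qed.

Lemma incl_x (i : 'I_n) : incl (cyc_x K lam_neq0 i) = x (lshift k i).
Proof. by rewrite /cyc_x cyc_inclE aff_incl_x. Qed.

Lemma incl_s (i : 'I_n.-1) : incl (cyc_s K lam_neq0 i) = s (lidx k i).
Proof. by rewrite /cyc_s cyc_inclE aff_incl_s. Qed.

Lemma shft_x (i : 'I_k) : shft (aff_x K i) = x (rshift n i).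
Proof. by rewrite /cyc_shift /= aff_shift_x. Qed.

Lemma shft_s (i : 'I_k.-1) : shft (aff_s K i) = s (ridx n i).
Proof. by rewrite /cyc_shift /= aff_shift_s. Qed.

Lemma incl_M a b : incl (a * b) = incl a * incl b.
Proof. exact: rmorphM. Qed.

Lemma B_sub_centralizer : B `<=` centralizer (range incl).
Proof.
move=> b; apply; split; first exact: centralizer_subalgebra.
move=> _ [[a _ <-]|[a ca <-]] _ [c _ <-].
  exact: commr_sym (cyc_incl_shift_comm c a).
exact: etrans (etrans (esym (incl_M a c)) (congr1 incl (ca c Logic.I))) (incl_M c a).
Qed.

Lemma range_incl_G h : perm_on low h -> range incl (G h).
Proof.
have rel0 := @cyc_rel0 K m lam lam_neq0.
have -> : low = [set i : 'I_m | (0 <= i < n)%N]%SET.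
  by apply/setP => i; rewrite !inE.
elim/adj_interval_ind => [|i w _ lt [u _ uw]].
  by exists 1 => //; rewrite rmorph1 cox1.
have lt' : (i < n.-1)%N by lia.
exists (cyc_s K lam_neq0 (Ordinal lt') * u); first by [].
rewrite incl_M uw incl_s.
rewrite (cox_adjM (hecke_s2 rel0) (hecke_s_comm rel0) (hecke_s_braid rel0)).
by congr (s _ * _); apply/val_inj.
Qed.

Lemma B_cox w : perm_on (~: low) w -> B (G w).
Proof.
have rel0 := @cyc_rel0 K m lam lam_neq0.
have [B1 _ BM] := subalg_gen_subalgebra (range shft `|` incl @` center Hn).
have -> : ~: low = [set i : 'I_m | (n <= i < m)%N]%SET.
  by apply/setP => i; rewrite !inE -leqNgt ltn_ord andbT.
elim/adj_interval_ind => [|i w' ni _ Bw]; first by rewrite cox1.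
rewrite (cox_adjM (hecke_s2 rel0) (hecke_s_comm rel0) (hecke_s_braid rel0)).
apply: BM => //; apply: sub_subalg_gen; left.
have lt : (i - n < k.-1)%N by have := ltn_ord i; lia.
exists (aff_s K (Ordinal lt)); first by [].
rewrite shft_s; congr (s _).
by apply/val_inj; rewrite /= subnKC.
Qed.

Lemma cyc_total (a : H) : exists N, fil s x [set: 'I_m]%SET N a.
Proof.
have rel0 := @cyc_rel0 K m lam lam_neq0.
move: a; apply: cyc_ind => [|i|i].
- split=> [|c u v [N fu] [N' fv]|u v [N fu] [N' fv]].
  + by exists 1%N; rewrite -(cox1 s); apply: Fl_G.
  + exists (maxn N N'); apply: filD; last by apply: Fl_le fv; rewrite leq_maxr.
    by apply: filZ; apply: Fl_le fu; rewrite leq_maxl.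
  + by exists (N + N').-1; apply: (Fl_M (level_gt0 lam_neq0) rel0
      (charpoly_monic _ _) (size_charpoly K lam)).
- exists 1%N; rewrite -(cox_adj (hecke_s2 rel0) (hecke_s_comm rel0) (hecke_s_braid rel0)).
  exact: Fl_G.
by exists 2; apply: Fl_x.
Qed.

Lemma centralizer_cyc_incl : [pchar K] =i pred0 -> centralizer (range incl) = B.
Proof.
move=> charK0; apply/seteqP; split; last exact: B_sub_centralizer.
have rel0 := @cyc_rel0 K m lam lam_neq0.
have sB := subalg_gen_subalgebra (range shft `|` incl @` center Hn).
have [B1 _ BM] := sB; have x_low i : i \in low -> range incl (x i).
  rewrite inE => il; exists (cyc_x K lam_neq0 (Ordinal il)); first by [].
  by rewrite incl_x; congr (x _); apply/val_inj.
move=> z cz; apply: (@centralized_in_B K H m (level lam) (level_gt0 lam_neq0)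
  s x (charpoly K lam) rel0 (charpoly_monic _ _) (size_charpoly _ _) _ _ low _ charK0 B).
- exact: cyc_x0.
- exact: cyc_coord.
- by move=> i j; rewrite !inE => il ji; apply: ltn_trans ji il.
- exact: subalgebra_subsp sB.
- exact: B1.
- exact: BM.
- move=> i; rewrite inE -leqNgt => ni; apply: sub_subalg_gen; left.
  have lt : (i - n < k)%N by have := ltn_ord i; lia.
  exists (aff_x K (Ordinal lt)); first by [].
  rewrite shft_x; congr (x _).
  by apply/val_inj; rewrite /= subnKC.
- exact: B_cox.
- move=> q; apply: sub_subalg_gen; right.
  exists (\sum_i horner_alg (cyc_x K lam_neq0 i) q); first exact: cyc_sum_central.
  rewrite rmorph_sum /= big_split_ord /= [X in _ = _ + X]big1 ?addr0.
    apply: eq_big => [i|i _]; first by rewrite inE /= ltn_ord.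
    by rewrite rmorph_horner_alg /= incl_x.
  by move=> i; rewrite inE /= ltnNge leq_addr.
- move=> b h Bb hl; apply: B_sub_centralizer => //; exact: range_incl_G.
- by move=> i il; apply/commr_sym/cz/x_low.
- by move=> h hl; apply/commr_sym/cz/range_incl_G.
- by move=> b i il Bb; apply/commr_sym/(B_sub_centralizer Bb)/x_low.
exact: cyc_total.
Qed.

End CentralizerTheorem.

Theorem corollary7p7 (K : fieldType) (charK0 : [pchar K] =i pred0) (n k : nat)
    (lam : weight) (lam_neq0 : lam != weight0) :
  centralizer (range (cyc_incl K n k lam_neq0)) =
  subalg_gen (range (cyc_shift K n k lam_neq0) `|`
              cyc_incl K n k lam_neq0 @` center (cycHecke K n lam_neq0)).
Proof. exact: centralizer_cyc_incl. Qed.
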